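(* Let $G$ be an abelian group, $K$ a field, and $\kappa$ a cardinal. Then there exists a $K$-algebra $T$ such that $T$ is a noncommutative simple Dedekind domain, $G(T)\cong G$ (where $G(T)$ is the class group of $T$), and each class of $G(T)$ contains at least $\kappa$ maximal right ideals of $T$.
   Context: Rings are unital. A domain is a not necessarily commutative ring in which $0$ is the unique zero divisor. A Dedekind prime ring is a ring $R$ in which every nonzero submodule of a (left or right) progenerator is a progenerator; equivalently, $R$ is a hereditary Noetherian prime ring which is a maximal order in its simple Artinian quotient ring. A Dedekind domain is a Dedekind prime ring which is also a domain. For a Dedekind prime ring $R$, the uniform dimension of finitely generated projective right modules is additive on direct sums and induces an epimorphism $\operatorname{udim}_R\colon K_0(R)\to\mathbb Z$. The class group of $R$ is $G(R)=\ker(\operatorname{udim}_R)$. Write $\langle P\rangle$ for the class of $P$ in $K_0(R)$. A class $g\in G(R)$ contains an essential right ideal $\mathfrak a$ of $R$ if $g=\langle\mathfrak a\rangle-\langle R\rangle$. (The elements of $G(R)$ correspond in this way to the stable isomorphism classes of essential right ideals of $R$.) *)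

(* Defs.v *)
From HB Require Import structures.
From mathcomp Require Import all_boot all_order all_algebra.
From mathcomp Require Import boolp classical_sets.

Set Implicit Arguments.
Unset Strict Implicit.
Unset Printing Implicit Defensive.

Import GRing.Theory.
Local Open Scope ring_scope.

(* Left R-modules are [lmodType R].  Right R-modules are [lmodType R^c], with
   R^c the opposite ring: for [r : R^c] and [m : M], the element [r *: m] is
   m r. *)

Section Modules.
Variable R : nzRingType.

Definition lmod_iso (M N : lmodType R) : Prop :=
  exists f : {linear M -> N}, bijective f.

Definition submodule (M : lmodType R) (U : set M) : Prop :=
  [/\ U 0, forall x y, U x -> U y -> U (x + y)
    & forall (r : R) x, U x -> U (r *: x)].

Definition finitely_generated (M : lmodType R) : Prop :=
  exists (n : nat) (x : 'I_n -> M),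
    forall y, exists c : 'I_n -> R, y = \sum_(i < n) c i *: x i.

Definition projective (M : lmodType R) : Prop :=
  forall (N N' : lmodType R) (g : {linear N -> N'}) (f : {linear M -> N'}),
    (forall y, exists x, g x = y) -> exists h : {linear M -> N}, g \o h =1 f.

(* Hom(M, -) is faithful. *)
Definition generator (M : lmodType R) : Prop :=
  forall (N N' : lmodType R) (f g : {linear N -> N'}),
    (forall h : {linear M -> N}, f \o h =1 g \o h) -> f =1 g.

Definition progenerator (M : lmodType R) : Prop :=
  [/\ finitely_generated M, projective M & generator M].

(* Submodules are given as injective linear maps. *)
Definition submodules_of_progenerators : Prop :=
  forall (M N : lmodType R) (i : {linear N -> M}),
    progenerator M -> injective i -> (exists x : N, x != 0) -> progenerator N.

(* M contains a direct sum of n nonzero submodules. *)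
Definition has_direct_sum (M : lmodType R) (n : nat) : Prop :=
  exists U : 'I_n -> set M,
    [/\ forall i, submodule (U i), forall i, exists2 x, U i x & x != 0
      & forall u : 'I_n -> M, (forall i, U i (u i)) ->
          \sum_(i < n) u i = 0 -> forall i, u i = 0].

Definition has_udim (M : lmodType R) (n : nat) : Prop :=
  has_direct_sum M n /\ ~ has_direct_sum M n.+1.

Lemma lmod_iso_can (M N : lmodType R) (f : M -> N) (g : N -> M) :
  linear f -> cancel f g -> cancel g f -> lmod_iso M N.
Proof.
move=> fl fK gK.
pose fL := GRing.isLinear.Build R M N *:%R f fl.
pose F : {linear M -> N} := HB.pack f fL.
by exists F; exists g.
Qed.

Lemma lmod_iso_refl (M : lmodType R) : lmod_iso M M.
Proof. exact: (@lmod_iso_can M M id id). Qed.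

Lemma lmod_iso_sym (M N : lmodType R) : lmod_iso M N -> lmod_iso N M.
Proof.
move=> [f [g fK gK]]; apply: (@lmod_iso_can N M g f) => // a x y.
by apply: (can_inj fK); rewrite linearP !gK.
Qed.

Lemma lmod_iso_trans (M N P : lmodType R) :
  lmod_iso M N -> lmod_iso N P -> lmod_iso M P.
Proof.
move=> [f [f' fK f'K]] [g [g' gK g'K]].
apply: (@lmod_iso_can M P (g \o f) (f' \o g')) => [a x y|x|x] /=.
- by rewrite !linearP.
- by rewrite gK fK.
- by rewrite f'K g'K.
Qed.

Lemma lmod_iso_prod (M M' N N' : lmodType R) :
  lmod_iso M M' -> lmod_iso N N' -> lmod_iso (M * N)%type (M' * N')%type.
Proof.
move=> [f [f' fK f'K]] [g [g' gK g'K]].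
apply: (@lmod_iso_can (M * N)%type (M' * N')%type
         (fun x => (f x.1, g x.2)) (fun x => (f' x.1, g' x.2))).
- by move=> a x y; rewrite /= !linearP.
- by case=> x y; rewrite /= fK gK.
- by case=> x y; rewrite /= f'K g'K.
Qed.

Lemma lmod_iso_AC (A B C D : lmodType R) :
  lmod_iso ((A * B) * (C * D))%type ((A * C) * (B * D))%type.
Proof.
by apply: (@lmod_iso_can ((A * B) * (C * D))%type ((A * C) * (B * D))%type
  (fun x => ((x.1.1, x.2.1), (x.1.2, x.2.2)))
  (fun x => ((x.1.1, x.2.1), (x.1.2, x.2.2)))) => // -[[a b] [c d]].
Qed.

Lemma lmod_iso_transl (A B C D E F : lmodType R) :
  lmod_iso ((A * B) * ((C * D) * (E * F)))%type
           (((A * D) * E) * ((C * B) * F))%type.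
Proof.
apply: (@lmod_iso_can ((A * B) * ((C * D) * (E * F)))%type
                      (((A * D) * E) * ((C * B) * F))%type
    (fun x => (x.1.1, x.2.1.2, x.2.2.1, (x.2.1.1, x.1.2, x.2.2.2)))
    (fun x => (x.1.1.1, x.2.1.2, (x.2.1.1, x.1.1.2, (x.1.2, x.2.2))))).
- by move=> a x y; reflexivity.
- by case=> -[? ?] [[? ?] [? ?]]; reflexivity.
- by case=> -[[? ?] ?] [[? ?] ?]; reflexivity.
Qed.

Lemma lmod_iso_transr (A B C D E F : lmodType R) :
  lmod_iso (((A * B) * E) * ((C * D) * F))%type
           ((C * B) * ((A * D) * (E * F)))%type.
Proof.
apply: (@lmod_iso_can (((A * B) * E) * ((C * D) * F))%type
                      ((C * B) * ((A * D) * (E * F)))%type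
    (fun x => (x.2.1.1, x.1.1.2, (x.1.1.1, x.2.1.2, (x.1.2, x.2.2))))
    (fun x => (x.2.1.1, x.1.2, x.2.2.1, (x.1.1, x.2.1.2, x.2.2.2)))).
- by move=> a x y; reflexivity.
- by case=> -[[? ?] ?] [[? ?] ?]; reflexivity.
- by case=> -[? ?] [[? ?] [? ?]]; reflexivity.
Qed.

Lemma finitely_generated_prod (M N : lmodType R) :
  finitely_generated M -> finitely_generated N ->
  finitely_generated (M * N)%type.
Proof.
move=> [m [x xP]] [n [y yP]]; exists (m + n)%N.
exists (fun k => match fintype.split k with
                 | inl i => (x i, 0) | inr j => (0, y j) end).
move=> [a b]; have [c ->] := xP a; have [d ->] := yP b.
exists (fun k => match fintype.split k with inl i => c i | inr j => d j end).
rewrite big_split_ord /=.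
have splitl i : fintype.split (lshift n i) = inl i := unsplitK (inl i).
have splitr j : fintype.split (rshift m j) = inr j := unsplitK (inr j).
under [X in _ = X + _]eq_bigr => i _ do rewrite splitl.
under [X in _ = _ + X]eq_bigr => i _ do rewrite splitr.
have sumE k (G : 'I_k -> M * N) :
    \sum_(i < k) G i = (\sum_(i < k) (G i).1, \sum_(i < k) (G i).2).
  elim: k G => [|k IH] G; first by rewrite !big_ord0.
  by rewrite !big_ord_recl IH; case: (G ord0).
have eqP' (u v : M * N) : u.1 = v.1 -> u.2 = v.2 -> u = v.
  by case: u v => [? ?] [? ?] /= -> ->.
rewrite !sumE; apply: eqP' => /=.
- by rewrite [X in _ + X]big1 ?addr0 // => i _; rewrite scaler0.
- by rewrite [X in X + _]big1 ?add0r // => i _; rewrite scaler0.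
Qed.

Lemma projective_prod (M N : lmodType R) :
  projective M -> projective N -> projective (M * N)%type.
Proof.
move=> pM pN A B g f gs.
have f1l : linear (fun x : M => f (x, 0)).
  move=> a x y; rewrite -linearP; congr (f _).
  by apply/pair_equal_spec; split=> //=; rewrite scaler0 addr0.
have f2l : linear (fun y : N => f (0, y)).
  move=> a x y; rewrite -linearP; congr (f _).
  by apply/pair_equal_spec; split=> //=; rewrite scaler0 addr0.
pose f1m := GRing.isLinear.Build R M B *:%R _ f1l.
pose f2m := GRing.isLinear.Build R N B *:%R _ f2l.
pose f1 : {linear M -> B} := HB.pack (fun x : M => f (x, 0)) f1m.
pose f2 : {linear N -> B} := HB.pack (fun y : N => f (0, y)) f2m.
have [h1 h1E] := pM A B g f1 gs; have [h2 h2E] := pN A B g f2 gs.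
have hl : linear (fun x : M * N => h1 x.1 + h2 x.2).
  by move=> a x y; rewrite /= !linearP scalerDr addrACA.
pose hm := GRing.isLinear.Build R (M * N)%type A *:%R _ hl.
pose h : {linear (M * N)%type -> A} :=
  HB.pack (fun x : M * N => h1 x.1 + h2 x.2) hm.
exists h => -[x y]; rewrite /= linearD.
have /= -> := h1E x; have /= -> := h2E y.
by rewrite -linearD; congr (f _); apply/pair_equal_spec; rewrite /= addr0 add0r.
Qed.

Lemma finitely_generated_regular : finitely_generated (R^o).
Proof.
exists 1%N, (fun _ => 1) => y; exists (fun _ => y).
by rewrite big_ord1 -[RHS]/((y : R) * 1) mulr1.
Qed.

Lemma projective_regular : projective (R^o).
Proof.
move=> N N' g f gs; have [x xE] := gs (f 1).
have hl : linear (fun r : R^o => (r : R) *: x).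
  by move=> a r s; rewrite scalerDl scalerA.
pose hm := GRing.isLinear.Build R (R^o) N *:%R _ hl.
pose h : {linear R^o -> N} := HB.pack (fun r : R^o => (r : R) *: x) hm.
exists h => r; rewrite /= linearZ xE /= -linearZ; congr (f _).
exact: mulr1.
Qed.

End Modules.

Definition dedekind_prime_ring (R : nzRingType) : Prop :=
  submodules_of_progenerators R /\ submodules_of_progenerators R^c.

Definition is_domain (R : nzRingType) : Prop :=
  forall x y : R, x * y = 0 -> x = 0 \/ y = 0.

Definition dedekind_domain (R : nzRingType) : Prop :=
  dedekind_prime_ring R /\ is_domain R.

Definition noncommutative (R : nzRingType) : Prop :=
  exists x y : R, x * y <> y * x.

Definition right_ideal (R : nzRingType) (a : set R) : Prop :=
  [/\ a 0, forall x y, a x -> a y -> a (x + y)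
    & forall x r, a x -> a (x * r)].

Definition two_sided_ideal (R : nzRingType) (a : set R) : Prop :=
  right_ideal a /\ forall r x, a x -> a (r * x).

Definition simple_ring (R : nzRingType) : Prop :=
  forall a : set R, two_sided_ideal a -> a = [set 0]%classic \/ a = [set: R]%classic.

Definition maximal_right_ideal (R : nzRingType) (a : set R) : Prop :=
  [/\ right_ideal a, a <> [set: R]%classic
    & forall b : set R, right_ideal b -> (a `<=` b)%classic ->
        b = a \/ b = [set: R]%classic].

Definition essential_right_ideal (R : nzRingType) (a : set R) : Prop :=
  right_ideal a /\
  forall b : set R, right_ideal b -> (exists2 x, b x & x != 0) ->
    exists x, [/\ a x, b x & x != 0].

(* K_0(R) is the Grothendieck group of finitely generated projective right
   R-modules.  The quotient is taken over the large type of all such modules,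
   so its universe is too high for a [zmodType] instance; its addition is
   [K0_add]. *)

Record fgproj (R : nzRingType) := FGProj {
  fgproj_mod :> lmodType R^c;
  fgproj_fg : finitely_generated fgproj_mod;
  fgproj_proj : projective fgproj_mod }.

Section K0.
Variable R : nzRingType.

Definition fgproj_sum (P Q : fgproj R) : fgproj R :=
  FGProj (finitely_generated_prod (fgproj_fg P) (fgproj_fg Q))
         (projective_prod (@fgproj_proj R P) (@fgproj_proj R Q)).

(* R as a right module over itself. *)
Definition fgproj_regular : fgproj R :=
  FGProj (finitely_generated_regular R^c) (@projective_regular R^c).

(* The pair (P, Q) stands for the formal difference <P> - <Q>. *)
Definition K0_eqv (x y : fgproj R * fgproj R) : Prop :=
  exists S : fgproj R,
    lmod_iso (fgproj_sum (fgproj_sum x.1 y.2) S)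
             (fgproj_sum (fgproj_sum y.1 x.2) S).

Definition K0_presum (x y : fgproj R * fgproj R) : fgproj R * fgproj R :=
  (fgproj_sum x.1 y.1, fgproj_sum x.2 y.2).

Lemma K0_eqv_refl x : K0_eqv x x.
Proof. by exists fgproj_regular; apply: lmod_iso_refl. Qed.

Lemma K0_eqv_sym x y : K0_eqv x y -> K0_eqv y x.
Proof. by move=> [S /lmod_iso_sym xy]; exists S. Qed.

Lemma K0_eqv_trans y x z : K0_eqv x y -> K0_eqv y z -> K0_eqv x z.
Proof.
case: x y z => [P Q] [P' Q'] [P'' Q''] [S /= xy] [S' /= yz].
exists (fgproj_sum (fgproj_sum P' Q') (fgproj_sum S S')) => /=.
pose LHS : lmodType R^c := ((P * Q' * S) * (P' * Q'' * S'))%type.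
pose RHS : lmodType R^c := ((P' * Q * S) * (P'' * Q' * S'))%type.
apply: (@lmod_iso_trans _ _ LHS); first exact: lmod_iso_transl.
apply: (@lmod_iso_trans _ _ RHS); first exact: lmod_iso_prod xy yz.
exact: lmod_iso_transr.
Qed.

Lemma K0_eqv_presum x x' y y' :
  K0_eqv x x' -> K0_eqv y y' -> K0_eqv (K0_presum x y) (K0_presum x' y').
Proof.
case: x x' y y' => [P Q] [P' Q'] [A B] [A' B'] [S /= xx] [S' /= yy].
exists (fgproj_sum S S') => /=.
have sw (C D C' D' : fgproj R) :
    lmod_iso ((C * D * S) * (C' * D' * S'))%type
             ((C * C') * (D * D') * (S * S'))%type.
  apply: lmod_iso_trans; first exact: lmod_iso_AC.
  by apply: lmod_iso_prod; [exact: lmod_iso_AC | exact: lmod_iso_refl].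
apply: lmod_iso_trans (sw P' Q A' B).
exact: lmod_iso_trans (lmod_iso_sym (sw P Q' A B')) (lmod_iso_prod xx yy).
Qed.

Record K0 := MkK0 {
  K0_class : fgproj R * fgproj R -> Prop;
  K0_classP : exists x, K0_class = K0_eqv x }.

(* The element <P> - <Q>. *)
Definition K0_diff (P Q : fgproj R) : K0 :=
  MkK0 (ex_intro (fun x => K0_eqv (P, Q) = K0_eqv x) (P, Q) erefl).

Lemma K0_add_subproof (x y : K0) :
  exists w, (fun z => exists u v,
    [/\ K0_class x u, K0_class y v & K0_eqv (K0_presum u v) z]) = K0_eqv w.
Proof.
have [p ->] := K0_classP x; have [q ->] := K0_classP y.
exists (K0_presum p q); apply/funext => z; apply/propext.
split=> [[u [v [xu yv uvz]]]|xyz].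
  exact: K0_eqv_trans (K0_eqv_presum xu yv) uvz.
by exists p, q; split=> //; exact: K0_eqv_refl.
Qed.

Definition K0_add (x y : K0) : K0 := MkK0 (K0_add_subproof x y).

Lemma K0_eq (x y : K0) : K0_class x = K0_class y -> x = y.
Proof.
case: x y => [X XP] [Y YP] /= XY; subst Y.
by congr MkK0; exact: Prop_irrelevance.
Qed.

Lemma K0_diff_eq P Q P' Q' :
  K0_diff P Q = K0_diff P' Q' <-> K0_eqv (P, Q) (P', Q').
Proof.
split=> [/(congr1 K0_class) /= ->|PQ]; first exact: K0_eqv_refl.
apply: K0_eq; apply/funext => z; apply/propext; split; apply: K0_eqv_trans => //.
exact: K0_eqv_sym.
Qed.

Lemma K0_add_diff P Q P' Q' :
  K0_add (K0_diff P Q) (K0_diff P' Q') =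
  K0_diff (fgproj_sum P P') (fgproj_sum Q Q').
Proof.
apply: K0_eq; apply/funext => z; apply/propext.
split=> [[u [v [xu yv uvz]]]|xyz].
  exact: K0_eqv_trans (K0_eqv_presum xu yv) uvz.
by exists (P, Q), (P', Q'); split=> //; exact: K0_eqv_refl.
Qed.

(* The graph of the homomorphism K_0(R) -> Z induced by udim; it is the graph
   of a function as soon as finitely generated projective right modules have
   finite uniform dimension, e.g. for R a Dedekind prime ring. *)
Definition K0_udim (x : K0) (z : int) : Prop :=
  exists (P Q : fgproj R) (m n : nat),
    [/\ x = K0_diff P Q, has_udim P m, has_udim Q n & z = m%:Z - n%:Z].

(* G(R) = ker(udim_R) as a subset of K_0(R). *)
Definition class_group (x : K0) : Prop := K0_udim x 0.

Definition class_group_isom (G : zmodType) : Prop :=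
  exists phi : G -> K0,
    [/\ forall a b, phi (a + b) = K0_add (phi a) (phi b), injective phi
      & forall x, class_group x <-> exists a, phi a = x].

(* The right R-module underlying the right ideal [a] is given, up to
   isomorphism, as a module P with an embedding into R of image [a]. *)
Definition class_contains (g : K0) (a : set R) : Prop :=
  essential_right_ideal a /\
  exists (P : fgproj R) (i : {linear P -> (R^c)^o}),
    [/\ injective i, forall x : R, a x <-> exists p, i p = x
      & g = K0_diff P fgproj_regular].

End K0.

(* Main.v *)
(* Let D be the free abelian group on G, and R the polynomial ring over K whose
   variables are indexed by triples (l, k, n) with l a list of elements of G, k in
   option kappa and n an integer, the degree of this variable being the sum of l in
   D. Inverting the homogeneous primes that are not associated to a variable and
   whose degree is in the kernel of D -> G gives a D-graded domain U: for coprime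
   homogeneous f and g and new variables y and z of suitable degrees, f y + g z is
   an inverted prime, so that homogeneous ideals of U are principal. Let sg be the
   automorphism n |-> n + 1 and T = U_0[x, 1/x; sg].
   Since no nonunit of U is fixed by a power of sg up to units, T is simple, and
   for a prime p of degree e the module W_d / W_{d - e} p is simple, where
   W_d = U_d[x, 1/x; sg]. Removing the primes of a left ideal one by one shows that
   it is projective and stably isomorphic to some W_d. The isomorphisms
   W_a + W_b = W_{a + b} + W_0, given by 2 x 2 matrices of determinant 1 over U,
   then show that the class of W_d depends only on the image of d in G; conversely
   this image is an invariant, because a matrix over L[x, 1/x; sg] maps the vectors
   of bounded degree to finite rank lattices over U_0 whose class can be computed
   from its extreme coefficients in two ways. Finally W_{-e} p is a maximal ideal,
   and the variables of degree e = [g] give kappa of them in each class. *)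
Require Import Defs.
From HB Require Import structures.
From mathcomp Require Import all_boot all_order all_algebra perm.
From mathcomp Require Import boolp classical_sets zify ring finmap.
From mathcomp.multinomials Require Import monalg.

Set Implicit Arguments.
Unset Strict Implicit.
Unset Printing Implicit Defensive.

Import Order.TTheory GRing.Theory Num.Theory.
Local Open Scope ring_scope.

(** * Modules *)

(** The ring [U_0] is a commutative Dedekind domain with class group G: its nonzero ideals have the
    form [U_(-d) c] with c in [U_d], and [U_d] is an invertible module whose class is the image of
    d. The grading thus replaces ideals of [U_0] by homogeneous elements, which have gcds and prime
    factors, and [W_d] is the T-module generated by [U_d]. As sg preserves degrees, it acts
    trivially on these classes; this is why passing from [U_0] to T yields a simple noncommutative
    ring without collapsing the class group. The Dedekind condition concerns both sides and the
    class group concerns right modules, whereas the proof treats left modules only. It is carried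
    out for the two interfaces [graded_pid] and [skew_laurent]. The opposite of T satisfies them
    again, with sg replaced by its inverse, so each result is available on both sides. *)

Section ModuleTools.
Variable R : nzRingType.
Implicit Types M N P Q : lmodType R.

Definition mklin M N (f : M -> N) (fl : linear f) : {linear M -> N} :=
  HB.pack f (GRing.isLinear.Build R M N *:%R f fl).

Lemma mklinE M N (f : M -> N) (fl : linear f) : mklin fl =1 f.
Proof. by []. Qed.

Lemma lmod_iso_bij M N (f : {linear M -> N}) :
  injective f -> (forall y, exists x, f x = y) -> lmod_iso M N.
Proof.
move=> fI fS; have [g gK] := choice fS.
apply: (@lmod_iso_can R M N f g) => //; first exact: linearP.
by move=> x; apply: fI; rewrite gK.
Qed.

Lemma lmod_isoP M N : lmod_iso M N ->
  exists (f : {linear M -> N}) (g : {linear N -> M}), cancel f g /\ cancel g f.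
Proof.
move=> [f [g fK gK]]; have gl : linear g.
  by move=> a x y; apply: (can_inj fK); rewrite linearP !gK.
by exists f, (mklin gl).
Qed.

(** The closure proof is an argument of the type, so that the module structure can be found from the
    type alone; membership is made boolean to form a subtype. *)
Definition submod_car M (U : set M) of submodule U := {x : M | `[< U x >]}.

Section Submod.
Variables (M : lmodType R) (U : set M) (hU : submodule U).

HB.instance Definition _ := SubType.on (submod_car hU).
HB.instance Definition _ := Choice.on (submod_car hU).

Fact submod_car_closed : subsemimod_closed (fun x : M => `[< U x >]).
Proof.
case: hU => U0 UD UZ; split; first split.
- exact/asboolP.
- by move=> x y /asboolP ? /asboolP ?; apply/asboolP; apply: UD.
- by move=> a x /asboolP ?; apply/asboolP; apply: UZ.
Qed.

HB.instance Definition _ :=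
  GRing.SubChoice_isSubLmodule.Build R M _ (submod_car hU) submod_car_closed.

Definition submod : lmodType R := submod_car hU.

Definition sval_fun (x : submod) : M := \val x.

Fact sval_fun_linear : linear sval_fun.
Proof. by []. Qed.

Definition sval_lin : {linear submod -> M} := mklin sval_fun_linear.

Lemma sval_linP (x : submod) : U (sval_lin x).
Proof. exact: (elimT (asboolP _) (valP x)). Qed.

Lemma sval_lin_inj : injective sval_lin.
Proof. exact: val_inj. Qed.

Definition msub (x : M) (Ux : U x) : submod :=
  exist _ x (introT (asboolP _) Ux).

Lemma msubK x (Ux : U x) : sval_lin (msub Ux) = x.
Proof. by []. Qed.

Lemma submod_lift (N : lmodType R) (f : {linear N -> M}) :
  (forall x, U (f x)) -> exists g : {linear N -> submod}, forall x, sval_lin (g x) = f x.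
Proof.
move=> Uf; pose g x := msub (Uf x).
have gl : linear g by move=> a x y; apply: sval_lin_inj; rewrite linearP !msubK linearP.
by exists (mklin gl).
Qed.

End Submod.

Arguments sval_lin {M U hU} : simpl never.
Arguments sval_linP {M U hU}.
Arguments sval_lin_inj {M U hU}.

Lemma submod_iso M N (U : set M) (V : set N) (hU : submodule U) (hV : submodule V)
    (f : {linear M -> N}) :
  (forall x, U x -> V (f x)) -> (forall x, U x -> f x = 0 -> x = 0) ->
  (forall y, V y -> exists2 x, U x & f x = y) ->
  lmod_iso (submod hU) (submod hV).
Proof.
move=> fUV fI fS.
pose f0 : {linear submod hU -> N} := f \o sval_lin.
have [g gE] : exists g : {linear submod hU -> submod hV},
    forall x, sval_lin (g x) = f0 x.
  by apply: submod_lift => x; apply: fUV; exact: sval_linP.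
apply: (@lmod_iso_bij _ _ g) => [x y gxy|y].
  apply: sval_lin_inj; apply/eqP; rewrite -subr_eq0; apply/eqP.
  rewrite -linearB; apply: fI; first exact: sval_linP.
  by rewrite -[LHS]/(f0 (x - y)) -gE linearB gxy subrr linear0.
have [x Ux fx] := fS _ (sval_linP y); exists (msub hU Ux).
by apply: sval_lin_inj; rewrite gE.
Qed.

Lemma ker_submodule M N (f : {linear M -> N}) : submodule (fun x => f x = 0).
Proof.
split=> [|x y fx fy|r x fx]; first by rewrite linear0.
  by rewrite linearD fx fy addr0.
by rewrite linearZZ fx scaler0.
Qed.

Lemma range_submodule M N (f : {linear M -> N}) :
  submodule (fun y => exists x, f x = y).
Proof.
split=> [|_ _ [x <-] [y <-]|r _ [x <-]]; first by exists 0; rewrite linear0.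
  by exists (x + y); rewrite linearD.
by exists (r *: x); rewrite linearZZ.
Qed.

Lemma projective_split M P (f : {linear M -> P}) : projective P ->
  (forall y, exists x, f x = y) ->
  lmod_iso M (submod (ker_submodule f) * P)%type.
Proof.
move=> pP fS; have [h fh] := pP _ _ f idfun fS.
have hl : linear (fun x : submod (ker_submodule f) * P => sval_lin x.1 + h x.2).
  by move=> a x y; rewrite /= !linearP scalerDr addrACA.
apply/lmod_iso_sym/(@lmod_iso_bij _ _ (mklin hl)).
- move=> x y; rewrite !mklinE => xy.
  have e : x.2 = y.2.
    have k1 : f (sval_lin x.1) = 0 := sval_linP x.1.
    have k2 : f (sval_lin y.1) = 0 := sval_linP y.1.
    move: (congr1 f xy); rewrite !linearD k1 k2 !add0r.
    by move: (fh x.2) (fh y.2) => /= -> ->.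
  rewrite e in xy; have e1 : x.1 = y.1.
    by apply: sval_lin_inj; exact: (addIr (h y.2)) xy.
  by case: x y e e1 {xy} => ? ? [? ?] /= -> ->.
- move=> y.
  have Ky : f (y - h (f y)) = 0.
    by rewrite linearB; move: (fh (f y)) => /= ->; rewrite subrr.
  exists (msub (ker_submodule f) Ky, f y).
  exact: subrK.
Qed.

Lemma finitely_generated_surj M N (f : {linear M -> N}) :
  (forall y, exists x, f x = y) -> finitely_generated M -> finitely_generated N.
Proof.
move=> fS [n [x xP]]; exists n, (f \o x) => y.
have [z <-] := fS y; have [c ->] := xP z; exists c.
by rewrite linear_sum; apply: eq_bigr => i _; rewrite linearZZ.
Qed.

Lemma projective_retract M N (f : {linear M -> N}) (g : {linear N -> M}) :
  cancel f g -> projective N -> projective M.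
Proof.
move=> fK pN A B p q pS; have [h hE] := pN A B p (q \o g) pS.
by exists (h \o f) => x /=; move: (hE (f x)) => /= ->; rewrite fK.
Qed.

Lemma lmod_iso_inj M N : lmod_iso M N -> exists f : {linear M -> N}, injective f.
Proof. by move=> [f /bij_inj]; exists f. Qed.

Lemma fg_iso M N : lmod_iso M N -> finitely_generated M -> finitely_generated N.
Proof.
by move=> /lmod_isoP[f [g [fK gK]]]; apply: (finitely_generated_surj (f := f)) => y; exists (g y).
Qed.

Lemma proj_iso M N : lmod_iso M N -> projective M -> projective N.
Proof. by move=> /lmod_isoP[f [g [fK gK]]]; exact: projective_retract gK. Qed.

Fact inl_linear M N : linear (fun x : M => (x, 0) : (M * N)%type).
Proof. by move=> a x y; apply/pair_equal_spec; split; rewrite //= scaler0 addr0. Qed.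

Fact inr_linear M N : linear (fun x : N => (0, x) : (M * N)%type).
Proof. by move=> a x y; apply/pair_equal_spec; split; rewrite //= scaler0 addr0. Qed.

Fact fst_linear M N : linear (fst : (M * N)%type -> M).
Proof. by []. Qed.

Fact snd_linear M N : linear (snd : (M * N)%type -> N).
Proof. by []. Qed.

Lemma proj_fst M N : projective (M * N)%type -> projective M.
Proof. by apply: (@projective_retract _ _ (mklin (@inl_linear M N)) (mklin (@fst_linear M N))). Qed.

Lemma fg_fst M N : finitely_generated (M * N)%type -> finitely_generated M.
Proof.
by apply: (finitely_generated_surj (f := mklin (@fst_linear M N))) => y; exists (y, 0).
Qed.

Lemma lmod_isoC M N : lmod_iso (M * N)%type (N * M)%type.
Proof.
apply: (@lmod_iso_can _ (M * N)%type (N * M)%type (fun x => (x.2, x.1)) (fun x => (x.2, x.1))).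
- by move=> a x y; reflexivity.
- by case=> ? ?; reflexivity.
- by case=> ? ?; reflexivity.
Qed.

Lemma lmod_isoA M N P : lmod_iso (M * (N * P))%type ((M * N) * P)%type.
Proof.
apply: (@lmod_iso_can _ (M * (N * P))%type ((M * N) * P)%type
  (fun x => (x.1, x.2.1, x.2.2)) (fun x => (x.1.1, (x.1.2, x.2)))).
- by move=> a x y; reflexivity.
- by case=> ? [? ?]; reflexivity.
- by case=> [[? ?] ?]; reflexivity.
Qed.

End ModuleTools.

Arguments sval_lin {R M U hU} : simpl never.
Arguments sval_linP {R M U hU}.
Arguments sval_lin_inj {R M U hU}.

(** * Restriction of scalars *)

Section RestrictScalars.
Variables (R S : nzRingType) (f : {rmorphism R -> S}) (M : lmodType S).

(** A copy of [M], so that the two scalar actions do not compete. It makes B and rows over B into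
    modules over T, and rows over B into vector spaces over L. *)
Definition resmod_car : Type := M.
HB.instance Definition _ := GRing.Zmodule.on resmod_car.

Definition resmod_scale (a : R) (x : resmod_car) : resmod_car := f a *: (x : M).

Fact resmod_scaleA a b v : resmod_scale a (resmod_scale b v) = resmod_scale (a * b) v.
Proof. by rewrite /resmod_scale scalerA rmorphM. Qed.
Fact resmod_scale1 : left_id 1 resmod_scale.
Proof. by move=> x; rewrite /resmod_scale rmorph1 scale1r. Qed.
Fact resmod_scaleDr : right_distributive resmod_scale +%R.
Proof. by move=> a x y; rewrite /resmod_scale scalerDr. Qed.
Fact resmod_scaleDl v : {morph resmod_scale^~ v : a b / a + b}.
Proof. by move=> a b; rewrite /resmod_scale rmorphD scalerDl. Qed.

HB.instance Definition _ := GRing.Zmodule_isLmodule.Build R resmod_car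
  resmod_scaleA resmod_scale1 resmod_scaleDr resmod_scaleDl.

Definition resmod : lmodType R := resmod_car.

Lemma resmodZ (a : R) (x : resmod) : a *: x = f a *: (x : M).
Proof. by []. Qed.

End RestrictScalars.

(** * Reflexive tactics *)

Inductive zexpr := ZVar of nat | ZZero | ZAdd of zexpr & zexpr | ZOpp of zexpr.

Section ZExpr.
Variable V : zmodType.

Fixpoint zeval (e : seq V) t : V :=
  match t with
  | ZVar i => nth 0 e i | ZZero => 0 | ZAdd a b => zeval e a + zeval e b
  | ZOpp a => - zeval e a end.

Fixpoint zcoef t (i : nat) : int :=
  match t with
  | ZVar j => (i == j)%:R | ZZero => 0 | ZAdd a b => zcoef a i + zcoef b i
  | ZOpp a => - zcoef a i end.

Lemma zevalE e t : zeval e t = \sum_(i < size e) nth 0 e i *~ zcoef t i.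
Proof.
elim: t => [j||a IHa b IHb|a IHa] /=.
- have [jlt|jge] := ltnP j (size e); last first.
    rewrite nth_default // big1 // => i _; case: eqP => [ij|]; rewrite ?mulr0z //.
    by move: (ltn_ord i); rewrite ij ltnNge jge.
  rewrite (bigD1 (Ordinal jlt)) //= eqxx mulr1z big1 ?addr0 // => i.
  by rewrite -val_eqE /= => /negPf ->; rewrite mulr0z.
- by rewrite big1 // => i _; rewrite mulr0z.
- by rewrite IHa IHb -big_split; apply: eq_bigr => i _; rewrite mulrzDr.
- by rewrite IHa -sumrN; apply: eq_bigr => i _; rewrite mulrNz.
Qed.

(** Integer combinations of the same atoms agree when their coefficients do, which computation
    checks. The tactic [zmod] built on this settles identities between degrees, which live in a mere
    abelian group. *)
Lemma zexprP e s t :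
  all (fun i => zcoef s i == zcoef t i) (iota 0 (size e)) -> zeval e s = zeval e t.
Proof.
move=> /allP st; rewrite !zevalE; apply: eq_bigr => i _.
by congr (_ *~ _); apply/eqP/st; rewrite mem_iota add0n leq0n /= ltn_ord.
Qed.
End ZExpr.

Ltac zinsert x l :=
  match l with
  | x :: _ => l
  | ?y :: ?l' => let l1 := zinsert x l' in constr:(y :: l1)
  | _ => constr:(x :: l)
  end.
Ltac zatoms l t :=
  match t with
  | (?a + ?b)%R => let l1 := zatoms l a in zatoms l1 b
  | (- ?a)%R => zatoms l a
  | 0%R => l
  | _ => zinsert t l
  end.
Ltac zindex x l :=
  match l with
  | x :: _ => constr:(0%N)
  | _ :: ?l' => let n := zindex x l' in constr:((S n)%N)
  end.
Ltac zreify l t :=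
  match t with
  | (?a + ?b)%R => let a' := zreify l a in let b' := zreify l b in constr:(ZAdd a' b')
  | (- ?a)%R => let a' := zreify l a in constr:(ZOpp a')
  | 0%R => constr:(ZZero)
  | _ => let n := zindex t l in constr:(ZVar n)
  end.
Ltac zmod :=
  match goal with
  | |- @eq ?T ?s ?t =>
    let l0 := constr:(@nil T) in
    let l1 := zatoms l0 s in
    let l := zatoms l1 t in
    let s' := zreify l s in
    let t' := zreify l t in
    apply: (@zexprP _ l s' t'); vm_compute; reflexivity
  end.

(** * Direct sums up to isomorphism, stable isomorphism, free modules *)

Section ModuleAC.
Variable R : nzRingType.
Implicit Types M N P Q : lmodType R.

Inductive mexpr := MVar of nat | MProd of mexpr & mexpr.

Definition zmodule : lmodType R := 'rV[R]_0.

Lemma lmod_iso_prod0 M : lmod_iso (M * zmodule)%type M.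
Proof.
apply: (@lmod_iso_can _ (M * zmodule)%type M (fun x => x.1) (fun x => (x, 0))) => //.
by case=> x y; apply/pair_equal_spec; split=> //; rewrite /= [y]thinmx0.
Qed.

Fixpoint msum (s : seq (lmodType R)) : lmodType R :=
  if s is M :: s' then (M * msum s')%type else zmodule.

Lemma lmod_iso_prodl M N P : lmod_iso M N -> lmod_iso (M * P)%type (N * P)%type.
Proof. by move=> MN; apply: lmod_iso_prod MN (lmod_iso_refl P). Qed.

Lemma lmod_iso_prodr M N P : lmod_iso M N -> lmod_iso (P * M)%type (P * N)%type.
Proof. by move=> MN; apply: lmod_iso_prod (lmod_iso_refl P) MN. Qed.

Lemma msum_cat s t : lmod_iso (msum s * msum t)%type (msum (s ++ t)).
Proof.
elim: s => [|M s IHs] /=.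
  exact: lmod_iso_trans (lmod_isoC _ _) (lmod_iso_prod0 _).
exact: lmod_iso_trans (lmod_iso_sym (lmod_isoA _ _ _)) (lmod_iso_prodr _ IHs).
Qed.

Section Env.
Variable e : nat -> lmodType R.

Lemma msum_rem k s : k \in s -> lmod_iso (msum [seq e i | i <- s]) (e k * msum [seq e i | i <- rem k s])%type.
Proof.
elim: s => //= i s IHs; rewrite inE eq_sym; case: eqP => [->|_] /= ks; first exact: lmod_iso_refl.
apply: lmod_iso_trans (lmod_iso_prodr _ (IHs ks)) _.
apply: lmod_iso_trans (lmod_isoA _ _ _) _.
apply: lmod_iso_trans (lmod_iso_prodl _ (lmod_isoC _ _)) _.
exact: lmod_iso_sym (lmod_isoA _ _ _).
Qed.

Lemma msum_perm s t : perm_eq s t -> lmod_iso (msum [seq e i | i <- s]) (msum [seq e i | i <- t]).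
Proof.
elim: s t => [|k s IHs] t st.
  by have := perm_size st; case: t {st} => // _; exact: lmod_iso_refl.
have kt : k \in t by rewrite -(perm_mem st) inE eqxx.
apply: lmod_iso_trans (lmod_iso_sym (msum_rem kt)) => /=.
apply/lmod_iso_prodr/IHs; rewrite -(perm_cons k).
exact: perm_trans st (perm_to_rem kt).
Qed.

Fixpoint meval t : lmodType R :=
  match t with MVar i => e i | MProd a b => (meval a * meval b)%type end.

Fixpoint mflat t := match t with MVar i => [:: i] | MProd a b => mflat a ++ mflat b end.

Lemma mevalE t : lmod_iso (meval t) (msum [seq e i | i <- mflat t]).
Proof.
elim: t => [i|a IHa b IHb] /=; first exact: lmod_iso_sym (lmod_iso_prod0 _).
rewrite map_cat; apply: lmod_iso_trans (lmod_iso_prod IHa IHb) _.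
exact: msum_cat.
Qed.

(** A direct sum depends up to isomorphism only on the multiset of its summands; [mod_ac] thereby
    reduces a rearrangement to comparing two lists of indices. *)
Lemma mexprP s t : perm_eq (mflat s) (mflat t) -> lmod_iso (meval s) (meval t).
Proof.
move=> st; apply: lmod_iso_trans (mevalE s) _.
exact: lmod_iso_trans (msum_perm st) (lmod_iso_sym (mevalE t)).
Qed.
End Env.

(** As in [K0_eqv], the complement may be any finitely generated projective module. *)
Definition stably_iso M N := exists Q, [/\ finitely_generated Q, projective Q
  & lmod_iso (M * Q)%type (N * Q)%type].

Lemma iso_stably M N : lmod_iso M N -> stably_iso M N.
Proof.
move=> MN; exists (R^o); split; [exact: finitely_generated_regular|exact: projective_regular|].
exact: lmod_iso_prodl.
Qed.

Lemma stably_trans M N P : stably_iso M N -> stably_iso N P -> stably_iso M P.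
Proof.
move=> [Q [fQ pQ MN]] [S [fS pS NP]]; exists (Q * S)%type; split.
- exact: finitely_generated_prod.
- exact: projective_prod.
apply: lmod_iso_trans (lmod_isoA _ _ _) _.
apply: lmod_iso_trans (lmod_iso_prodl _ MN) _.
apply: lmod_iso_trans (lmod_iso_sym (lmod_isoA _ _ _)) _.
apply: lmod_iso_trans (lmod_iso_prodr _ (lmod_isoC _ _)) _.
apply: lmod_iso_trans (lmod_isoA _ _ _) _.
apply: lmod_iso_trans (lmod_iso_prodl _ NP) _.
apply: lmod_iso_trans (lmod_iso_sym (lmod_isoA _ _ _)) _.
exact: lmod_iso_prodr (lmod_isoC _ _).
Qed.

Lemma stably_sym M N : stably_iso M N -> stably_iso N M.
Proof. by move=> [Q [? ? /lmod_iso_sym]]; exists Q. Qed.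

Lemma stably_prod M N M' N' : stably_iso M N -> stably_iso M' N' ->
  stably_iso (M * M')%type (N * N')%type.
Proof.
move=> [Q [fQ pQ MN]] [S [fS pS NP]]; exists (Q * S)%type; split.
- exact: finitely_generated_prod.
- exact: projective_prod.
apply: lmod_iso_trans (lmod_iso_AC _ _ _ _) _.
exact: lmod_iso_trans (lmod_iso_prod MN NP) (lmod_iso_AC _ _ _ _).
Qed.

Definition embeds M N := exists f : {linear M -> N}, injective f.

Lemma embeds_trans M N P : embeds M N -> embeds N P -> embeds M P.
Proof. by move=> [f fI] [g gI]; exists (g \o f); exact: inj_comp. Qed.

Lemma embeds_iso M N : lmod_iso M N -> embeds M N.
Proof. exact: lmod_iso_inj. Qed.

Lemma embeds_prod M N M' N' : embeds M N -> embeds M' N' -> embeds (M * M')%type (N * N')%type.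
Proof.
move=> [p pI] [q qI]; have hl : linear (fun x : M * M' => (p x.1, q x.2) : N * N').
  by move=> t x y; apply/pair_equal_spec; split; exact: linearP.
by exists (mklin hl) => -[x y] [x' y'] [/pI -> /qI ->].
Qed.

Definition free_mod n : lmodType R := 'rV[R]_n.

Lemma free_modS n : lmod_iso (free_mod n.+1) (R^o * free_mod n)%type.
Proof.
apply/lmod_iso_sym/(@lmod_iso_can _ (R^o * free_mod n)%type (free_mod n.+1)
  (fun x => row_mx ((x.1 : R)%:M : 'M_1) (x.2 : 'rV[R]_n) : 'rV_(1 + n))
  (fun v => ((v : 'rV[R]_(1 + n)) 0 0 : R^o, rsubmx (v : 'rV[R]_(1 + n))))).
- move=> a x y; apply/rowP => k; rewrite !mxE.
  case: fintype.splitP => l _; rewrite !mxE // ord1 eqxx !mulr1n //.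
- case=> x v; apply/pair_equal_spec; split.
    have -> : (0 : 'I_(1 + n)) = lshift n 0 by apply: val_inj.
    by rewrite row_mxEl mxE eqxx.
  by rewrite row_mxKr.
- move=> v; apply/rowP => k; rewrite !mxE.
  case: fintype.splitP => l kl; rewrite mxE.
    by rewrite [l]ord1 eqxx mulr1n; congr (fun_of_matrix v _ _); apply: val_inj; rewrite /= kl [l]ord1.
  by congr (fun_of_matrix v _ _); apply: val_inj; rewrite /= kl.
Qed.

Lemma free_mod_fgproj n : finitely_generated (free_mod n) /\ projective (free_mod n).
Proof.
elim: n => [|n [fn pn]].
  split; first by exists 0%N, (fun=> 0) => y; exists (fun=> 0); rewrite big_ord0 [y]thinmx0.
  move=> N N' g f gS.
  have l0 : linear (fun _ : free_mod 0 => 0 : N) by move=> a x y; rewrite scaler0 addr0.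
  by exists (mklin l0) => x; rewrite [x]thinmx0 /= !linear0.
have iso := lmod_iso_sym (free_modS n); split.
  by apply: fg_iso iso _; apply: finitely_generated_prod => //; exact: finitely_generated_regular.
by apply: proj_iso iso _; apply: projective_prod => //; exact: projective_regular.
Qed.

Lemma fgproj_embed M : finitely_generated M -> projective M ->
  exists n N, lmod_iso (free_mod n) (N * M)%type.
Proof.
move=> [n [x xP]] pM.
have gl : linear (fun v : free_mod n => \sum_(i < n) (v : 'rV[R]_n) 0 i *: x i).
  move=> a u v; rewrite scaler_sumr -big_split; apply: eq_bigr => i _ /=.
  by rewrite !mxE scalerDl scalerA.
have gS y : exists v, mklin gl v = y.
  have [c ->] := xP y; exists (\row_i c i).
  by rewrite mklinE; apply: eq_bigr => i _; rewrite mxE.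
by exists n, (submod (ker_submodule (mklin gl))); exact: projective_split.
Qed.

End ModuleAC.

Ltac matoms l t :=
  match t with
  | reverse_coercion ?x _ => matoms l x
  | Datatypes_prod__canonical__GRing_Lmodule ?a ?b =>
      let l1 := matoms l a in matoms l1 b
  | _ => match l with context [t] => l | _ => constr:(t :: l) end
  end.
Ltac mreify l t :=
  match t with
  | reverse_coercion ?x _ => mreify l x
  | Datatypes_prod__canonical__GRing_Lmodule ?a ?b =>
      let a' := mreify l a in let b' := mreify l b in constr:(MProd a' b')
  | _ => let n := zindex t l in constr:(MVar n)
  end.
Ltac mod_ac :=
  match goal with
  | |- @lmod_iso ?R ?s ?t =>
    let l0 := constr:(@nil (GRing.Lmodule.type R)) in
    let l1 := matoms l0 s in
    let l := matoms l1 t in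
    let s' := mreify l s in
    let t' := mreify l t in
    exact: (@mexprP R (nth (zmodule R) l) s' t' isT)
  end.

(** * Uniform dimension of free modules over an Ore domain *)

Section UniformDimension.
Variable T : nzRingType.
Hypothesis Tdom : forall x y : T, x * y = 0 -> x = 0 \/ y = 0.
Hypothesis Tore : forall a b : T, b != 0 -> exists s t, s != 0 /\ s * a = t * b.

Lemma dom_mul_neq0 (x y : T) : x != 0 -> y != 0 -> x * y != 0.
Proof. by move=> x0 y0; apply/eqP => /Tdom[] e; rewrite e eqxx in x0 y0. Qed.

(** Gaussian elimination without division: for a pivot b and an entry a, the Ore condition gives
    [s * a = t * b] with s nonzero, so s times the row minus t times the pivot row has first
    coordinate zero. The rows obtained are one fewer and live in one dimension less. *)
Lemma ore_dependent m (v : 'I_m.+1 -> free_mod T m) :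
  exists c : 'I_m.+1 -> T, (exists i, c i != 0) /\ \sum_i c i *: v i = 0.
Proof.
elim: m v => [|m IHm] v.
  exists (fun=> 1); split; first by exists ord0; exact: oner_neq0.
  by rewrite [LHS]thinmx0.
pose fst_coord (x : 'rV[T]_(1 + m)) := x 0 0.
pose rest (x : 'rV[T]_(1 + m)) : free_mod T m := rsubmx x.
have restE (x : 'rV[T]_(1 + m)) : fst_coord x = 0 -> rest x = 0 -> x = 0.
  move=> x0 xr; apply/rowP => k; rewrite !mxE.
  case: (fintype.splitP k) => l kl.
    by rewrite -[RHS]x0; congr (x _ _); apply: val_inj; rewrite /= kl [l]ord1.
  have -> : k = rshift 1 l by apply: val_inj; rewrite /= kl.
  by have /rowP/(_ l) := xr; rewrite !mxE.
have rest_sum n (c : 'I_n -> T) (w : 'I_n -> 'rV[T]_(1 + m)) :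
    rest (\sum_i c i *: w i) = \sum_i c i *: rest (w i).
  rewrite /rest raddf_sum; apply: eq_bigr => i _.
  by apply/rowP => k; rewrite !mxE.
have fst_sum n (c : 'I_n -> T) (w : 'I_n -> 'rV[T]_(1 + m)) :
    fst_coord (\sum_i c i *: w i) = \sum_i c i * fst_coord (w i).
  by rewrite /fst_coord summxE; apply: eq_bigr => i _; rewrite mxE.
have [v0|nv0] := pselect (forall i, fst_coord (v i) = 0).
  have [c [[i ci] cs]] := IHm (fun i => rest (v (lift ord0 i))).
  exists (fun k => if unlift ord0 k is Some i then c i else 0); split.
    by exists (lift ord0 i); rewrite liftK.
  rewrite big_ord_recl unlift_none scale0r add0r.
  rewrite (eq_bigr (fun i => c i *: v (lift ord0 i))) => [|i' _]; last by rewrite liftK.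
  by apply: restE; rewrite ?rest_sum // fst_sum big1 // => i' _; rewrite v0 mulr0.
have [i0 b0] : exists i, fst_coord (v i) != 0.
  apply: contrapT => nex; apply: nv0 => i.
  by apply/eqP; apply: contrapT => /negP vi; apply: nex; exists i.
have /choice[st stP] : forall i, exists st : T * T, st.1 != 0 /\
    st.1 * fst_coord (v (lift i0 i)) = st.2 * fst_coord (v i0).
  by move=> i; have [s [t [s0 e]]] := Tore (fst_coord (v (lift i0 i))) b0; exists (s, t).
pose w i : 'rV[T]_(1 + m) := (st i).1 *: (v (lift i0 i) : 'rV_(1 + m)) - (st i).2 *: (v i0 : 'rV_(1 + m)).
have [c [[k ck] cs]] := IHm (fun i => rest (w i)).
(* The coefficient of the pivot row collects what was subtracted from the other rows. *)
exists (fun k => if unlift i0 k is Some i then c i * (st i).1 else - \sum_i c i * (st i).2).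
split; first by exists (lift i0 k); rewrite liftK dom_mul_neq0 //; case: (stP k).
rewrite (bigD1_ord i0) //= unlift_none.
rewrite (eq_bigr (fun i => (c i * (st i).1) *: v (lift i0 i))) => [|i' _]; last by rewrite liftK.
have -> : - (\sum_i c i * (st i).2) *: v i0 + \sum_i (c i * (st i).1) *: v (lift i0 i) =
    \sum_i c i *: w i.
  rewrite scaleNr scaler_suml addrC -sumrB; apply: eq_bigr => i _.
  by rewrite /w scalerBr !scalerA.
apply: restE; rewrite ?rest_sum // fst_sum big1 // => i _.
by rewrite /w /fst_coord !mxE [X in X - _](stP i).2 subrr mulr0.
Qed.

Lemma free_mod_direct_sum m : has_direct_sum (free_mod T m) m.
Proof.
exists (fun i (v : 'rV[T]_m) => forall k, k != i -> v 0 k = 0); split=> [i|i|u Uu us i].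
- split=> [k _|x y x0 y0 k ki|r x x0 k ki]; rewrite mxE //; first by rewrite x0 // y0 // addr0.
  by rewrite x0 // mulr0.
- exists (delta_mx 0 i : 'rV[T]_m); first by move=> k /negPf ki; rewrite mxE ki andbF.
  by apply/eqP => /rowP/(_ i); rewrite !mxE !eqxx => /eqP; rewrite oner_eq0.
apply/rowP => k; rewrite mxE; have [->|ki] := eqVneq k i; last by apply: (Uu i).
have /rowP/(_ i) : \sum_(i < m) (u i : 'rV[T]_m) = 0 by exact: us.
by rewrite summxE mxE (bigD1 i) //= big1 ?addr0 // => l li; apply: Uu; rewrite eq_sym.
Qed.

Lemma free_mod_no_direct_sum m : ~ has_direct_sum (free_mod T m) m.+1.
Proof.
move=> [V [Vs Vn Vd]]; have /choice[x xP] : forall i, exists x, V i x /\ x != 0.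
  by move=> i; have [x] := Vn i; exists x.
have [c [[i ci] cs]] := ore_dependent x.
have cx : c i *: x i = 0.
  apply: (Vd (fun i => c i *: x i) _ cs) => k.
  by have [_ _] := Vs k; apply; case: (xP k).
have [_ /eqP] := xP i; apply; apply/rowP => k.
have /rowP/(_ k) := cx; rewrite !mxE => /Tdom[] // c0.
by rewrite c0 eqxx in ci.
Qed.
End UniformDimension.

(** * Transfer and uniqueness of the uniform dimension *)

Section DirectSums.
Variable R : nzRingType.

Lemma has_direct_sum_inj (M N : lmodType R) (f : {linear M -> N}) n : injective f ->
  has_direct_sum M n -> has_direct_sum N n.
Proof.
move=> fI [V [Vs Vn Vd]]; exists (fun i y => exists2 x, V i x & f x = y); split=> [i|i|u Vu us i].
- have [V0 VD VZ] := Vs i; split.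
  + by exists 0; rewrite ?linear0.
  + by move=> _ _ [x Vx <-] [y Vy <-]; exists (x + y); [exact: VD|rewrite linearD].
  + by move=> r _ [x Vx <-]; exists (r *: x); [exact: VZ|rewrite linearZZ].
- have [x Vx x0] := Vn i; exists (f x); first by exists x.
  by apply: contra_neq x0 => fx; apply: fI; rewrite fx linear0.
have /choice[x xP] : forall i, exists x, V i x /\ f x = u i.
  by move=> k; have [x] := Vu k; exists x.
rewrite -(xP i).2 (Vd x) ?linear0 // => [k|]; first by case: (xP k).
by apply: fI; rewrite linear_sum linear0 -[RHS]us; apply: eq_bigr => k _; case: (xP k).
Qed.

Lemma has_direct_sum_leq (M : lmodType R) n m : (m <= n)%N ->
  has_direct_sum M n -> has_direct_sum M m.
Proof.
move=> mn [V [Vs Vn Vd]]; exists (fun i => V (widen_ord mn i)); split=> // u Vu us i.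
pose u' (k : 'I_n) := if insub (val k) is Some l then u l else 0.
have u'E l : u' (widen_ord mn l) = u l.
  by rewrite /u' /= insubT ?ltn_ord // => lm; congr u; apply: val_inj.
rewrite -u'E; apply: Vd => [k|].
  rewrite /u'; case: insubP => [l _ lk|_]; last by case: (Vs k).
  by have := Vu l; congr (V _ _); apply: val_inj.
rewrite -[RHS]us (bigID (fun k : 'I_n => (k < m)%N)) /= [X in _ + X]big1 ?addr0; last first.
  by move=> k km; rewrite /u' insubN.
rewrite (big_ord_narrow mn); apply: eq_bigr => k _; exact: u'E.
Qed.

Lemma has_udim_uniq (M : lmodType R) n m : has_udim M n -> has_udim M m -> n = m.
Proof.
move=> [dn nn] [dm nm]; apply/eqP; rewrite eqn_leq; apply/andP; split; rewrite leqNgt; apply/negP => lt.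
  by apply: nm; exact: has_direct_sum_leq dn.
by apply: nn; exact: has_direct_sum_leq dm.
Qed.
End DirectSums.

(** * Graded principal ideal domains *)

(* [U a] is the component of degree [a] of a graded subring of [L] in which
   homogeneous ideals are principal; [cl] is the map from the degrees to the class
   group. *)
Record graded_pid (L : fieldType) (D G : zmodType) (cl : D -> G)
    (U : D -> L -> Prop) (len : L -> nat) (sg : int -> {rmorphism L -> L}) : Prop :=
  GradedPid {
  gp_clB : forall a b, cl (a - b) = cl a - cl b;
  gp_cl_surj : forall g, exists a, cl a = g;
  gp_0 : forall a, U a 0;
  gp_deg : forall a b u, U a u -> U b u -> u != 0 -> a = b;
  gp_B : forall a u v, U a u -> U a v -> U a (u - v);
  gp_1 : U 0 1;
  gp_M : forall a b u v, U a u -> U b v -> U (a + b) (u * v);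
  gp_lenM : forall a b u v, U a u -> U b v -> u != 0 -> v != 0 ->
    len (u * v) = (len u + len v)%N;
  gp_len0 : forall a u, U a u -> u != 0 -> len u = 0%N -> U (- a) u^-1;
  gp_bezout : forall a b u v, U a u -> U b v -> u != 0 -> v != 0 ->
    exists c d r s, [/\ U c d, d != 0, U (a - c) (u / d), U (b - c) (v / d)
      & [/\ U (c - a) r, U (c - b) s & d = r * u + s * v]];
  gp_unit_cl : forall a u, u != 0 -> U a u -> U (- a) u^-1 -> cl a = 0;
  gp_unit_ex : forall a, cl a = 0 -> exists u, [/\ u != 0, U a u & U (- a) u^-1];
  gp_det : forall a b, exists p q r s,
    [/\ U b p, U a q, U (- a) r, U (- b) s & p * s - q * r = 1];
  gp_nonunit : exists u, [/\ U 0 u, u != 0 & ~ U 0 u^-1];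
  gp_sg0 : forall u, sg 0 u = u;
  gp_sgD : forall i j u, sg (i + j) u = sg i (sg j u);
  gp_sgU : forall a u k, U a u -> U a (sg k u);
  gp_sg_orbit : forall a u k, U a u -> u != 0 -> k != 0 ->
    U 0 (sg k u / u) -> U 0 (u / sg k u) -> U (- a) u^-1 }.

(* [B] is the ring of skew Laurent polynomials [sum_k io (cf b k) xz k]. *)
Record skew_laurent (L : fieldType) (sg : int -> {rmorphism L -> L}) (B : nzRingType)
    (io : {rmorphism L -> B}) (xz : int -> B) (cf : B -> int -> L) : Prop :=
  SkewLaurent {
  sl_x0 : xz 0 = 1;
  sl_xD : forall i j, xz (i + j) = xz i * xz j;
  sl_comm : forall i a, xz i * io a = io (sg i a) * xz i;
  sl_cfB : forall b c i, cf (b - c) i = cf b i - cf c i;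
  sl_cf_inj : forall b c, (forall i, cf b i = cf c i) -> b = c;
  sl_cf_fin : forall b, exists N : nat, forall i, cf b i != 0 -> `|i|%R <= N%:Z;
  sl_cf_mon : forall a k i, cf (io a * xz k) i = if i == k then a else 0;
  sl_cfl : forall a k b i, cf (io a * xz k * b) i = a * sg k (cf b (i - k));
  sl_cfr : forall a k b i, cf (b * (io a * xz k)) i = cf b (i - k) * sg (i - k) a }.

Section GradedPid.
Variables (L : fieldType) (D G : zmodType) (cl : D -> G) (U : D -> L -> Prop).
Variables (len : L -> nat) (sg : int -> {rmorphism L -> L}).
Hypothesis gp : graded_pid cl U len sg.

Lemma gp_cl0 : cl 0 = 0.
Proof. by rewrite -[in LHS](subrr 0) (gp_clB gp) subrr. Qed.

Lemma gp_clN a : cl (- a) = - cl a.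
Proof. by rewrite -[- a]add0r (gp_clB gp) gp_cl0 add0r. Qed.

Lemma gp_clD a b : cl (a + b) = cl a + cl b.
Proof. by rewrite -{1}[b]opprK (gp_clB gp) gp_clN opprK. Qed.

Lemma gp_N a u : U a u -> U a (- u).
Proof. by move=> Uu; rewrite -[- u]add0r; apply: (gp_B gp) => //; exact: (gp_0 gp). Qed.

Lemma gp_D a u v : U a u -> U a v -> U a (u + v).
Proof. by move=> Uu Uv; rewrite -[v]opprK; apply: (gp_B gp) => //; exact: gp_N. Qed.

Lemma gp_Me a b c u v : U a u -> U b v -> c = a + b -> U c (u * v).
Proof. by move=> Uu Uv ->; exact: (gp_M gp). Qed.

Lemma gp_sum (I : Type) (r : seq I) (P : pred I) a (F : I -> L) :
  (forall i, P i -> U a (F i)) -> U a (\sum_(i <- r | P i) F i).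
Proof.
move=> UF; elim/big_ind: _ => //; first exact: (gp_0 gp).
by move=> x y; apply: gp_D.
Qed.

Lemma gp_prod (I : Type) (r : seq I) (P : pred I) (d : I -> D) (F : I -> L) :
  (forall i, P i -> U (d i) (F i)) ->
  U (\sum_(i <- r | P i) d i) (\prod_(i <- r | P i) F i).
Proof.
move=> UF; elim: r => [|i r IHr]; first by rewrite !big_nil; exact: (gp_1 gp).
by rewrite !big_cons; case: ifP => // Pi; apply: (gp_M gp) => //; exact: UF.
Qed.

(** This says that [U_a U_(-a)] contains 1: [U_a] is an invertible module over [U_0], generated by p
    and q. *)
Lemma gp_split a : exists p q r s,
  [/\ U a p, U a q, U (- a) r, U (- a) s & p * s - q * r = 1].
Proof. exact: (gp_det gp a a). Qed.

Lemma gp_neq0 a : exists2 u, U a u & u != 0.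
Proof.
have [p [q [r [s [Up Uq _ _ e]]]]] := gp_split a.
have [p0|p0] := eqVneq p 0; last by exists p.
exists q => //; apply/eqP => q0; move: e; rewrite p0 q0 !mul0r subr0.
by move/eqP; rewrite eq_sym oner_eq0.
Qed.

(** As 1 is a combination of products from [U_a] and [U_(-a)], m is a combination of elements of
    [U_a m] with coefficients in [U_(-a)]. This is how the degree of an unknown scalar is found
    below. *)
Lemma gp_quot a b m : (forall u, U a u -> U b (u * m)) -> U (b - a) m.
Proof.
move=> Um; have [p [q [r [s [Up Uq Ur Us e]]]]] := gp_split a.
have -> : m = (p * m) * s - (q * m) * r.
  by rewrite mulrAC (mulrAC q) -mulrBl e mul1r.
by apply: (gp_B gp); apply: (gp_M gp) => //; exact: Um.
Qed.

(** Irreducibility for homogeneous factorizations; with the Bezout property it implies Euclid's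
    property, see [gp_prime_dvd]. *)
Definition gp_prime d p := [/\ U d p, p != 0, ~ U (- d) p^-1
  & forall a b u v, U a u -> U b v -> p = u * v -> U (- a) u^-1 \/ U (- b) v^-1].

(** Induction on [len], which is additive and is zero only on units. *)
Lemma gp_prime_ex a u : U a u -> u != 0 -> ~ U (- a) u^-1 ->
  exists d p, gp_prime d p /\ U (a - d) (u / p).
Proof.
have [n] := ubnP (len u); elim: n => // n IHn in a u * => /ltnSE lun Uu u0 nu.
have [pr|npr] := pselect (gp_prime a u).
  by exists a, u; split=> //; rewrite divff // subrr; exact: (gp_1 gp).
have [b [c [v [w [Uv Uw uvw nv nw]]]]] : exists b c v w,
    [/\ U b v, U c w, u = v * w, ~ U (- b) v^-1 & ~ U (- c) w^-1].
  apply: contrapT => H; apply: npr; split=> // b c v w Uv Uw uvw.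
  have [|nv] := pselect (U (- b) v^-1); first by left.
  have [|nw] := pselect (U (- c) w^-1); first by right.
  by exfalso; apply: H; exists b, c, v, w; split.
have v0 : v != 0 by apply: contra_neq u0 => v0; rewrite uvw v0 mul0r.
have w0 : w != 0 by apply: contra_neq u0 => w0; rewrite uvw w0 mulr0.
have lw : (0 < len w)%N.
  by rewrite lt0n; apply/eqP => lw; apply: nw; exact: (gp_len0 gp) lw.
have lv : (len v < n)%N.
  apply: leq_trans lun; rewrite uvw (gp_lenM gp Uv Uw v0 w0) -addn1.
  by rewrite leq_add2l.
have [d [p [pp Up]]] := IHn b v lv Uv v0 nv.
have abc : a = b + c by apply: (gp_deg gp) Uu _ u0; rewrite uvw; exact: (gp_M gp).
by exists d, p; split=> //; rewrite uvw mulrAC; apply: gp_Me Up Uw _; rewrite abc; zmod.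
Qed.

(** For a gcd e of u and p, one of e and p / e is a unit. If p / e is, then p divides u; if e is,
    the Bezout relation multiplied by v / p shows that p divides v. *)
Lemma gp_prime_dvd a b d p u v : gp_prime d p -> U a u -> U b v ->
  U (a + b - d) (u * v / p) -> U (a - d) (u / p) \/ U (b - d) (v / p).
Proof.
move=> [Up p0 np pirr] Uu Uv Uuv.
have [u0|u0] := eqVneq u 0; first by left; rewrite u0 mul0r; exact: (gp_0 gp).
have [c [e [r [s [Ue e0 Ue1 Ue2 [Ur Us ersE]]]]]] := gp_bezout gp Uu Up u0 p0.
have pE : p = (p / e) * e by rewrite divfK.
have [upe|ue] := pirr _ _ _ _ Ue2 Ue pE.
  left; have -> : u / p = (u / e) * (p / e)^-1 by rewrite invf_div mulrA divfK.
  by apply: gp_Me Ue1 upe _; zmod.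
right.
have -> : v / p = (r * (u * v / p) + s * v) * e^-1.
  have -> : r * (u * v / p) + s * v = (r * u + s * p) * (v / p).
    by rewrite mulrDl -!mulrA; congr (_ + _); rewrite [p * _]mulrC divfK.
  by rewrite -ersE mulrAC divff // mul1r.
apply: gp_Me (_ : U (b - d + c) _) ue _; last by zmod.
apply: gp_D; first by apply: gp_Me Ur Uuv _; zmod.
by apply: gp_Me Us Uv _; zmod.
Qed.

Lemma gp_prime_coprime a d p u : gp_prime d p -> U a u -> ~ U (a - d) (u / p) ->
  exists r s, [/\ U (- a) r, U (- d) s & r * u + s * p = 1].
Proof.
move=> [Up p0 np pirr] Uu nu.
have u0 : u != 0 by apply/eqP => u0; apply: nu; rewrite u0 mul0r; exact: (gp_0 gp).
have [c [e [r [s [Ue e0 Ue1 Ue2 [Ur Us ersE]]]]]] := gp_bezout gp Uu Up u0 p0.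
have pE : p = (p / e) * e by rewrite divfK.
have [upe|ue] := pirr _ _ _ _ Ue2 Ue pE.
  exfalso; apply: nu; have -> : u / p = (u / e) * (p / e)^-1 by rewrite invf_div mulrA divfK.
  by apply: gp_Me Ue1 upe _; zmod.
exists (e^-1 * r), (e^-1 * s); split.
- by apply: gp_Me ue Ur _; zmod.
- by apply: gp_Me ue Us _; zmod.
- by rewrite -!mulrA -mulrDr -ersE mulVf.
Qed.

Lemma gp_sgV k d u : U d u -> u != 0 -> U (- d) (sg k u)^-1 -> U (- d) u^-1.
Proof.
move=> Uu u0 Uv; have -> : u^-1 = sg (- k) (sg k u)^-1.
  by rewrite -fmorphV -(gp_sgD gp) addNr (gp_sg0 gp).
exact: (gp_sgU gp).
Qed.

Lemma gp_sgK k : cancel (sg k) (sg (- k)).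
Proof. by move=> u; rewrite -(gp_sgD gp) addNr (gp_sg0 gp). Qed.

Lemma gp_sgNK k : cancel (sg (- k)) (sg k).
Proof. by move=> u; rewrite -(gp_sgD gp) addrN (gp_sg0 gp). Qed.

Lemma gp_prime_sg k d p : gp_prime d p -> gp_prime d (sg k p).
Proof.
move=> [Up p0 np pirr]; split; first exact: (gp_sgU gp).
- by rewrite fmorph_eq0.
- by move=> /(gp_sgV Up p0).
move=> a b u v Uu Uv puv.
have pE : p = sg (- k) u * sg (- k) v by rewrite -rmorphM -puv gp_sgK.
have [] := pirr _ _ _ _ (gp_sgU gp (- k) Uu) (gp_sgU gp (- k) Uv) pE; [left|right];
  by rewrite -[X in X^-1](gp_sgNK k) -fmorphV; apply: (gp_sgU gp).
Qed.

(** If [sg j p] divided [sg i p], the two primes would be associate, and [gp_sg_orbit] would make p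
    a unit. *)
Lemma gp_prime_orbit i j d p : gp_prime d p -> i != j -> ~ U 0 (sg i p / sg j p).
Proof.
move=> pp ij Uij; have [Up p0 np pirr] := pp.
have Uq : U 0 (sg (i - j) p / p).
  have := gp_sgU gp (- j) Uij; rewrite rmorphM fmorphV -!(gp_sgD gp).
  by rewrite addNr (gp_sg0 gp) [- j + i]addrC.
apply: (np); apply: (gp_sg_orbit gp (k := i - j)) => //; first by rewrite subr_eq0.
have qE : sg (i - j) p = (sg (i - j) p / p) * p by rewrite divfK.
have [_ _ _ pirr'] := gp_prime_sg (i - j) pp.
have [] := pirr' _ _ _ _ Uq Up qE; last by move=> /np.
by rewrite oppr0 invf_div.
Qed.

(* A graded ideal, given by its component of degree [a], is principal. *)
Lemma gp_principal a (Y : L -> Prop) :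
  (forall u, Y u -> U a u) -> (forall u v, Y u -> Y v -> Y (u + v)) ->
  (forall r u, U 0 r -> Y u -> Y (r * u)) -> (exists2 u, Y u & u != 0) ->
  exists d c, [/\ U d c, c != 0 & forall u, Y u <-> U (a - d) (u / c)].
Proof.
move=> YU YD YM [y0 Yy0 y00].
(* The generator is sought among the c, in any degree d, with [U_(a-d) c] inside Y. One of minimal
   length divides every u in Y, since a gcd of u and c is again of this kind and cannot be
   shorter. *)
pose Z c := [/\ c != 0 & exists d, U d c /\ forall t, U (a - d) t -> Y (t * c)].
have Zy0 : Z y0.
  split=> //; exists a; split; first exact: YU.
  by move=> t; rewrite subrr => Ut; apply: YM.
have [c [[c0 [d [Uc cY]]] cmin]] : exists c, Z c /\ forall c', Z c' -> (len c <= len c')%N.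
  have exn : exists n, `[< exists2 c, Z c & len c = n >].
    by exists (len y0); apply/asboolP; exists y0.
  case: (ex_minnP exn) => n /asboolP [c Zc <-] nmin; exists c; split=> // c' Zc'.
  by apply: nmin; apply/asboolP; exists c'.
exists d, c; split=> // u; split=> [Yu|Uu]; last by rewrite -[u](divfK c0); apply: cY.
have [->|u0] := eqVneq u 0; first by rewrite mul0r; exact: (gp_0 gp).
have [e [f [r [s [Uf f0 Uuf Ucf [Ur Us fE]]]]]] := gp_bezout gp (YU _ Yu) Uc u0 c0.
have Zf : Z f.
  split=> //; exists e; split=> // t Ut; rewrite fE mulrDr !mulrA.
  apply: YD; last by apply: cY; apply: gp_Me Ut Us _; zmod.
  by apply: YM => //; apply: gp_Me Ut Ur _; zmod.
have cE : c = (c / f) * f by rewrite divfK.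
have cf0 : c / f != 0 by rewrite mulf_neq0 // invr_eq0.
have lcf : len (c / f) = 0%N.
  have := cmin _ Zf; rewrite {1}cE (gp_lenM gp Ucf Uf cf0 f0) -[X in (_ <= X)%N]add0n.
  by rewrite leq_add2r leqn0 => /eqP.
have -> : u / c = (u / f) * (c / f)^-1 by rewrite invf_div mulrA divfK.
by apply: gp_Me Uuf (gp_len0 gp Ucf cf0 lcf) _; zmod.
Qed.

End GradedPid.

(** * Lattices over [U_0] and their Steinitz class *)

Section Lattices.
Variables (L : fieldType) (D G : zmodType) (cl : D -> G) (U : D -> L -> Prop).
Variables (len : L -> nat) (sg : int -> {rmorphism L -> L}).
Hypothesis gp : graded_pid cl U len sg.

(** A pseudo-basis: V is the direct sum of the [U_(g i) v_i]. The vectors [v_i] themselves may lie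
    outside V. *)
Definition gbasis (E : lmodType L) (V : E -> Prop) n (v : 'I_n -> E) (g : 'I_n -> D) :=
  (forall l : 'I_n -> L, \sum_i l i *: v i = 0 -> forall i, l i = 0) /\
  (forall y, V y <-> exists2 u : 'I_n -> L, (forall i, U (g i) (u i))
     & y = \sum_i u i *: v i).

(** The Steinitz class, that is, the class of the determinant of V. It is a relation, shown to be
    functional in [gclass_uniq]. *)
Definition gclass (E : lmodType L) (V : E -> Prop) (c : G) :=
  exists n (v : 'I_n -> E) g, gbasis V v g /\ cl (\sum_i g i) = c.

(** A nonzero scalar of degree [g i] brings [v i] into V and gives its coordinates on w. Every other
    scalar of this degree gives the same ones, so [gp_quot] yields their degrees. *)
Lemma gbasis_change (E : lmodType L) (V : E -> Prop) n (v : 'I_n -> E) g s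
    (w : 'I_s -> E) h : gbasis V v g -> gbasis V w h ->
  exists M : 'M[L]_(n, s), (forall i, v i = \sum_j M i j *: w j) /\
    forall i j, U (h j - g i) (M i j).
Proof.
move=> [_ vV] [wfree wV].
suff /choice[m mP] : forall i, exists m : 'I_s -> L, v i = \sum_j m j *: w j /\
    forall j, U (h j - g i) (m j).
  exists (\matrix_(i, j) m i j); split=> i; first rewrite {1}(mP i).1.
    by apply: eq_bigr => j _; rewrite mxE.
  by move=> j; rewrite mxE; exact: (mP i).2.
move=> i.
have Vi u : U (g i) u -> V (u *: v i).
  move=> Uu; apply/vV; exists (fun k => if k == i then u else 0).
    by move=> k; case: eqP => [->|_] //; exact: (gp_0 gp).
  by rewrite (bigD1 i) //= eqxx big1 ?addr0 // => k /negPf ->; rewrite scale0r.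
have [a Ua a0] := gp_neq0 gp (g i).
have [u Uu aE] := (wV _).1 (Vi a Ua).
exists (fun j => a^-1 * u j).
have vE : v i = \sum_j (a^-1 * u j) *: w j.
  rewrite -[LHS](scalerK a0) aE scaler_sumr.
  by apply: eq_bigr => j _; rewrite scalerA.
split=> // j; apply: (gp_quot gp) => b Ub.
have [t Ut bE] := (wV _).1 (Vi b Ub).
suff -> : b * (a^-1 * u j) = t j by exact: Ut.
apply/eqP; rewrite -subr_eq0; apply/eqP; move: j.
apply: wfree; rewrite (eq_bigr (fun j => b *: ((a^-1 * u j) *: w j) - t j *: w j)).
  by rewrite sumrB -bE -scaler_sumr -vE subrr.
by move=> j _; rewrite scalerBl scalerA.
Qed.

Lemma gbasis_changeK (E : lmodType L) (V : E -> Prop) n (v : 'I_n -> E) g s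
    (w : 'I_s -> E) (M : 'M_(n, s)) (N : 'M_(s, n)) : gbasis V v g ->
  (forall i, v i = \sum_j M i j *: w j) -> (forall j, w j = \sum_i N j i *: v i) ->
  M *m N = 1%:M.
Proof.
move=> [vfree _] vE wE; apply/matrixP => i k.
apply/eqP; rewrite -subr_eq0; apply/eqP; move: k.
apply: vfree; rewrite (eq_bigr (fun k => (M *m N) i k *: v k - (i == k)%:R *: v k)).
  rewrite sumrB [X in _ - X](bigD1 i) //= eqxx scale1r [X in v i + X]big1 ?addr0; last first.
    by move=> k /negPf ki; rewrite eq_sym ki scale0r.
  apply/eqP; rewrite subr_eq0; apply/eqP; rewrite [RHS]vE.
  under [RHS]eq_bigr => j _ do rewrite wE scaler_sumr.
  rewrite exchange_big; apply: eq_bigr => k _ /=.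
  by rewrite mxE scaler_suml; apply: eq_bigr => j _; rewrite scalerA.
by move=> k _; rewrite !mxE -mulr_natr mul1r scalerBl.
Qed.

Lemma gp_det_deg n (M : 'M[L]_n) (a b : 'I_n -> D) :
  (forall i j, U (b j - a i) (M i j)) -> U (\sum_i b i - \sum_i a i) (\det M).
Proof.
move=> UM; apply: (gp_sum gp) => s _.
have Up : U (\sum_i b i - \sum_i a i) (\prod_i M i (s i)).
  have -> : \sum_i b i - \sum_i a i = \sum_i (b (s i) - a i).
    by rewrite sumrB; congr (_ - _); rewrite (reindex_inj (@perm_inj _ s)).
  by apply: (gp_prod gp).
by case: (odd_perm s); rewrite ?expr0 ?mul1r // expr1 mulN1r; exact: (gp_N gp).
Qed.

(** The two transition matrices are inverse to each other with homogeneous entries, so the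
    determinant is a unit of U whose degree is the difference of the two sums. *)
Lemma gclass_uniq (E : lmodType L) (V : E -> Prop) c c' :
  gclass V c -> gclass V c' -> c = c'.
Proof.
move=> [n [v [g [bv <-]]]] [s [w [h [bw <-]]]].
have [M [vM UM]] := gbasis_change bv bw; have [N [wN UN]] := gbasis_change bw bv.
have MN := gbasis_changeK bv vM wN; have NM := gbasis_changeK bw wN vM.
have ns : n = s.
  by apply/eqP; rewrite eqn_leq (mulmx1_min MN) (mulmx1_min NM).
subst s.
have dMN : \det M * \det N = 1 by rewrite -det_mulmx MN det1.
have dM0 : \det M != 0.
  by apply: contra_eq_neq dMN => ->; rewrite mul0r eq_sym oner_eq0.
have := gp_unit_cl gp dM0 (gp_det_deg UM).
have -> : (\det M)^-1 = \det N by rewrite -[LHS]mulr1 -dMN mulKf.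
rewrite opprB (gp_clB gp) => /(_ (gp_det_deg UN)) /eqP.
by rewrite subr_eq0 eq_sym => /eqP.
Qed.

(** Additivity in exact sequences: the image is projective over [U_0], so its pseudo-basis lifts and
    completes that of the kernel. *)
Lemma gclass_ext (E E' : lmodType L) (V : E -> Prop) (f : {linear E -> E'}) c c' :
  (forall x y, V x -> V y -> V (x + y)) -> (forall r x, U 0 r -> V x -> V (r *: x)) ->
  gclass (fun y => V y /\ f y = 0) c -> gclass (fun z => exists2 y, V y & f y = z) c' ->
  gclass V (c + c').
Proof.
move=> VD VZ [n [v [g [[vfree vV] <-]]]] [s [w [h [[wfree wV] <-]]]].
have Vsum m (l : 'I_m -> L) (x : 'I_m -> E) : (0 < m)%N \/ V 0 ->
    (forall i, V (l i *: x i)) -> V (\sum_i l i *: x i).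
  move=> [|V0 Vl]; last by elim/big_ind: _.
  case: m l x => // m l x _ Vl; elim: m l x Vl => [|m IHm] l x Vl.
    by rewrite big_ord1.
  by rewrite big_ord_recl; apply: VD => //; exact: IHm.
have V0 : V 0.
  have [] : V 0 /\ f 0 = 0; last by [].
  by apply/vV; exists (fun=> 0) => [i|]; [exact: (gp_0 gp)|rewrite big1 // => i _; rewrite scale0r].
have VN x : V x -> V (- x).
  by move=> Vx; rewrite -scaleN1r; apply: VZ => //; apply: gp_N gp _ _ (gp_1 gp).
(* Only the multiples of [w j] by [U_(h j)] are known to be in the image. Lifts y1 and y2 of [p w_j]
   and [q w_j] combine by [p t - q r = 1] into a preimage y of [w j] with [U_(h j) y] inside V. *)
have /choice[y yP] : forall j, exists y, f y = w j /\ forall u, U (h j) u -> V (u *: y).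
  move=> j; have [p [q [r [t [Up Uq Ur Ut e]]]]] := gp_split gp (h j).
  have lift u : U (h j) u -> exists2 y, V y & f y = u *: w j.
    move=> Uu; apply/wV; exists (fun k => if k == j then u else 0).
      by move=> k; case: eqP => [->|_] //; exact: (gp_0 gp).
    by rewrite (bigD1 j) //= eqxx big1 ?addr0 // => k /negPf ->; rewrite scale0r.
  have [y1 Vy1 fy1] := lift p Up; have [y2 Vy2 fy2] := lift q Uq.
  exists (t *: y1 - r *: y2); split.
    by rewrite linearB (linearZZ f t) (linearZZ f r) fy1 fy2 !scalerA -scalerBl mulrC [r * q]mulrC e scale1r.
  move=> u Uu; rewrite scalerBr !scalerA; apply: VD; last apply: VN.
    by apply: VZ => //; apply: (gp_Me gp Uu Ut); zmod.
  by apply: VZ => //; apply: (gp_Me gp Uu Ur); zmod.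
pose vy k := match fintype.split k with inl i => v i | inr j => y j end.
pose gh k := match fintype.split k with inl i => g i | inr j => h j end.
have splitl i : fintype.split (lshift s i) = inl i := unsplitK (inl i).
have splitr j : fintype.split (rshift n j) = inr j := unsplitK (inr j).
have fv i : f (v i) = 0.
  have [a Ua a0] := gp_neq0 gp (g i).
  have [_] : V (a *: v i) /\ f (a *: v i) = 0.
    apply/vV; exists (fun k => if k == i then a else 0).
      by move=> k; case: eqP => [->|_] //; exact: (gp_0 gp).
    by rewrite (bigD1 i) //= eqxx big1 ?addr0 // => k /negPf ->; rewrite scale0r.
  by rewrite linearZZ => /eqP; rewrite scaler_eq0 (negPf a0) => /eqP.
have sumE (l : 'I_(n + s) -> L) : \sum_k l k *: vy k =
    \sum_i l (lshift s i) *: v i + \sum_j l (rshift n j) *: y j.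
  rewrite big_split_ord; congr (_ + _); apply: eq_bigr => k _; by rewrite /vy ?splitl ?splitr.
have fsum (l : 'I_(n + s) -> L) : f (\sum_k l k *: vy k) = \sum_j l (rshift n j) *: w j.
  rewrite sumE linearD !linear_sum big1 ?add0r; last by move=> i _; rewrite linearZZ fv scaler0.
  by apply: eq_bigr => j _; rewrite linearZZ (yP j).1.
exists (n + s)%N, vy, gh; split; last first.
  rewrite big_split_ord (gp_clD gp) /=; congr (cl _ + cl _); apply: eq_bigr => k _;
    by rewrite /gh ?splitl ?splitr.
split=> [l l0|x]; last split.
- have lr j : l (rshift n j) = 0.
    by apply: (wfree (fun j => l (rshift n j))); rewrite -fsum l0 linear0.
  have ll i : l (lshift s i) = 0.
    apply: (vfree (fun i => l (lshift s i))); move: l0; rewrite sumE [X in _ + X]big1 ?addr0 //.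
    by move=> j _; rewrite lr scale0r.
  by move=> k; rewrite -(splitK k); case: fintype.split => i; [exact: ll|exact: lr].
- move=> Vx; have [t Ut fx] : exists2 t : 'I_s -> L, forall j, U (h j) (t j) & f x = \sum_j t j *: w j.
    by apply/wV; exists x.
  have [u Uu xE] : exists2 u : 'I_n -> L, (forall i, U (g i) (u i)) &
      x - \sum_j t j *: y j = \sum_i u i *: v i.
    apply/vV; split.
      apply: VD => //; apply/VN/Vsum; first by right.
      by move=> j; apply: (yP j).2.
    rewrite linearB fx linear_sum -sumrB big1 // => j _.
    by rewrite linearZZ (yP j).1 subrr.
  exists (fun k => match fintype.split k with inl i => u i | inr j => t j end).
    by move=> k; rewrite /gh; case: fintype.split.
  rewrite sumE -[LHS](subrK (\sum_j t j *: y j)) xE.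
  by congr (_ + _); apply: eq_bigr => k _; rewrite ?splitl ?splitr.
- move=> [u Uu ->]; rewrite sumE; apply: VD; apply: Vsum; try by right.
    move=> i; have [] // : V (u (lshift s i) *: v i) /\ f (u (lshift s i) *: v i) = 0.
    apply/vV; exists (fun k => if k == i then u (lshift s i) else 0).
      move=> k; case: eqP => [->|_]; last by exact: (gp_0 gp).
      by move: (Uu (lshift s i)); rewrite /gh splitl.
    by rewrite (bigD1 i) //= eqxx [X in _ + X]big1 ?addr0 // => k /negPf ->; rewrite scale0r.
  by move=> j; apply: (yP j).2; move: (Uu (rshift n j)); rewrite /gh splitr.
Qed.

(** The n forms embed V into a sum of modules [U_(g i)]. Splitting off the last form leaves its
    image, which is zero or [U_(g n - d) e] by [gp_principal], and a kernel embedded by the other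
    forms. *)
Lemma gclass_sub (E : lmodType L) (V : E -> Prop) n (f : nat -> {linear E -> L^o}) (g : nat -> D) :
  V 0 -> (forall x y, V x -> V y -> V (x + y)) -> (forall r x, U 0 r -> V x -> V (r *: x)) ->
  (forall i y, (i < n)%N -> V y -> U (g i) (f i y)) ->
  (forall y, V y -> (forall i, (i < n)%N -> f i y = 0) -> y = 0) ->
  exists c, gclass V c.
Proof.
elim: n V => [|n IHn] V V0 VD VZ Vf Vker.
  exists 0, 0%N, (fun=> 0), (fun=> 0); rewrite big_ord0 (gp_cl0 gp); split=> //.
  split=> [l _ []//|y]; split=> [Vy|[u _ ->]]; last by rewrite big_ord0.
  by exists (fun=> 0) => [[]//|]; rewrite big_ord0; apply: Vker.
have [c Hc] : exists c, gclass (fun y => V y /\ f n y = 0) c.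
  apply: IHn.
  - by rewrite linear0.
  - by move=> x y [Vx fx] [Vy fy]; split; [exact: VD|rewrite linearD fx fy addr0].
  - by move=> r x Ur [Vx fx]; split; [exact: VZ|rewrite linearZZ fx scaler0].
  - by move=> i y lin [Vy _]; apply: Vf => //; rewrite ltnS ltnW.
  - move=> y [Vy fy] fi; apply: Vker => // i; rewrite ltnS leq_eqVlt => /predU1P[->//|]; exact: fi.
have [c' Hc'] : exists c', gclass (fun z : L^o => exists2 y, V y & f n y = z) c'; last first.
  by exists (c + c'); apply: gclass_ext Hc Hc'.
have [[y Vy fy]|nex] := pselect (exists2 y, V y & f n y != 0); last first.
  exists 0, 0%N, (fun=> 0), (fun=> 0); rewrite big_ord0 (gp_cl0 gp); split=> //.
  split=> [l _ []//|z]; split=> [[y Vy <-]|[u _ ->]]; last by exists 0; rewrite ?linear0 ?big_ord0.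
  exists (fun=> 0) => [[]//|]; rewrite big_ord0; apply/eqP; apply: contrapT => /negP fy.
  by apply: nex; exists y.
have [||||d [e [Ue e0 YE]]] := @gp_principal _ _ _ _ _ _ _ gp (g n)
    (fun z : L => exists2 y, V y & f n y = z).
- by move=> _ [x Vx <-]; apply: Vf.
- by move=> _ _ [x Vx <-] [x' Vx' <-]; exists (x + x'); [exact: VD|rewrite linearD].
- by move=> r _ Ur [x Vx <-]; exists (r *: x); [exact: VZ|rewrite linearZZ].
- by exists (f n y) => //; exists y.
exists (cl (\sum_(i < 1) (g n - d))), 1%N, (fun=> e : L^o), (fun=> g n - d); split=> //.
split=> [l|z].
  by rewrite big_ord1 => /eqP; rewrite scaler_eq0 (negPf e0) orbF => /eqP l0 i; rewrite ord1.
split=> [/YE Uz|[u Uu]].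
  by exists (fun=> (z : L) / e) => //; rewrite big_ord1 -[RHS]/((z : L) / e * e) divfK.
rewrite big_ord1 => ->; apply/YE; rewrite -[u ord0 *: _]/(u ord0 * e) mulfK //; exact: Uu.
Qed.

End Lattices.

(** * Skew Laurent polynomials *)

Section SkewLaurentBasics.
Variables (L : fieldType) (sg : int -> {rmorphism L -> L}) (B : nzRingType).
Variables (io : {rmorphism L -> B}) (xz : int -> B) (cf : B -> int -> L).
Hypothesis sl : skew_laurent sg io xz cf.

Lemma cf0 i : cf 0 i = 0.
Proof. by rewrite -[X in cf X](subrr 0) (sl_cfB sl) subrr. Qed.

Lemma cfN b i : cf (- b) i = - cf b i.
Proof. by rewrite -[- b]add0r (sl_cfB sl) cf0 add0r. Qed.

Lemma cfD b c i : cf (b + c) i = cf b i + cf c i.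
Proof. by rewrite -{1}[c]opprK (sl_cfB sl) cfN opprK. Qed.

Lemma cf_sum (I : Type) (r : seq I) (P : pred I) (F : I -> B) k :
  cf (\sum_(i <- r | P i) F i) k = \sum_(i <- r | P i) cf (F i) k.
Proof. by elim/big_rec2: _ => [|i _ y _ <-]; rewrite ?cf0 ?cfD. Qed.

Lemma cf_iol a b i : cf (io a * b) i = a * cf b i.
Proof.
have := sl_cfl sl a 0 b i; rewrite (sl_x0 sl) mulr1 subr0 => ->.
have := sl_comm sl 0 (cf b i); rewrite (sl_x0 sl) mul1r mulr1 => /fmorph_inj e.
by rewrite -e.
Qed.

Lemma cf_xl k b i : cf (xz k * b) i = sg k (cf b (i - k)).
Proof. by have := sl_cfl sl 1 k b i; rewrite rmorph1 mul1r mul1r. Qed.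

Lemma cf_ior b a i : cf (b * io a) i = cf b i * sg i a.
Proof. by have := sl_cfr sl a 0 b i; rewrite (sl_x0 sl) mulr1 subr0. Qed.

Lemma cf_io a i : cf (io a) i = if i == 0 then a else 0.
Proof. by have := sl_cf_mon sl a 0 i; rewrite (sl_x0 sl) mulr1. Qed.

Lemma cf_xz k i : cf (xz k) i = if i == k then 1 else 0.
Proof. by have := sl_cf_mon sl 1 k i; rewrite rmorph1 mul1r. Qed.

Lemma xzK k : xz k * xz (- k) = 1.
Proof. by rewrite -(sl_xD sl) subrr (sl_x0 sl). Qed.

Lemma xzNK k : xz (- k) * xz k = 1.
Proof. by rewrite -(sl_xD sl) addNr (sl_x0 sl). Qed.

Lemma io_neq0 a : (io a == 0) = (a == 0). Proof. exact: fmorph_eq0. Qed.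

Lemma ioVK a b : a != 0 -> io a^-1 * (io a * b) = b.
Proof. by move=> a0; rewrite mulrA -rmorphM mulVf // rmorph1 mul1r. Qed.

Lemma ioKV a b : a != 0 -> io a * (io a^-1 * b) = b.
Proof. by move=> a0; rewrite mulrA -rmorphM divff // rmorph1 mul1r. Qed.

Lemma skew_sum b : exists N : nat,
  b = \sum_(k < N.*2.+1) io (cf b (k%:Z - N%:Z)) * xz (k%:Z - N%:Z).
Proof.
have [N Nb] := sl_cf_fin sl b; exists N; apply: (sl_cf_inj sl) => i.
rewrite cf_sum (eq_bigr (fun k : 'I_N.*2.+1 =>
  if i == k%:Z - N%:Z then cf b i else 0)); last first.
  by move=> k _; rewrite (sl_cf_mon sl); case: eqP => [->|].
have [bi0|/Nb iN] := eqVneq (cf b i) 0.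
  by rewrite bi0 big1 // => k _; case: ifP.
have klt : (absz (i + N%:Z)%R < N.*2.+1)%N by lia.
rewrite (bigD1 (Ordinal klt)) //= big1 ?addr0 => [|k].
  by have -> : i == (absz (i + N%:Z))%:Z - N%:Z by lia.
by rewrite -val_eqE /= => ik; case: eqP => // ie; move: ik; lia.
Qed.

Lemma skew_ind (P : B -> Prop) b : P 0 -> (forall x y, P x -> P y -> P (x + y)) ->
  (forall k, P (io (cf b k) * xz k)) -> P b.
Proof.
move=> P0 PD Pm; have [N ->] := skew_sum b.
by elim/big_ind: _ => // k _; exact: Pm.
Qed.

Definition below (n : int) b := forall i, n <= i -> cf b i = 0.

Lemma below_mul n m b c : below n b -> below (m + 1) c -> below (n + m) (b * c).
Proof.
move=> bn cm; apply: (@skew_ind (fun x => below (n + m) (x * c)) b) => [i _|x y xb yb i ni|k i ni].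
- by rewrite mul0r cf0.
- by rewrite mulrDl cfD xb // yb // addr0.
have [nk|kn] := lerP n k; first by rewrite bn // rmorph0 !mul0r cf0.
by rewrite (sl_cfl sl) cm ?rmorph0 ?mulr0 //; lia.
Qed.

Lemma top_ex b : b != 0 -> exists n, cf b n != 0 /\ below (n + 1) b.
Proof.
move=> b0; have [N Nb] := sl_cf_fin sl b.
have bN : below (N%:Z + 1) b.
  move=> i Ni; apply/eqP; apply: contraTT Ni => /Nb; lia.
have [i0 bi0] : exists i, cf b i != 0.
  apply: contrapT => nex; move/eqP: b0; apply; apply: (sl_cf_inj sl) => i.
  by rewrite cf0; apply/eqP; apply: contrapT => /negP bi; apply: nex; exists i.
have : exists m : nat, cf b (N%:Z - m%:Z) != 0.
  have i0N : i0 <= N%:Z by move/Nb: (bi0); lia.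
  exists (absz (N%:Z - i0)); have -> // : N%:Z - (absz (N%:Z - i0))%:Z = i0 by lia.
move=> ex; case: (ex_minnP ex) => m bm mmin; exists (N%:Z - m%:Z); split=> // i mi.
have [/bN //|iN] := lerP (N%:Z + 1) i.
apply/eqP; apply: contrapT => /negP bi.
have := mmin (absz (N%:Z - i)%R).
have -> : N%:Z - (absz (N%:Z - i))%:Z = i by lia.
move=> /(_ bi); lia.
Qed.

Lemma cf_top n m b c : below (n + 1) b -> below (m + 1) c ->
  cf (b * c) (n + m) = cf b n * sg n (cf c m).
Proof.
move=> bn cm; pose b' := b - io (cf b n) * xz n.
have b'n : below n b'.
  move=> i ni; rewrite (sl_cfB sl) (sl_cf_mon sl); case: eqP => [->|/eqP ni']; first by rewrite subrr.
  by rewrite subr0 bn //; lia.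
have -> : b * c = b' * c + io (cf b n) * xz n * c by rewrite -mulrDl subrK.
by rewrite cfD (below_mul b'n cm) // add0r (sl_cfl sl) addrC addrA addNr add0r.
Qed.

Lemma skew_mul_eq0 (b c : B) : b * c = 0 -> b = 0 \/ c = 0.
Proof.
move=> bc; have [->|b0] := eqVneq b 0; first by left.
have [->|c0] := eqVneq c 0; first by right.
have [n [bn blb]] := top_ex b0; have [m [cm blc]] := top_ex c0.
have := cf_top blb blc; rewrite bc cf0 => /esym/eqP.
by rewrite mulf_eq0 (negPf bn) fmorph_eq0 (negPf cm).
Qed.

Lemma skew_mulI (c : B) : c != 0 -> injective (fun b : B => b * c).
Proof.
move=> c0 b b' /eqP; rewrite -subr_eq0 -mulrBl => /eqP /skew_mul_eq0[|cE].
  by move=> /eqP; rewrite subr_eq0 => /eqP.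
by rewrite cE eqxx in c0.
Qed.

End SkewLaurentBasics.

Section PrincipalPair.
Variables (L : fieldType) (D G : zmodType) (cl : D -> G) (U : D -> L -> Prop).
Variables (len : L -> nat) (sg : int -> {rmorphism L -> L}).
Hypothesis gp : graded_pid cl U len sg.

(** A nonzero Y is [U_(a-d) c], and the invertible module [U_(a-d)] has two generators. This is the
    Noetherian property needed for leading coefficients. *)
Lemma gp_two_gens a (Y : L -> Prop) : Y 0 ->
  (forall u, Y u -> U a u) -> (forall u v, Y u -> Y v -> Y (u + v)) ->
  (forall r u, U 0 r -> Y u -> Y (r * u)) ->
  exists p q, [/\ Y p, Y q & forall u, Y u -> exists r s,
    [/\ U 0 r, U 0 s & u = r * p + s * q]].
Proof.
move=> Y0 YU YD YM.
have [Yn0|Yz] := pselect (exists2 u, Y u & u != 0); last first.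
  exists 0, 0; split=> // u Yu; exists 0, 0; split; try exact: (gp_0 gp).
  rewrite !mulr0 addr0; apply/eqP; apply: contrapT => /negP u0.
  by apply: Yz; exists u.
have [d [c [Uc c0 YE]]] := gp_principal gp YU YD YM Yn0.
have [p [q [r [s [Up Uq Ur Us e]]]]] := gp_split gp (a - d).
exists (p * c), (q * c); split; try by apply/YE; rewrite mulfK.
move=> u /YE Uu; exists (u / c * s), (- (u / c * r)); split.
- by apply: (gp_Me gp Uu Us); zmod.
- by apply: gp_N gp _ _ _; apply: (gp_Me gp Uu Ur); zmod.
have -> : u / c * s * (p * c) + - (u / c * r) * (q * c) = (u / c) * c * (p * s - q * r).
  by ring.
by rewrite e mulr1 divfK.
Qed.
End PrincipalPair.

(** * The modules [W_a] over the integral skew Laurent ring *)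

Section IntegralSkewRing.
Variables (L : fieldType) (D G : zmodType) (cl : D -> G) (U : D -> L -> Prop).
Variables (len : L -> nat) (sg : int -> {rmorphism L -> L}).
Hypothesis gp : graded_pid cl U len sg.
Variables (B : nzRingType) (io : {rmorphism L -> B}) (xz : int -> B) (cf : B -> int -> L).
Hypothesis sl : skew_laurent sg io xz cf.

Definition W (a : D) (b : B) := forall k, U a (cf b k).

Lemma W_D a b c : W a b -> W a c -> W a (b + c).
Proof. by move=> Wb Wc k; rewrite (cfD sl); apply: gp_D gp _ _ _ _ _. Qed.

Lemma W_0 a : W a 0.
Proof. by move=> k; rewrite (cf0 sl); exact: (gp_0 gp). Qed.

Lemma W_N a b : W a b -> W a (- b).
Proof. by move=> Wb k; rewrite (cfN sl); exact: gp_N gp _ _ (Wb k). Qed.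

Lemma W_io a u : U a u -> W a (io u).
Proof. by move=> Uu k; rewrite (cf_io sl); case: eqP => // _; exact: (gp_0 gp). Qed.

Lemma W_xz k : W 0 (xz k).
Proof.
by move=> i; rewrite (cf_xz sl); case: eqP => // _; [exact: (gp_1 gp)|exact: (gp_0 gp)].
Qed.

Lemma W_M a b x y : W a x -> W b y -> W (a + b) (x * y).
Proof.
move=> Wx Wy; apply: (@skew_ind _ _ _ _ _ _ sl (fun x => W (a + b) (x * y)) x).
- by rewrite mul0r; exact: W_0.
- by move=> u v; rewrite mulrDl; exact: W_D.
- move=> k i; rewrite (sl_cfl sl); apply: (gp_M gp) => //.
  exact: (gp_sgU gp).
Qed.

Lemma W_Me a b c x y : W a x -> W b y -> c = a + b -> W c (x * y).
Proof. by move=> Wx Wy ->; exact: W_M. Qed.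

Lemma W_ior a b c x u : W a x -> U b u -> c = a + b -> W c (x * io u).
Proof. by move=> Wx Uu; apply: W_Me => //; exact: W_io. Qed.

Variables (T : nzRingType) (j : {rmorphism T -> B}).
Hypothesis jI : injective j.
Hypothesis jW : forall b, W 0 b <-> exists t, j t = b.

(** T is known only through an injection j onto [W_0], so that what follows applies to the opposite
    ring as well. *)
Definition BT : lmodType T := resmod j (B^o).

Lemma BTZ (t : T) (b : BT) : t *: b = j t * (b : B).
Proof. by []. Qed.

Lemma jW0 t : W 0 (j t). Proof. by apply/jW; exists t. Qed.

Lemma submodule_mul (J : set BT) (t b : B) : submodule J -> W 0 t -> J b -> J (t * b).
Proof. by move=> [_ _ JZ] /jW[s <-] Jb; exact: JZ. Qed.

Lemma submodule_opp (J : set BT) (b : B) : submodule J -> J b -> J (- b).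
Proof.
move=> hJ Jb; rewrite -mulN1r; apply: (submodule_mul hJ) => //.
by apply: W_N; rewrite -(rmorph1 io); apply: W_io; exact: (gp_1 gp).
Qed.

Lemma submodule_sub (J : set BT) (b c : B) : submodule J -> J b -> J c -> J (b - c).
Proof. by move=> hJ Jb Jc; case: (hJ) => _ JD _; apply: JD => //; exact: submodule_opp. Qed.

Fact rmul_linear (c : B) : linear (fun b : BT => ((b : B) * c : BT)).
Proof. by move=> t x y; rewrite -[LHS]/((j t * x + y) * c) mulrDl -mulrA. Qed.

Definition rmul (c : B) : {linear BT -> BT} := mklin (rmul_linear c).

Arguments rmul : simpl never.

Lemma rmulE c (b : B) : rmul c b = b * c. Proof. by []. Qed.

Lemma W_submodule a : submodule (W a : set BT).
Proof.
split; [exact: W_0|by move=> x y; exact: W_D|].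
by move=> t x Wx; apply: (W_Me (jW0 t) Wx); zmod.
Qed.

Definition WM a : lmodType T := submod (W_submodule a).

Lemma WM0_iso : lmod_iso (T^o) (WM 0).
Proof.
have fl : linear (fun t : T^o => msub (W_submodule 0) (jW0 t)).
  by move=> a x y; apply: sval_lin_inj; rewrite linearP !msubK rmorphD rmorphM.
apply: (@lmod_iso_bij _ _ _ (mklin fl)) => [x y|y].
  by move=> e; apply: jI; exact: (congr1 (fun z : WM 0 => sval_lin z) e).
have /jW[t jt] := sval_linP y; exists t.
by apply: sval_lin_inj; rewrite mklinE msubK jt.
Qed.

Lemma WM_cl a b : cl a = cl b -> lmod_iso (WM a) (WM b).
Proof.
move=> ab; have [u [u0 Uu Uv]] : exists u, [/\ u != 0, U (b - a) u & U (- (b - a)) u^-1].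
  by apply: (gp_unit_ex gp); rewrite (gp_clB gp) ab subrr.
apply: (@submod_iso _ _ _ _ _ _ _ (rmul (io u))) => [x Wx|x Wx|y Wy].
- by rewrite rmulE; apply: (W_ior Wx Uu); zmod.
- rewrite rmulE => /(skew_mul_eq0 sl)[//|/eqP]; by rewrite (io_neq0 _ u) (negPf u0).
- exists ((y : B) * io u^-1); first by apply: (W_ior Wy Uv); zmod.
  by rewrite rmulE -mulrA -rmorphM mulVf // rmorph1 mulr1.
Qed.

Fact rmul2_linear a b (c d : B) : linear (fun x : WM a * WM b =>
  (((sval_lin x.1 : B) * c + (sval_lin x.2 : B) * d) : BT)).
Proof.
move=> t x y.
have e1 : sval_lin (t *: x + y).1 = t *: sval_lin x.1 + sval_lin y.1 by exact: linearP.
have e2 : sval_lin (t *: x + y).2 = t *: sval_lin x.2 + sval_lin y.2 by exact: linearP.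
by rewrite e1 e2 !BTZ !mulrDl mulrDr !mulrA addrACA.
Qed.

Lemma WM_det a b : lmod_iso (WM a * WM b)%type (WM (a + b) * WM 0)%type.
Proof.
have [p [q [r [s [Up Uq Ur Us e]]]]] := gp_det gp a b.
have H1 (x : WM a * WM b) :
    W (a + b) ((sval_lin x.1 : B) * io p + (sval_lin x.2 : B) * io q).
  by apply: W_D; [apply: (W_ior (sval_linP x.1) Up)|apply: (W_ior (sval_linP x.2) Uq)]; zmod.
have H2 (x : WM a * WM b) :
    W 0 ((sval_lin x.1 : B) * io r + (sval_lin x.2 : B) * io s).
  by apply: W_D; [apply: (W_ior (sval_linP x.1) Ur)|apply: (W_ior (sval_linP x.2) Us)]; zmod.
have K1 (x : WM (a + b) * WM 0) :
    W a ((sval_lin x.1 : B) * io s - (sval_lin x.2 : B) * io q).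
  apply: W_D; first by apply: (W_ior (sval_linP x.1) Us); zmod.
  by apply: W_N; apply: (W_ior (sval_linP x.2) Uq); zmod.
have K2 (x : WM (a + b) * WM 0) :
    W b (- ((sval_lin x.1 : B) * io r) + (sval_lin x.2 : B) * io p).
  apply: W_D; last by apply: (W_ior (sval_linP x.2) Up); zmod.
  by apply: W_N; apply: (W_ior (sval_linP x.1) Ur); zmod.
have ioC u v : io u * io v = io v * io u by rewrite -!rmorphM mulrC.
have ioe : io p * io s - io q * io r = 1 by rewrite -!rmorphM -rmorphB e rmorph1.
apply: (@lmod_iso_can _ (WM a * WM b)%type (WM (a + b) * WM 0)%type
  (fun x => (msub (W_submodule _) (H1 x), msub (W_submodule _) (H2 x)))
  (fun x => (msub (W_submodule _) (K1 x), msub (W_submodule _) (K2 x)))).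
- move=> t x y; apply/pair_equal_spec; split; apply: sval_lin_inj.
    exact: (@rmul2_linear a b (io p) (io q) t x y).
  exact: (@rmul2_linear a b (io r) (io s) t x y).
- case=> x y; pose X : B := sval_lin x; pose Y : B := sval_lin y.
  apply/pair_equal_spec; split; apply: sval_lin_inj.
    rewrite -[LHS]/((X * io p + Y * io q) * io s - (X * io r + Y * io s) * io q).
    rewrite !mulrDl -!mulrA opprD addrACA [io s * io q]ioC subrr addr0.
    by rewrite [io r * io q]ioC -mulrBr ioe mulr1.
  rewrite -[LHS]/(- ((X * io p + Y * io q) * io r) + (X * io r + Y * io s) * io p).
  rewrite !mulrDl -!mulrA opprD addrACA [io p * io r]ioC addNr add0r.
  by rewrite -mulrN -mulrDr [io s * io p]ioC addrC ioe mulr1.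
- case=> x y; pose X : B := sval_lin x; pose Y : B := sval_lin y.
  apply/pair_equal_spec; split; apply: sval_lin_inj.
    rewrite -[LHS]/((X * io s - Y * io q) * io p + (- (X * io r) + Y * io p) * io q).
    rewrite !mulrDl !mulNr -!mulrA addrACA [io q * io p]ioC addNr addr0.
    by rewrite -mulrBr [io s * io p]ioC [io r * io q]ioC ioe mulr1.
  rewrite -[LHS]/((X * io s - Y * io q) * io r + (- (X * io r) + Y * io p) * io s).
  rewrite !mulrDl !mulNr -!mulrA addrACA [io s * io r]ioC subrr add0r.
  by rewrite addrC -mulrBr ioe mulr1.
Qed.

Lemma WM0_fg : finitely_generated (WM 0).
Proof. exact: fg_iso WM0_iso (finitely_generated_regular T). Qed.

Lemma WM0_proj : projective (WM 0).
Proof. exact: proj_iso WM0_iso (@projective_regular T). Qed.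

Lemma WM_sumN a : lmod_iso (WM a * WM (- a))%type (WM 0 * WM 0)%type.
Proof. by have := WM_det a (- a); rewrite subrr. Qed.

Lemma WM_fg a : finitely_generated (WM a).
Proof.
apply: (@fg_fst _ _ (WM (- a))); apply: fg_iso (lmod_iso_sym (WM_sumN a)) _.
by apply: finitely_generated_prod; exact: WM0_fg.
Qed.

Lemma WM_proj a : projective (WM a).
Proof.
apply: (@proj_fst _ _ (WM (- a))); apply: proj_iso (lmod_iso_sym (WM_sumN a)) _.
by apply: projective_prod; exact: WM0_proj.
Qed.

(** * Left ideals: finite generation and denominators *)

Definition gens (s : seq B) (I : set BT) := (forall x, x \in s -> I x) /\
  forall J : set BT, submodule J -> (forall x, x \in s -> J x) -> forall y, I y -> J y.

Section LeftIdeal.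
Variable I : set BT.
Hypothesis hI : submodule I.
Hypothesis IW : forall b, I b -> W 0 b.

(** Elements of I with exponents in [[0, n)]. As powers of x are units of T, a suitable one moves
    any given element of I into this range. *)
Definition inQ (n : nat) (y : B) := I y /\ forall i, cf y i != 0 -> 0 <= i < n%:Z.

Lemma inQ_D n x y : inQ n x -> inQ n y -> inQ n (x + y).
Proof.
case: hI => _ ID _ [Ix Qx] [Iy Qy]; split; first exact: ID.
move=> i; rewrite (cfD sl); have [x0|/Qx //] := eqVneq (cf x i) 0.
by rewrite x0 add0r => /Qy.
Qed.

Lemma inQ_io n r x : U 0 r -> inQ n x -> inQ n (io r * x).
Proof.
move=> Ur [Ix Qx]; split; first by apply: (submodule_mul hI) => //; exact: W_io.
by move=> i; rewrite (cf_iol sl) mulf_eq0 negb_or => /andP[_ /Qx].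
Qed.

Lemma inQ_xz n m x : inQ n x -> inQ (n + m) (xz m%:Z * x).
Proof.
move=> [Ix Qx]; split; first by apply: (submodule_mul hI) => //; exact: W_xz.
by move=> i; rewrite (cf_xl sl) fmorph_eq0 => /Qx; lia.
Qed.

Lemma inQ_N n x : inQ n x -> inQ n (- x).
Proof.
move=> [Ix Qx]; split; first exact: submodule_opp.
by move=> i; rewrite (cfN sl) oppr_eq0 => /Qx.
Qed.

Lemma inQ_lt n x : inQ n.+1 x -> cf x n%:Z = 0 -> inQ n x.
Proof.
move=> [Ix Qx] x0; split=> // i xi; have := Qx i xi.
have [in_|] := eqVneq i n%:Z; first by move: xi; rewrite in_ x0 eqxx.
by lia.
Qed.

Lemma inQ_ex x : I x -> exists n m : nat, inQ m (xz n%:Z * x).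
Proof.
move=> Ix; have [N Nx] := sl_cf_fin sl x; exists N, N.*2.+1.
split; first by apply: (submodule_mul hI) => //; exact: W_xz.
by move=> i; rewrite (cf_xl sl) fmorph_eq0 => /Nx; lia.
Qed.

Lemma inQ_eq0 x : inQ 0 x -> x = 0.
Proof.
move=> [_ Qx]; apply: (sl_cf_inj sl) => i; rewrite (cf0 sl).
by apply/eqP; apply: contrapT => /negP /Qx; lia.
Qed.

(** Hilbert's basis theorem. The coefficients of [x^n] in [inQ n.+1] form a submodule of [U_0];
    twisted by [sg (- n)] they increase with n, and their union is again a submodule. Each of these
    has two generators. *)
Lemma noetherian_gens : exists s, gens s I.
Proof.
have I0 : I 0 by case: hI.
have Q0 n : inQ n 0 by split=> // i; rewrite (cf0 sl) eqxx.
(* Generators for each single degree; they will be used in the degrees below N. *)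
have /choice[f fP] : forall n : nat, exists p : B * B, [/\ inQ n.+1 p.1, inQ n.+1 p.2 &
    forall y, inQ n.+1 y -> exists r s,
    [/\ U 0 r, U 0 s & cf y n%:Z = r * cf p.1 n%:Z + s * cf p.2 n%:Z]].
  move=> n; have [|||| p [q [[y Qy yp] [z Qz zq] pq]]] := @gp_two_gens _ _ _ _ _ _ _ gp 0
    (fun c => exists2 y, inQ n.+1 y & cf y n%:Z = c).
  - by exists 0; rewrite ?(cf0 sl).
  - by move=> _ [y [Iy _] <-]; exact: IW.
  - by move=> _ _ [y Qy <-] [z Qz <-]; exists (y + z); [exact: inQ_D|rewrite (cfD sl)].
  - by move=> r _ Ur [y Qy <-]; exists (io r * y); [exact: inQ_io|rewrite (cf_iol sl)].
  exists (y, z); split=> // x Qx; rewrite yp zq.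
  by apply: pq; exists x.
have cfx (n m : nat) y : sg (- (n + m)%N%:Z) (cf (xz m%:Z * y) (n + m)%N%:Z) = sg (- n%:Z) (cf y n%:Z).
  rewrite (cf_xl sl) -(gp_sgD gp); congr (sg _ (cf y _)); lia.
have [|||| p [q [[n [y Qy yp]] [m [z Qz zq]] pq]]] := @gp_two_gens _ _ _ _ _ _ _ gp 0
    (fun c => exists n : nat, exists2 y, inQ n.+1 y & sg (- n%:Z) (cf y n%:Z) = c).
- by exists 0%N, 0; rewrite ?(cf0 sl) ?rmorph0.
- by move=> _ [n [y [Iy _] <-]]; apply: (gp_sgU gp); exact: IW.
- move=> _ _ [n [y Qy <-]] [m [z Qz <-]]; exists (n + m)%N, (xz m%:Z * y + xz n%:Z * z).
    apply: inQ_D; first by rewrite -addSn; exact: inQ_xz.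
    by rewrite addnC -addSn; exact: inQ_xz.
  by rewrite (cfD sl) rmorphD cfx addnC cfx.
- move=> r _ Ur [n [y Qy <-]]; exists n, (io (sg n%:Z r) * y).
    by apply: inQ_io => //; exact: (gp_sgU gp).
  by rewrite (cf_iol sl) rmorphM (gp_sgK gp).
(* The two generators of the union are moved to the common degree N. *)
pose N := (n + m)%N; pose y' := xz m%:Z * y; pose z' := xz n%:Z * z.
have Qy' : inQ N.+1 y' by rewrite /N -addSn; exact: inQ_xz.
have Qz' : inQ N.+1 z' by rewrite /N addnC -addSn; exact: inQ_xz.
have yp' : sg (- N%:Z) (cf y' N%:Z) = p by rewrite cfx.
have zq' : sg (- N%:Z) (cf z' N%:Z) = q by rewrite /N addnC cfx.
exists ([:: y'; z'] ++ [seq (f k).1 | k <- iota 0 N] ++ [seq (f k).2 | k <- iota 0 N]).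
split=> [x|J hJ Js].
  rewrite !mem_cat !inE => /orP[/orP[/eqP ->|/eqP ->]|/orP[]/mapP[k _ ->]].
  - by case: Qy'.
  - by case: Qz'.
  - by have [[]] := fP k.
  - by have [_ []] := fP k.
have Jy : J y' by apply: Js; rewrite !mem_cat !inE eqxx.
have Jz : J z' by apply: Js; rewrite !mem_cat !inE eqxx orbT.
have Jf k : (k < N)%N -> J (f k).1 /\ J (f k).2.
  move=> kN; split; apply: Js; rewrite !mem_cat; apply/orP; right; apply/orP; [left|right];
    by apply: map_f; rewrite mem_iota add0n.
(* The leading term is cancelled by the generators of its own degree below N, and by shifts of [y']
   and [z'] from N on. *)
have JQ : forall k x, inQ k x -> J x.
  elim=> [|k IHk] x Qx; first by rewrite (inQ_eq0 Qx); case: hJ.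
  have [kN|Nk] := ltnP k N.
    have [Q1 Q2 fk] := fP k; have [J1 J2] := Jf k kN.
    have [r [s [Ur Us xE]]] := fk x Qx.
    pose w := io r * (f k).1 + io s * (f k).2.
    have Jw : J w.
      by case: (hJ) => _ JD _; apply: JD; apply: (submodule_mul hJ) => //; exact: W_io.
    have -> : x = (x - w) + w by rewrite subrK.
    case: (hJ) => _ JD _; apply: JD => //; apply: IHk; apply: inQ_lt.
      by apply: inQ_D => //; apply: inQ_N; apply: inQ_D; exact: inQ_io.
    by rewrite (cfD sl) (cfN sl) (cfD sl) !(cf_iol sl) -xE subrr.
  have [r [s [Ur Us xE]]] := pq (sg (- k%:Z) (cf x k%:Z)) (ex_intro _ k (ex_intro2 _ _ x Qx erefl)).
  pose w := io (sg k%:Z r) * (xz (k - N)%N%:Z * y') + io (sg k%:Z s) * (xz (k - N)%N%:Z * z').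
  have Jw : J w.
    case: (hJ) => _ JD _; apply: JD; apply: (submodule_mul hJ);
      try (by apply: W_io; exact: (gp_sgU gp)); apply: (submodule_mul hJ) => //; exact: W_xz.
  have -> : x = (x - w) + w by rewrite subrK.
  case: (hJ) => _ JD _; apply: JD => //; apply: IHk.
  have kE : k.+1 = (N.+1 + (k - N))%N by lia.
  apply: inQ_lt.
    apply: inQ_D => //; apply: inQ_N; apply: inQ_D; apply: inQ_io;
      try exact: (gp_sgU gp); by rewrite kE; exact: inQ_xz.
  apply: (can_inj (gp_sgK gp (- k%:Z))); rewrite rmorph0.
  rewrite (cfD sl) (cfN sl) (cfD sl) !(cf_iol sl) !(cf_xl sl (k - N)%N%:Z).
  have kNE : k%:Z - (k - N)%N%:Z = N%:Z by lia.
  rewrite kNE rmorphB rmorphD !rmorphM !(gp_sgK gp) -!(gp_sgD gp).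
  have -> : - k%:Z + (k - N)%N%:Z = - N%:Z by lia.
  by rewrite yp' zq' xE subrr.
move=> x Ix; have [k [l Qx]] := inQ_ex Ix.
have -> : x = xz (- k%:Z) * (xz k%:Z * x) by rewrite mulrA (xzNK sl) mul1r.
by apply: (submodule_mul hJ); [exact: W_xz|exact: JQ Qx].
Qed.

(* Division by an element of minimal width shows that [I] is isomorphic to a
   left ideal which contains a nonzero element of [U 0]. *)
Lemma left_ideal_iso : (exists2 y, I y & y != 0) ->
  exists (J : set BT) (hJ : submodule J) c, [/\ forall b, J b -> W 0 b, U 0 c, c != 0,
    J (io c) & lmod_iso (submod hI) (submod hJ)].
Proof.
move=> [y0 Iy0 y00].
have exw : exists n : nat, `[< exists2 w, inQ n w & w != 0 >].
  have [k [m Qy]] := inQ_ex Iy0; exists m; apply/asboolP; exists (xz k%:Z * y0) => //.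
  apply/eqP => e; move/eqP: y00; apply.
  by rewrite -[y0]mul1r -(xzNK sl k%:Z) -mulrA e mulr0.
case: (ex_minnP exw) => m /asboolP[w Qw w0] mmin.
have zero_min n x : (n < m)%N -> inQ n x -> x = 0.
  move=> nm Qx; apply/eqP; apply: contraTT nm => x0; rewrite -leqNgt.
  by apply: mmin; apply/asboolP; exists x.
case: m Qw mmin zero_min => [/inQ_eq0 e|n Qw _ zero_min]; first by rewrite e eqxx in w0.
have wn : cf w n%:Z != 0 by apply: contra w0 => /eqP wn; apply/eqP; apply: zero_min (inQ_lt Qw wn).
have Iw : I w by case: Qw.
(* Pseudo-division by w: a remainder is narrower than w, hence zero. *)
have pseudo : forall k x, inQ k x ->
    exists a q, [/\ U 0 a, a != 0, W 0 q & io a * x = q * w].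
  elim=> [|k IHk] x Qx.
    rewrite (inQ_eq0 Qx); exists 1, 0; rewrite mulr0 mul0r; split=> //.
    - exact: (gp_1 gp).
    - exact: oner_neq0.
    - exact: W_0.
  have [kn|nk] := ltnP k n.
    rewrite (zero_min k.+1 x _ Qx) //; exists 1, 0; rewrite mulr0 mul0r; split=> //.
    - exact: (gp_1 gp).
    - exact: oner_neq0.
    - exact: W_0.
  pose a := sg (k - n)%N%:Z (cf w n%:Z).
  have Ua : U 0 a by apply: (gp_sgU gp); exact: IW.
  have Ux : U 0 (cf x k%:Z) by apply: IW; case: Qx.
  pose x' := io a * x - io (cf x k%:Z) * (xz (k - n)%N%:Z * w).
  have [a' [q [Ua' a'0 Wq xq]]] : exists a' q, [/\ U 0 a', a' != 0, W 0 q & io a' * x' = q * w].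
    apply: IHk; apply: inQ_lt.
      apply: inQ_D; first exact: inQ_io.
      apply: inQ_N; apply: inQ_io => //.
      have -> : k.+1 = (n.+1 + (k - n))%N by lia.
      exact: inQ_xz.
    rewrite (cfD sl) (cfN sl) !(cf_iol sl) (cf_xl sl).
    have -> : k%:Z - (k - n)%N%:Z = n%:Z by lia.
    by rewrite mulrC subrr.
  exists (a' * a), (q + io (a' * cf x k%:Z) * xz (k - n)%N%:Z); split.
  - by apply: (gp_Me gp Ua' Ua); zmod.
  - by rewrite mulf_neq0 // fmorph_eq0.
  - apply: W_D => //; apply: (W_Me _ (W_xz _)); last by rewrite addr0.
    by apply: W_io; apply: (gp_Me gp Ua' Ux); zmod.
  rewrite mulrDl -xq mulrBr !rmorphM -!mulrA -addrA.
  by rewrite [X in _ + X]addNr addr0.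
(* I equals [J0 w], but the elements of [J0] have denominators, which are cleared next. *)
pose J0 : set BT := fun b => I (b * w).
have hJ0 : submodule J0.
  case: (hI) => I0 ID IZ; split; rewrite /J0.
  - by rewrite mul0r.
  - by move=> x y; rewrite mulrDl; exact: ID.
  - by move=> t x; rewrite BTZ -mulrA; exact: IZ.
have J01 : J0 1 by rewrite /J0 mul1r.
have div x : I x -> exists b a, [/\ x = b * w, U 0 a, a != 0 & W 0 (io a * b)].
  move=> Ix; have [k [l Qx]] := inQ_ex Ix.
  have [a [q [Ua a0 Wq xq]]] := pseudo l _ Qx.
  have a'0 : sg (- k%:Z) a != 0 by rewrite fmorph_eq0.
  exists (io (sg (- k%:Z) a)^-1 * (xz (- k%:Z) * q)), (sg (- k%:Z) a); split=> //.
  - rewrite -!mulrA -xq [xz (- _) * (io a * _)]mulrA (sl_comm sl) -!mulrA.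
    by rewrite [xz (- _) * (xz _ * _)]mulrA (xzNK sl) mul1r (ioVK _ _ a'0).
  - exact: (gp_sgU gp).
  - by rewrite (ioKV _ _ a'0); apply: (W_Me (W_xz _) Wq); rewrite addr0.
pose good c x := exists b, x = b * w /\ W 0 (b * io c).
have goodex x : I x -> exists c, [/\ U 0 c, c != 0 & good c x].
  move=> /div[b [a [-> Ua a0 Wab]]].
  have [N Nb] := sl_cf_fin sl b.
  (* The scalar a is a left denominator of b. For a right denominator c, it suffices that a divides
     [sg i c] for each exponent i of b; so c is the product of the [sg (- i) a] over [|i| <= N],
     with [i = k - N]. *)
  pose c := \prod_(k < N.*2.+1) sg (N%:Z - k%:Z) a.
  have Uc : U 0 c.
    have := gp_prod gp (index_enum _) (P := xpredT) (d := fun=> 0)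
      (F := fun k : 'I_N.*2.+1 => sg (N%:Z - k%:Z) a) (fun k _ => gp_sgU gp _ Ua).
    by rewrite big1.
  have c0 : c != 0 by apply/prodf_neq0 => k _; rewrite fmorph_eq0.
  exists c; split=> //; exists b; split=> // i; rewrite (cf_ior sl).
  have [->|/Nb iN] := eqVneq (cf b i) 0; first by rewrite mul0r; exact: (gp_0 gp).
  have klt : (absz (N%:Z + i)%R < N.*2.+1)%N by lia.
  rewrite /c (bigD1 (Ordinal klt)) //= rmorphM -(gp_sgD gp).
  have -> : i + (N%:Z - (absz (N%:Z + i))%:Z) = 0 by lia.
  rewrite (gp_sg0 gp) mulrA [_ * a]mulrC -(cf_iol sl).
  apply: (gp_Me gp (Wab i) _ (esym (addr0 0))); apply: (gp_sgU gp).
  have := gp_prod gp (index_enum _) (P := fun k => k != Ordinal klt) (d := fun=> 0)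
    (F := fun k : 'I_N.*2.+1 => sg (N%:Z - k%:Z) a) (fun k _ => gp_sgU gp _ Ua).
  by rewrite big1.
have goodM c c' x : U 0 c' -> good c x -> good (c * c') x.
  move=> Uc' [b [xb Wb]]; exists b; split=> //; rewrite rmorphM mulrA.
  by apply: (W_ior Wb Uc'); rewrite addr0.
have [s [sI Igen]] := noetherian_gens.
(* Since I is finitely generated, one right denominator c serves all of [J0]; then [J0 c] lies in
   [W_0], and it contains c because [J0] contains 1. *)
have [c [Uc c0 cs]] : exists c, [/\ U 0 c, c != 0 & forall x, x \in s -> good c x].
  elim: s sI {Igen} => [|x s IHs] sI.
    by exists 1; split=> //; [exact: (gp_1 gp)|exact: oner_neq0].
  have [|c [Uc c0 cs]] := IHs; first by move=> z zs; apply: sI; rewrite inE zs orbT.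
  have [|c' [Uc' c'0 cx]] := goodex x; first by apply: sI; rewrite inE eqxx.
  exists (c * c'); split; first by apply: (gp_Me gp Uc Uc'); rewrite addr0.
    exact: mulf_neq0.
  move=> z; rewrite inE => /predU1P[->|zs]; first by rewrite mulrC; exact: goodM.
  by apply: goodM => //; exact: cs.
have hgood : submodule (good c : set BT).
  split.
  - by exists 0; rewrite !mul0r; split=> //; exact: W_0.
  - move=> x y [b [-> Wb]] [b' [-> Wb']]; exists (b + b'); rewrite !mulrDl; split=> //.
    exact: W_D.
  - move=> t x [b [-> Wb]]; exists (j t * b); rewrite BTZ mulrA; split=> //.
    by rewrite -mulrA; apply: (W_Me (jW0 t) Wb); rewrite addr0.
have J0c b : J0 b -> W 0 (b * io c).
  move=> J0b; have [b' [bw Wb']] := Igen _ hgood cs _ J0b.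
  by have -> : b = b' by apply: (skew_mulI sl w0).
pose J : set BT := fun y => exists2 b, J0 b & y = b * io c.
have hJ : submodule J.
  case: (hJ0) => J00 J0D J0Z; split.
  - by exists 0; rewrite ?mul0r.
  - by move=> x y [b Jb ->] [b' Jb' ->]; exists (b + b'); rewrite ?mulrDl //; exact: J0D.
  - by move=> t x [b Jb ->]; exists (t *: (b : BT)); [exact: J0Z|rewrite !BTZ mulrA].
exists J, hJ, c; split=> //.
- by move=> _ [b Jb ->]; exact: J0c.
- by exists 1; rewrite ?mul1r.
have e1 : lmod_iso (submod hJ0) (submod hI).
  apply: (@submod_iso _ _ _ _ _ _ _ (rmul w)) => [//|x Jx|x Ix].
    by rewrite rmulE => /(skew_mul_eq0 sl)[//|e]; rewrite e eqxx in w0.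
  by have [b [a [xb _ _ _]]] := div x Ix; exists b; rewrite ?rmulE // /J0 -xb.
apply: lmod_iso_trans (lmod_iso_sym e1) _.
apply: (@submod_iso _ _ _ _ _ _ _ (rmul (io c))) => [x Jx|x Jx|x [b Jb ->]].
- by exists x.
- by rewrite rmulE => /(skew_mul_eq0 sl)[//|/eqP]; rewrite (io_neq0 _ c) (negPf c0).
- by exists b.
Qed.

End LeftIdeal.

(** * Simple quotients of [W_d] and the stable class of a left ideal *)

Lemma gp_prime_ndvdM a b e p u v : gp_prime U e p -> U a u -> U b v ->
  ~ U (a - e) (u / p) -> ~ U (b - e) (v / p) -> ~ U (a + b - e) (u * v / p).
Proof. by move=> pp Uu Uv nu nv /(gp_prime_dvd gp pp Uu Uv)[]. Qed.

Lemma gp_prime_ndvd1 e p : gp_prime U e p -> ~ U (0 - e) (1 / p).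
Proof. by move=> [_ _ np _]; rewrite sub0r div1r. Qed.

Lemma gp_prime_ndvd_prod (I : Type) (r : seq I) (P : pred I) e p (d : I -> D) F :
  gp_prime U e p -> (forall i, P i -> U (d i) (F i)) ->
  (forall i, P i -> ~ U (d i - e) (F i / p)) ->
  ~ U (\sum_(i <- r | P i) d i - e) ((\prod_(i <- r | P i) F i) / p).
Proof.
move=> pp UF nF; elim: r => [|i r IHr]; first by rewrite !big_nil; exact: gp_prime_ndvd1.
rewrite !big_cons; case: ifP => // Pi.
by apply: gp_prime_ndvdM => //; [exact: UF|exact: (gp_prod gp)|exact: nF].
Qed.

(** Moved across [x^i], p becomes [sg i p]: divisibility by p on the right means divisibility of
    each coefficient i by [sg i p]. *)
Lemma W_divp d e p z : p != 0 -> U e p -> (forall i, U (d - e) (cf z i / sg i p)) ->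
  exists2 b, W (d - e) b & z = b * io p.
Proof.
move=> p0 Up Uz; exists (z * io p^-1).
  by move=> i; rewrite (cf_ior sl) fmorphV; exact: Uz.
by rewrite -mulrA -rmorphM mulVf // rmorph1 mulr1.
Qed.

(* [W d] modulo [W (d - e) p] is simple: since the primes [sg i p] are pairwise
   non-associate, multiplying by a suitable element of [U 0] kills all
   coefficients of [w] modulo [p] but one. *)
Lemma W_simple d e p (J : set BT) w k : gp_prime U e p -> submodule J ->
  (forall b, W (d - e) b -> J (b * io p)) -> J w -> W d w ->
  ~ U (d - e) (cf w k / sg k p) -> forall y, W d y -> J y.
Proof.
move=> pp hJ Jp Jw Ww nw; have [Up p0 np pirr] := pp.
have [N Nw] := sl_cf_fin sl w.
have [J0 JD _] := hJ.
(* The product q is divisible by [sg i p] for every exponent i of w other than k, and prime to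
   [sg k p] because distinct shifts are not associate. *)
pose P (i : 'I_N.*2.+1) := i%:Z - N%:Z != k.
pose q := \prod_(i | P i) sg (i%:Z - N%:Z) p; pose m := \sum_(i | P i) e.
have ppk i : gp_prime U e (sg i p) := gp_prime_sg gp i pp.
have Uk i : U e (sg i p) by case: (ppk i).
have Uq : U m q by apply: (gp_prod gp).
have nq : ~ U (m - e) (q / sg k p).
  apply: gp_prime_ndvd_prod => // i Pi; rewrite subrr.
  by exact: (gp_prime_orbit gp pp Pi).
(* A factor r of degree [- m] prime to [sg k p] brings the multiplier back to degree 0. One of r1
   and s1 will do, for otherwise [sg k p] would divide 1. *)
have [r Ur nr] : exists2 r, U (- m) r & ~ U (- m - e) (r / sg k p).
  have [p1 [q1 [r1 [s1 [Up1 Uq1 Ur1 Us1 e1]]]]] := gp_split gp m.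
  have [Ur1p|] := pselect (U (- m - e) (r1 / sg k p)); last by exists r1.
  have [Us1p|] := pselect (U (- m - e) (s1 / sg k p)); last by exists s1.
  exfalso; apply: (gp_prime_ndvd1 (ppk k)); rewrite -e1 mulrBl -!mulrA.
  by apply: (gp_B gp); [apply: (gp_Me gp Up1 Us1p)|apply: (gp_Me gp Uq1 Ur1p)]; zmod.
pose a := q * r; have Ua : U 0 a by apply: (gp_Me gp Uq Ur); rewrite subrr.
pose c := a * cf w k.
have Uc : U d c by apply: (gp_Me gp Ua (Ww k)); rewrite add0r.
have nc : ~ U (d - e) (c / sg k p).
  rewrite -[d]add0r; apply: (gp_prime_ndvdM (ppk k)) => //.
  by rewrite -(subrr m); apply: (gp_prime_ndvdM (ppk k)).
have Jc : J (io c * xz k).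
  have -> : io c * xz k = io a * w - (io a * w - io c * xz k) by rewrite subKr.
  apply: (submodule_sub hJ); first by apply: (submodule_mul hJ) => //; exact: W_io.
  suff [b Wb ->] : exists2 b, W (d - e) b & io a * w - io c * xz k = b * io p by exact: Jp.
  apply: (W_divp p0 Up) => i; rewrite (sl_cfB sl) (cf_iol sl) (sl_cf_mon sl).
  have [ik|ik] := eqVneq i k; first by rewrite ik subrr mul0r; exact: (gp_0 gp).
  rewrite subr0; have [->|/Nw iN] := eqVneq (cf w i) 0.
    by rewrite mulr0 mul0r; exact: (gp_0 gp).
  have klt : (absz (N%:Z + i)%R < N.*2.+1)%N by lia.
  have [i0 i0E] : exists i0 : 'I_N.*2.+1, i0%:Z - N%:Z = i.
    by exists (Ordinal klt) => /=; lia.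
  have Pi0 : P i0 by rewrite /P i0E.
  rewrite /a /q (bigD1 i0) //= i0E.
  set q' := \prod_(_ | _) _.
  have -> : sg i p * q' * r * cf w i / sg i p = q' * (r * cf w i).
    by rewrite -!mulrA mulrC -!mulrA mulVf ?mulr1 // fmorph_eq0.
  have Uq' : U (m - e) q'.
    have -> : m - e = \sum_(i | P i && (i != i0)) e by rewrite /m (bigD1 i0) //= addrC addrK.
    exact: (gp_prod gp).
  by apply: (gp_Me gp Uq' (gp_M gp Ur (Ww i))); zmod.
(* All that remains of w is [c x^k], and c is invertible modulo [sg k p]; hence J contains every
   [u x^k] with u of degree d, and powers of x give the other exponents. *)
have [r' [s' [Ur' Us' rs1]]] := gp_prime_coprime gp (ppk k) Uc nc.
move=> y Wy; apply: (@skew_ind _ _ _ _ _ _ sl J y) => // i.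
pose u := sg (k - i) (cf y i).
have Uu : U d u by apply: (gp_sgU gp).
have -> : io (cf y i) * xz i = xz (i - k) * (io u * xz k).
  rewrite mulrA (sl_comm sl) -mulrA -(sl_xD sl) subrK; congr (io _ * _).
  by rewrite /u -(gp_sgD gp) -[k - i]opprB subrr (gp_sg0 gp).
apply: (submodule_mul hJ); first exact: W_xz.
have -> : io u * xz k = io (u * r') * (io c * xz k) + (io (u * s') * xz k) * io p.
  rewrite -[X in _ = _ + X]mulrA (sl_comm sl) !mulrA -!rmorphM -mulrDl -rmorphD.
  by rewrite -!mulrA -mulrDr rs1 mulr1.
apply: JD; first by apply: (submodule_mul hJ) => //; apply: W_io; apply: (gp_Me gp Uu Ur'); zmod.
apply: Jp; apply: (W_Me (b := 0) _ (W_xz k)); last by rewrite addr0.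
by apply: W_io; apply: (gp_Me gp Uu Us'); zmod.
Qed.

Definition rank_one (M : lmodType T) := [/\ finitely_generated M, projective M
  & exists a, stably_iso M (WM a)].

Lemma rank_one_iso M N : lmod_iso M N -> rank_one N -> rank_one M.
Proof.
move=> MN [fN pN [a [Q [fQ pQ NQ]]]]; split.
- exact: fg_iso (lmod_iso_sym MN) fN.
- exact: proj_iso (lmod_iso_sym MN) pN.
- by exists a, Q; split=> //; apply: lmod_iso_trans NQ; exact: lmod_iso_prodl.
Qed.

Lemma WM_rank_one a : rank_one (WM a).
Proof.
split; [exact: WM_fg|exact: WM_proj|exists a].
exact/iso_stably/lmod_iso_refl.
Qed.

Lemma submod_eq_iso (J J' : set BT) (hJ : submodule J) (hJ' : submodule J') :
  (forall x, J x <-> J' x) -> lmod_iso (submod hJ) (submod hJ').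
Proof.
move=> JJ'; apply: (@submod_iso _ _ _ _ _ _ _ idfun) => [x /JJ'|x _|y /JJ' Jy] //.
by exists y.
Qed.

Lemma Wp_iso d e p (P : set BT) (hP : submodule P) : p != 0 -> U e p ->
  (forall x, P x <-> exists2 b, W (d - e) b & x = b * io p) ->
  lmod_iso (submod hP) (WM (d - e)).
Proof.
move=> p0 Up PE; apply/lmod_iso_sym.
apply: (@submod_iso _ _ _ _ _ _ _ (rmul (io p))) => [x Wx|x Wx|y /PE[b Wb ->]].
- by apply/PE; exists x.
- by rewrite rmulE => /(skew_mul_eq0 sl)[//|/eqP]; rewrite (io_neq0 _ p) (negPf p0).
- by exists b.
Qed.

(** Induction on the length of u. For a prime factor p of u, of degree e, let [u' = u / p] and
    [J' = J + W_(e-d) u'], to which induction applies. The part [P0] of [W_(e-d)] that u' sends into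
    J contains [W_(e-d-e) p], and [W_(e-d)] modulo the latter is simple. So either [J = J'], or the
    map from the direct sum of J and [W_(e-d)] onto [J'] has kernel isomorphic to [W_(e-d-e)], and
    it splits. *)
Lemma rank_one_between d u (J : set BT) (hJ : submodule J) : U d u -> u != 0 ->
  (forall b, J b -> W 0 b) -> (forall b, W (- d) b -> J (b * io u)) -> rank_one (submod hJ).
Proof.
have [n] := ubnP (len u); elim: n => // n IHn in d u J hJ *.
move=> /ltnSE lun Uu u0 JW Ju.
have [Uv|nu] := pselect (U (- d) u^-1).
  apply: rank_one_iso (WM_rank_one 0); apply: submod_eq_iso => x; split=> [/JW //|Wx].
  have -> : x = (x : B) * io u^-1 * io u by rewrite -mulrA -rmorphM mulVf // rmorph1 mulr1.
  by apply: Ju; apply: (W_ior Wx Uv); zmod.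
have [e [p [pp Uup]]] := gp_prime_ex gp Uu u0 nu.
have [Up p0 np _] := pp.
pose u' := u / p; have u'0 : u' != 0 by rewrite mulf_neq0 // invr_eq0.
have uE : u = u' * p by rewrite divfK.
have lu' : (len u' < n)%N.
  apply: leq_trans lun; rewrite uE (gp_lenM gp Uup Up u'0 p0) -addn1 leq_add2l lt0n.
  by apply/eqP => lp; apply: np; exact: (gp_len0 gp) lp.
have [J0 JD JZ] := hJ.
pose J' : set BT := fun y => exists z b, [/\ J z, W (e - d) b & y = (z : B) + b * io u'].
have hJ' : submodule J'.
  split.
  - by exists 0, 0; rewrite mul0r addr0; split=> //; exact: W_0.
  - move=> _ _ [z [b [Jz Wb ->]]] [z' [b' [Jz' Wb' ->]]].
    exists (z + z'), (b + b'); rewrite mulrDl addrACA; split=> //; first exact: JD.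
    exact: W_D.
  - move=> t _ [z [b [Jz Wb ->]]]; exists (t *: z), (j t * b); rewrite !BTZ mulrDr mulrA.
    by split=> //; [exact: JZ|apply: (W_Me (jW0 t) Wb); zmod].
have JJ' z : J z -> J' z by exists z, 0; rewrite mul0r addr0; split=> //; exact: W_0.
have JW' b : W (e - d) b -> J' (b * io u') by exists 0, b; rewrite add0r.
have [fJ' pJ' [a' [Q [fQ pQ J'Q]]]] : rank_one (submod hJ').
  apply: (IHn _ u') => //; first exact: Uup.
    move=> _ [z [b [Jz Wb ->]]]; apply: W_D; first exact: JW.
    by apply: (W_ior Wb Uup); zmod.
  by move=> b; rewrite opprB; exact: JW'.
pose P0 : set BT := fun b => W (e - d) b /\ J ((b : B) * io u').
have hP0 : submodule P0.
  split.
  - by split; [exact: W_0|rewrite mul0r].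
  - move=> x y [Wx Jx] [Wy Jy]; split; first exact: W_D.
    by rewrite mulrDl; exact: JD.
  - move=> t x [Wx Jx]; split; first by apply: (W_Me (jW0 t) Wx); zmod.
    by rewrite BTZ -mulrA; exact: JZ.
have P0p b : W (e - d - e) b -> P0 (b * io p).
  move=> Wb; split; first by apply: (W_ior Wb Up); zmod.
  rewrite -mulrA -rmorphM mulrC -uE; apply: Ju.
  by have <- : e - d - e = - d by zmod.
have [[w [k [[Ww Jw] nw]]]|P0all] := pselect (exists w k,
    P0 w /\ ~ U (e - d - e) (cf w k / sg k p)).
  apply: rank_one_iso (IHn (d - e) u' J' hJ' lu' Uup u'0 _ _); last 2 first.
  - move=> _ [z [b [Jz Wb ->]]]; apply: W_D; first exact: JW.
    by apply: (W_ior Wb Uup); zmod.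
  - by move=> b; rewrite opprB; exact: JW'.
  apply: submod_eq_iso => x; split=> [/JJ' //|[z [b [Jz Wb ->]]]]; apply: JD => //.
  by have [] := W_simple pp hP0 P0p (conj Ww Jw) Ww nw Wb.
have P0E x : P0 x <-> exists2 b, W (e - d - e) b & x = b * io p.
  split=> [P0x|[b Wb ->]]; last exact: P0p.
  apply: (W_divp p0 Up) => i; apply: contrapT => nx; apply: P0all.
  by exists x, i.
have P0iso := Wp_iso hP0 p0 Up P0E.
pose F (x : submod hJ * WM (e - d)) : BT := (sval_lin x.1 : B) + (sval_lin x.2 : B) * io u'.
have Fl : linear F.
  move=> t x y; rewrite /F.
  have e1 : sval_lin (t *: x + y).1 = t *: sval_lin x.1 + sval_lin y.1 by exact: linearP.
  have e2 : sval_lin (t *: x + y).2 = t *: sval_lin x.2 + sval_lin y.2 by exact: linearP.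
  by rewrite e1 e2 !BTZ !mulrDl mulrDr !mulrA addrACA.
have FJ' x : J' (mklin Fl x).
  by exists (sval_lin x.1), (sval_lin x.2); split=> //; exact: sval_linP.
have [g gE] := submod_lift hJ' FJ'.
have gS y : exists x, g x = y.
  have [z [b [Jz Wb yE]]] := sval_linP y.
  exists (msub hJ Jz, msub (W_submodule (e - d)) Wb); apply: sval_lin_inj.
  by rewrite gE yE.
have Kiso : lmod_iso (submod (ker_submodule g)) (submod hP0).
  have fl : linear (fun x : submod (ker_submodule g) => sval_lin (sval_lin x).2).
    move=> t x y.
    have e1 : sval_lin (t *: x + y) = t *: sval_lin x + sval_lin y by exact: linearP.
    by rewrite e1; exact: linearP.
  have Fker (x : submod (ker_submodule g)) :
      (sval_lin (sval_lin x).1 : B) = - ((sval_lin (sval_lin x).2 : B) * io u').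
    have gx : g (sval_lin x) = 0 := sval_linP x.
    apply/eqP; rewrite -addr_eq0; apply/eqP.
    by rewrite -[LHS]/(F (sval_lin x)) -(mklinE Fl) -gE gx linear0.
  have fP0 x : P0 (mklin fl x).
    rewrite mklinE; split; first exact: sval_linP.
    rewrite -[X in J X]opprK -Fker; apply: (submodule_opp hJ); exact: sval_linP.
  have [h hE] := submod_lift hP0 fP0.
  apply: (@lmod_iso_bij _ _ _ h) => [x y xy|y].
    have e2 : (sval_lin x).2 = (sval_lin y).2.
      by apply: sval_lin_inj; have := congr1 (fun z => sval_lin z) xy; rewrite !hE !mklinE.
    have e1 : (sval_lin x).1 = (sval_lin y).1.
      by apply: sval_lin_inj; rewrite [LHS]Fker [RHS]Fker e2.
    apply: sval_lin_inj; move: e1 e2.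
    by case: (sval_lin x) => ? ?; case: (sval_lin y) => ? ? /= -> ->.
  have [Wy Jy] := sval_linP y.
  pose z : submod hJ * WM (e - d) :=
    (msub hJ (submodule_opp hJ Jy), msub (W_submodule (e - d)) Wy).
  have gz : g z = 0.
    apply: sval_lin_inj; rewrite gE linear0 -[LHS]/(- ((sval_lin y : B) * io u') + _).
    exact: addNr.
  by exists (msub (ker_submodule g) gz); apply: sval_lin_inj; rewrite hE.
have iso1 : lmod_iso (submod hJ * WM (e - d))%type (WM (e - d - e) * submod hJ')%type.
  apply: lmod_iso_trans (projective_split pJ' gS) _; apply: lmod_iso_prodl.
  exact: lmod_iso_trans Kiso P0iso.
split.
- apply: (@fg_fst _ _ (WM (e - d))); apply: fg_iso (lmod_iso_sym iso1) _.
  by apply: finitely_generated_prod => //; exact: WM_fg.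
- apply: (@proj_fst _ _ (WM (e - d))); apply: proj_iso (lmod_iso_sym iso1) _.
  by apply: projective_prod => //; exact: WM_proj.
(* The degree solves [J + W_(e-d) = W_(e-d-e) + J'] with [J'] of class [a']. The two copies of [W_0]
   stand for [W_(e-d) + W_(d-e)], which is added to cancel [W_(e-d)]. *)
exists (e - d - e + a' - (e - d)), ((WM 0 * WM 0) * Q)%type; split.
- by apply: finitely_generated_prod => //; apply: finitely_generated_prod; exact: WM_fg.
- by apply: projective_prod => //; apply: projective_prod; exact: WM_proj.
set b := e - d - e in iso1 *; set a := e - d in b iso1 *.
apply: (@lmod_iso_trans _ _ ((submod hJ * WM a) * (WM (- a) * Q))%type).
  apply: (@lmod_iso_trans _ _ (submod hJ * ((WM a * WM (- a)) * Q))%type); last by mod_ac.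
  by apply/lmod_iso_prodr/lmod_iso_prodl/lmod_iso_sym; exact: WM_sumN.
apply: lmod_iso_trans (lmod_iso_prodl _ iso1) _.
apply: (@lmod_iso_trans _ _ ((submod hJ' * Q) * (WM b * WM (- a)))%type); first by mod_ac.
apply: lmod_iso_trans (lmod_iso_prodl _ J'Q) _.
apply: (@lmod_iso_trans _ _ ((WM b * WM a') * (WM (- a) * Q))%type); first by mod_ac.
apply: lmod_iso_trans (lmod_iso_prodl _ (WM_det _ _)) _.
apply: (@lmod_iso_trans _ _ ((WM (b + a') * WM (- a)) * (WM 0 * Q))%type); first by mod_ac.
apply: lmod_iso_trans (lmod_iso_prodl _ (WM_det _ _)) _.
by mod_ac.
Qed.

Lemma left_ideal_rank_one (I : set BT) (hI : submodule I) : (forall b, I b -> W 0 b) ->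
  (exists2 y, I y & y != 0) -> rank_one (submod hI).
Proof.
move=> IW I0; have [J [hJ [c [JW Uc c0 Jc IJ]]]] := left_ideal_iso hI IW I0.
apply: rank_one_iso IJ _; apply: (rank_one_between (d := 0) (u := c)) => // b.
by rewrite oppr0 => Wb; apply: submodule_mul.
Qed.

(** * Ore condition, simplicity, submodules of free modules *)

Lemma T_dom (x y : T) : x * y = 0 -> x = 0 \/ y = 0.
Proof.
move=> xy; have : j x * j y = 0 by rewrite -rmorphM xy rmorph0.
by move=> /(skew_mul_eq0 sl)[e|e]; [left|right]; apply: jI; rewrite rmorph0.
Qed.

(** A left Noetherian domain is left Ore. The left ideal generated by all [a * b ^ k] is finitely
    generated, so some [a * b ^ N] is a combination of the earlier ones. Once powers of b are
    cancelled on the right, the term in [b ^ 0] has a nonzero coefficient and the others have a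
    right factor b. *)
Lemma T_ore (a b : T) : b != 0 -> exists s t, s != 0 /\ s * a = t * b.
Proof.
move=> b0; pose comb n (c : nat -> T) := \sum_(k < n) c k * a * b ^+ k.
have rel n c : comb n c = 0 -> (exists2 k, (k < n)%N & c k != 0) ->
    exists s t, s != 0 /\ s * a = t * b.
  elim: n c => [|n IHn] c; first by move=> _ [].
  rewrite /comb big_ord_recl /= expr0 mulr1 => cE [k kn ck].
  have shift : \sum_(i < n) c (bump 0 i) * a * b ^+ bump 0 i = comb n (fun i => c i.+1) * b.
    by rewrite mulr_suml; apply: eq_bigr => i _; rewrite -!mulrA -exprSr.
  rewrite shift in cE; have [c0|c0] := eqVneq (c 0%N) 0.
    move: cE; rewrite c0 mul0r add0r => /T_dom[e|e]; last by rewrite e eqxx in b0.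
    apply: IHn e _; case: k kn ck => [|k] kn ck; first by rewrite c0 eqxx in ck.
    by exists k.
  exists (c 0%N), (- comb n (fun i => c i.+1)); split=> //.
  by apply/eqP; rewrite mulNr -addr_eq0 cE.
pose I : set BT := fun y => exists n c, y = j (comb n c).
have combD n m c d : exists e, comb n c + comb m d = comb (n + m)%N e.
  exists (fun k => (if (k < n)%N then c k else 0) + (if (k < m)%N then d k else 0)).
  have combE l N f : (l <= N)%N -> comb l f = comb N (fun k => if (k < l)%N then f k else 0).
    move=> lN; rewrite /comb (big_ord_widen _ (fun k => f k * a * b ^+ k) lN) big_mkcond.
    by apply: eq_bigr => k _; case: ifP; rewrite ?mul0r.
  rewrite (combE n (n + m)%N) ?leq_addr // (combE m (n + m)%N) ?leq_addl // -big_split.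
  by apply: eq_bigr => k _; rewrite !mulrDl.
have hI : submodule I.
  split.
  - by exists 0%N, (fun=> 0); rewrite /comb big_ord0 rmorph0.
  - move=> _ _ [n [c ->]] [m [d ->]]; have [e eE] := combD n m c d.
    by exists (n + m)%N, e; rewrite -eE rmorphD.
  - move=> t _ [n [c ->]]; exists n, (fun k => t * c k); rewrite BTZ -rmorphM; congr (j _).
    by rewrite mulr_sumr; apply: eq_bigr => k _; rewrite !mulrA.
have IW y : I y -> W 0 y by move=> [n [c ->]]; exact: jW0.
have [s [sI Igen]] := noetherian_gens hI IW.
have [N sN] : exists N, forall y, y \in s -> exists c, y = j (comb N c).
  elim: s sI {Igen} => [|y s IHs] sI; first by exists 0%N.
  have [|N sN] := IHs; first by move=> z zs; apply: sI; rewrite inE zs orbT.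
  have [|n [c yE]] := sI y; first by rewrite inE eqxx.
  exists (n + N)%N => z; rewrite inE => /predU1P[->|/sN[d ->]].
    have [e eE] := combD n N c (fun=> 0); exists e; rewrite yE -eE.
    by rewrite [X in _ + X]big1 ?addr0 // => k _; rewrite !mul0r.
  have [e eE] := combD n N (fun=> 0) d; exists e; rewrite -eE.
  by rewrite [X in X + _]big1 ?add0r // => k _; rewrite !mul0r.
pose J : set BT := fun y => exists c, y = j (comb N c).
have hJ : submodule J.
  split.
  - by exists (fun=> 0); rewrite [comb _ _]big1 ?rmorph0 // => k _; rewrite !mul0r.
  - move=> _ _ [c ->] [d ->]; exists (fun k => c k + d k); rewrite -rmorphD -big_split.
    by congr (j _); apply: eq_bigr => k _; rewrite !mulrDl.
  - move=> t _ [c ->]; exists (fun k => t * c k); rewrite BTZ -rmorphM; congr (j _).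
    by rewrite mulr_sumr; apply: eq_bigr => k _; rewrite !mulrA.
have [|c cE] := Igen J hJ sN (j (a * b ^+ N)).
  exists N.+1, (fun k => (k == N)%:R); rewrite /comb big_ord_recr /= eqxx mul1r big1 ?add0r //.
  by move=> k _; rewrite ltn_eqF ?mul0r.
apply: (rel N.+1 (fun k => if (k == N)%N then -1 else c k)); last first.
  by exists N => //; rewrite eqxx oppr_eq0 oner_eq0.
rewrite /comb big_ord_recr /= eqxx mulN1r mulNr; apply/eqP; rewrite subr_eq0; apply/eqP.
rewrite (jI cE); apply: eq_bigr => k _; by rewrite ltn_eqF.
Qed.

(** An element of minimal width turns out to be a constant. So I meets [U_0] in a nonzero ideal
    stable under sg; its generator is fixed up to units, hence is a unit. *)
Lemma W_two_sided (I : set BT) : submodule I -> (forall b, I b -> W 0 b) ->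
  (forall b c, I b -> W 0 c -> I ((b : B) * c)) -> (exists2 y, I y & y != 0) -> I (1 : B).
Proof.
move=> hI IW IM [y0 Iy0 y00].
have exw : exists n : nat, `[< exists2 w, inQ I n w & w != 0 >].
  have [k [m Qy]] := inQ_ex hI Iy0; exists m; apply/asboolP; exists (xz k%:Z * y0) => //.
  apply/eqP => e; move/eqP: y00; apply.
  by rewrite -[y0]mul1r -(xzNK sl k%:Z) -mulrA e mulr0.
case: (ex_minnP exw) => m /asboolP[w Qw w0] mmin.
have zero_min n x : (n < m)%N -> inQ I n x -> x = 0.
  move=> nm Qx; apply/eqP; apply: contraTT nm => x0; rewrite -leqNgt.
  by apply: mmin; apply/asboolP; exists x.
case: m Qw mmin zero_min => [/inQ_eq0 e|n Qw _ zero_min]; first by rewrite e eqxx in w0.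
have [Iw wQ] := Qw.
(* Otherwise [x^(-1) w] would be narrower. *)
have c0 : cf w 0 != 0.
  apply/eqP => c0; have e : xz (-1) * w = 0.
    apply: (zero_min n) => //; split; first by apply: (submodule_mul hI) => //; exact: W_xz.
    move=> i; rewrite (cf_xl sl) fmorph_eq0 => wi.
    have := wQ _ wi; have [e|] := eqVneq (i - -1) 0; first by move: wi; rewrite e c0 eqxx.
    by lia.
  by move/eqP: w0; apply; rewrite -[w]mul1r -(xzK sl 1) -mulrA e mulr0.
have n0 : n = 0%N.
  apply/eqP; apply: contrapT => /negP n0.
  have [u [Uu u0 nu]] := gp_nonunit gp.
  (* Chosen to cancel the coefficient n, so that z is zero by minimality; its constant coefficient
     then gives [sg n u = u], impossible for a nonunit u and positive n. *)
  pose z := w * io u - io (sg n%:Z u) * w.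
  have : z = 0.
    apply: (zero_min n) => //; apply: inQ_lt; first apply: (inQ_D hI).
    - split; first by apply: IM => //; exact: W_io.
      by move=> i; rewrite (cf_ior sl) mulf_eq0 negb_or => /andP[/wQ].
    - by apply: (inQ_N hI); apply: (inQ_io hI) => //; exact: (gp_sgU gp).
    - by rewrite (cfD sl) (cfN sl) (cf_ior sl) (cf_iol sl) mulrC subrr.
  move/(congr1 (fun b => cf b 0)); rewrite (cfD sl) (cfN sl) (cf_ior sl) (cf_iol sl) (cf0 sl).
  rewrite (gp_sg0 gp) [_ * u]mulrC -mulrBl => /eqP; rewrite mulf_eq0 (negPf c0) orbF subr_eq0.
  move=> /eqP us; apply: nu; rewrite -[X in U X _]oppr0.
  apply: (gp_sg_orbit gp (k := n%:Z)) => //; rewrite -?us ?divff //; exact: (gp_1 gp).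
subst n; have wE : w = io (cf w 0).
  apply: (sl_cf_inj sl) => i; rewrite (cf_io sl); case: eqP => [->|/eqP i0] //.
  by apply/eqP; apply: contrapT => /negP /wQ; lia.
pose Y u := U 0 u /\ I (io u).
have [|||| d [e [Ue e0 YE]]] := @gp_principal _ _ _ _ _ _ _ gp 0 Y.
- by move=> u [].
- move=> u v [Uu Iu] [Uv Iv]; split; first exact: gp_D gp _ _ _ _ _.
  by rewrite rmorphD; case: hI => _ ID _; exact: ID.
- move=> r u Ur [Uu Iu]; split; first by apply: (gp_Me gp Ur Uu); rewrite addr0.
  by rewrite rmorphM; apply: (submodule_mul hI) => //; exact: W_io.
- by exists (cf w 0) => //; split; [exact: IW|rewrite -wE].
have Ysg k u : Y u -> Y (sg k u).
  move=> [Uu Iu]; split; first exact: (gp_sgU gp).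
  have -> : io (sg k u) = xz k * io u * xz (- k) by rewrite (sl_comm sl) -mulrA (xzK sl) mulr1.
  by apply: IM; [apply: (submodule_mul hI) => //|]; exact: W_xz.
(* As Y is stable under sg, multiplication by [sg k e] carries [U_(-d)] into [Y = U_(-d) e], and
   [gp_quot] applies to the quotient. *)
have He k : U 0 (sg k e / e).
  rewrite -[X in U X _](subrr (0 - d)); apply: (gp_quot gp) => v Uv.
  have := Ysg k (sg (- k) v * e); rewrite !YE rmorphM (gp_sgNK gp) mulfK // -mulrA; apply.
  exact: (gp_sgU gp).
have Ye : U (- d) e^-1.
  apply: (gp_sg_orbit gp (k := 1)) => //.
  by have := gp_sgU gp 1 (He (-1)); rewrite rmorphM fmorphV (gp_sgNK gp).
have [_] : Y 1 by apply/YE; rewrite sub0r div1r.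
by rewrite rmorph1.
Qed.

Lemma T_simple (I : T -> Prop) : (forall x y, I x -> I y -> I (x + y)) ->
  (forall t x, I x -> I (t * x)) -> (forall t x, I x -> I (x * t)) ->
  (exists2 x, I x & x != 0) -> forall t, I t.
Proof.
move=> ID Il Ir [x Ix x0] t; rewrite -[t]mulr1; apply: (Il).
pose J : set BT := fun y => exists2 x, I x & y = j x.
have [z Iz /jI] : J (j 1); last by move=> ->.
rewrite rmorph1; apply: W_two_sided.
- split; first by exists 0; [rewrite -(mul0r x); exact: Il|rewrite rmorph0].
    by move=> _ _ [y Iy ->] [z Iz ->]; exists (y + z); [exact: ID|rewrite rmorphD].
  by move=> r _ [y Iy ->]; exists (r * y); [exact: Il|rewrite BTZ rmorphM].
- by move=> _ [y Iy ->]; exact: jW0.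
- move=> _ c [y Iy ->] /jW[z <-]; exists (y * z); [exact: Ir|by rewrite rmorphM].
- by exists (j x); [exists x|rewrite -(rmorph0 j) (inj_eq jI)].
Qed.

(** M has rank m and class a. The summand [WM 0] on the left lets the formula cover m = 0, and the
    two embeddings determine the uniform dimension. *)
Definition good_module (M : lmodType T) m a :=
  [/\ finitely_generated M, projective M,
      stably_iso (M * WM 0)%type (WM a * free_mod T m)%type,
      exists f : {linear free_mod T m -> M}, injective f
    & exists f : {linear M -> free_mod T m}, injective f].

Lemma ideal_rank_one (I : set (T^o)) (hI : submodule I) : (exists2 y, I y & y != 0) ->
  rank_one (submod hI).
Proof.
move=> [y Iy y0].
have jl : linear (fun t : T^o => j t : BT) by move=> a s t; rewrite rmorphD rmorphM.
pose J : set BT := fun b => exists2 t : T, I t & b = j t.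
have hJ : submodule J.
  case: hI => I0 ID IZ; split; first by exists 0; rewrite ?rmorph0.
    by move=> _ _ [s Is ->] [t It ->]; exists (s + t); rewrite ?rmorphD //; exact: ID.
  by move=> r _ [t It ->]; exists (r * t); rewrite ?BTZ ?rmorphM //; exact: IZ.
apply: (@rank_one_iso _ (submod hJ)).
  apply: (@submod_iso _ _ _ _ _ _ _ (mklin jl)) => [x Ix|x Ix|b [t It ->]].
  - by exists x.
  - by rewrite mklinE -(rmorph0 j) => /jI.
  - by exists t.
apply: left_ideal_rank_one; first by move=> _ [t _ ->]; exact: jW0.
by exists (j y); [exists y|rewrite -(rmorph0 j) (inj_eq jI)].
Qed.

(** The usual argument for hereditary rings: the first coordinate maps N onto a left ideal, which is
    zero or projective; it splits off, and the kernel embeds in a free module of smaller rank. *)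
Lemma good_module_sub n (N : lmodType T) (i : {linear N -> free_mod T n}) : injective i ->
  exists m a, good_module N m a.
Proof.
elim: n N i => [|n IHn] N i iI.
  have N0 (x : N) : x = 0 by apply: iI; rewrite [LHS]thinmx0 linear0.
  have iso0 : lmod_iso N (free_mod T 0).
    by apply: (@lmod_iso_bij _ _ _ i) => // y; exists 0; rewrite [RHS]thinmx0 [LHS]thinmx0.
  have [f0 p0] := free_mod_fgproj T 0.
  exists 0%N, 0; split.
  - exact: fg_iso (lmod_iso_sym iso0) f0.
  - exact: proj_iso (lmod_iso_sym iso0) p0.
  - apply: iso_stably; apply: lmod_iso_trans (lmod_isoC _ _) _.
    exact: lmod_iso_prodr.
  - exact: lmod_iso_inj (lmod_iso_sym iso0).
  - by exists i.
have [g [g' [gK g'K]]] := lmod_isoP (free_modS T n).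
have [f fE] : exists f : {linear N -> T^o}, forall x, f x = (g (i x)).1.
  by exists (mklin (@fst_linear T (T^o) (free_mod T n)) \o (g \o i)).
have [r rE] : exists r : {linear N -> free_mod T n}, forall x, r x = (g (i x)).2.
  by exists (mklin (@snd_linear T (T^o) (free_mod T n)) \o (g \o i)).
have fr x : f x = 0 -> r x = 0 -> x = 0.
  move=> fx rx; apply: iI; rewrite linear0; apply: (can_inj gK); rewrite linear0.
  by rewrite [LHS]surjective_pairing -fE -rE fx rx.
have [f0|nf0] := pselect (forall x, f x = 0).
  apply: (IHn N r) => x y xy; apply/eqP; rewrite -subr_eq0; apply/eqP; apply: fr => //.
  by rewrite linearB xy subrr.
have [x0 fx0] : exists x, f x != 0.
  apply: contrapT => nex; apply: nf0 => x.
  by apply/eqP; apply: contrapT => /negP fx; apply: nex; exists x.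
pose I := submod (range_submodule f).
have [fI pI [a' Ia']] : rank_one I by apply: ideal_rank_one; exists (f x0) => //; exists x0.
have [f' f'E] := submod_lift (range_submodule f) (fun x => ex_intro _ x erefl).
have f'S y : exists x, f' x = y.
  by have [x fx] := sval_linP y; exists x; apply: sval_lin_inj; rewrite f'E.
pose K := submod (ker_submodule f').
have isoN : lmod_iso N (K * I)%type := projective_split pI f'S.
have [m [a [fK pK Ka [u uI] [v vI]]]] : exists m a, good_module K m a.
  apply: (IHn K (r \o sval_lin)) => x y /= xy; apply: sval_lin_inj.
  apply/eqP; rewrite -subr_eq0; apply/eqP; apply: fr; last first.
    by rewrite linearB; apply/eqP; rewrite subr_eq0; apply/eqP; exact: xy.
  have fx : f' (sval_lin x) = 0 := sval_linP x.
  have fy : f' (sval_lin y) = 0 := sval_linP y.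
  by rewrite -f'E linearB fx fy subrr linear0.
exists m.+1, (a + a'); split.
- by apply: fg_iso (lmod_iso_sym isoN) _; exact: finitely_generated_prod.
- by apply: proj_iso (lmod_iso_sym isoN) _; exact: projective_prod.
- apply: (@stably_trans _ _ ((K * WM 0) * I)%type).
    apply: iso_stably; apply: lmod_iso_trans (lmod_iso_prodl _ isoN) _; by mod_ac.
  apply: stably_trans (stably_prod Ka Ia') _; apply: iso_stably.
  apply: (@lmod_iso_trans _ _ ((WM a * WM a') * free_mod T m)%type); first by mod_ac.
  apply: lmod_iso_trans (lmod_iso_prodl _ (WM_det _ _)) _.
  apply: lmod_iso_trans (lmod_iso_sym (lmod_isoA _ _ _)) _; apply: lmod_iso_prodr.
  apply: lmod_iso_trans (lmod_iso_sym (free_modS T m)).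
  exact/lmod_iso_prodl/lmod_iso_sym/WM0_iso.
- have yl : linear (fun t : T^o => t *: f' x0) by move=> t s s'; rewrite scalerDl scalerA.
  have [y yE] : exists y : {linear T^o -> I}, forall t, y t = t *: f' x0 by exists (mklin yl).
  have yI : injective y.
    have ez z : sval_lin (z *: f' x0) = z *: f x0 by rewrite linearZZ f'E.
    move=> s t; rewrite !yE => st; have /eqP : s *: f x0 = t *: f x0 by rewrite -!ez st.
    rewrite -subr_eq0 -scalerBl => /eqP /T_dom[/eqP|e]; last by rewrite e eqxx in fx0.
    by rewrite subr_eq0 => /eqP.
  have eI : embeds (T^o) I by exists y.
  apply: embeds_trans (embeds_iso (free_modS T m)) _.
  apply: embeds_trans (embeds_iso (lmod_isoC _ _)) _.
  apply: embeds_trans (embeds_iso (lmod_iso_sym isoN)).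
  by apply: embeds_prod eI; exists u.
- have eI : embeds I (T^o) by exists sval_lin; exact: sval_lin_inj.
  apply: embeds_trans (embeds_iso isoN) _.
  apply: embeds_trans (embeds_iso (lmod_iso_sym (free_modS T m))).
  apply: embeds_trans (embeds_iso (lmod_isoC _ _)).
  by apply: embeds_prod eI; exists v.
Qed.

Lemma good_module_udim M m a k : good_module M m a -> has_udim M k <-> k = m.
Proof.
move=> [_ _ _ [f fI] [g gI]].
have uM : has_udim M m.
  split; first exact: has_direct_sum_inj fI (@free_mod_direct_sum T m).
  by move=> /(has_direct_sum_inj gI); apply: free_mod_no_direct_sum; [exact: T_dom|exact: T_ore].
by split=> [/has_udim_uniq/(_ uM)|->].
Qed.

Lemma fgproj_good (M : lmodType T) : finitely_generated M -> projective M ->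
  exists m a, good_module M m a.
Proof.
move=> fM pM; have [n [N iso]] := fgproj_embed fM pM.
have [f fI] : embeds M (free_mod T n).
  apply: embeds_trans (embeds_iso (lmod_iso_sym iso)).
  by exists (mklin (@inr_linear T N M)) => x y [].
exact: good_module_sub fI.
Qed.

Lemma T_submodules_of_progenerators : submodules_of_progenerators T.
Proof.
move=> M N i [fM pM _] iI [x0 x00]; have [n [P iso]] := fgproj_embed fM pM.
have [f fI] : embeds N (free_mod T n).
  apply: (@embeds_trans _ _ M); first by exists i.
  apply: embeds_trans (embeds_iso (lmod_iso_sym iso)).
  by exists (mklin (@inr_linear T P M)) => x y [].
have [m [a [fN pN _ _ _]]] := good_module_sub fI.
split=> // X Y p q pq y.
have [k fk] : exists k, (f x0 : 'rV[T]_n) 0 k != 0.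
  apply: contrapT => nk; move/eqP: x00; apply; apply: fI; rewrite linear0.
  apply/rowP => k; rewrite mxE; apply/eqP; apply: contrapT => /negP fk.
  by apply: nk; exists k.
(* For the generator property: the scalars killing every [p y - q y] form a two-sided ideal. It
   contains the nonzero coordinate k of [f x0], because [v |-> (f v)_k z] is a morphism on N; by
   simplicity it contains 1. *)
have kill : forall t y, t *: (p y - q y) = 0.
  apply: (@T_simple (fun t => forall y, t *: (p y - q y) = 0)).
  - by move=> s t sE tE z; rewrite scalerDl sE tE addr0.
  - by move=> t s sE z; rewrite -scalerA sE scaler0.
  - by move=> t s sE z; rewrite -scalerA scalerBr -!linearZZ sE.
  exists ((f x0 : 'rV[T]_n) 0 k) => // z.
  have hl : linear (fun v : N => (f v : 'rV[T]_n) 0 k *: z).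
    by move=> t u v; rewrite linearP !mxE scalerDl scalerA.
  have := pq (mklin hl) x0; rewrite /= !linearZZ => e.
  by rewrite scalerBr e subrr.
by apply/eqP; rewrite -subr_eq0 -[X in X == _]scale1r kill.
Qed.

(** * Maximal left ideals and uniform dimension *)

Definition max_ideal e p (t : T) := exists2 b, W (- e) b & j t = b * io p.

Lemma max_ideal_submodule e p : submodule (max_ideal e p : set (T^o)).
Proof.
split.
- by exists 0; rewrite ?mul0r ?rmorph0 //; exact: W_0.
- move=> s t [b Wb sb] [c Wc tc]; exists (b + c); first exact: W_D.
  by rewrite rmorphD sb tc mulrDl.
- move=> r t [b Wb tb]; exists (j r * b); first by apply: (W_Me (jW0 r) Wb); zmod.
  by rewrite rmorphM tb mulrA.
Qed.

Lemma max_ideal_proper e p : gp_prime U e p -> ~ max_ideal e p 1.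
Proof.
move=> pp [b Wb]; rewrite rmorph1 => /(congr1 (fun c => cf c 0)).
rewrite -(rmorph1 io) (cf_io sl) eqxx (cf_ior sl) (gp_sg0 gp) => e1.
have [Up p0 np _] := pp; apply: np.
have -> : p^-1 = cf b 0 by rewrite -[LHS]mul1r e1 mulfK.
exact: Wb.
Qed.

Lemma max_ideal_maximal e p (I : set (T^o)) (t : T) : gp_prime U e p -> submodule I ->
  (forall s, max_ideal e p s -> I s) -> I t -> ~ max_ideal e p t -> forall s, I s.
Proof.
move=> pp hI pI It nt s; have [Up p0 _ _] := pp.
pose J : set BT := fun b => exists2 x : T, I x & b = j x.
have hJ : submodule J.
  case: hI => I0 ID IZ; split; first by exists 0; rewrite ?rmorph0.
    by move=> _ _ [x Ix ->] [y Iy ->]; exists (x + y); rewrite ?rmorphD //; exact: ID.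
  by move=> r _ [x Ix ->]; exists (r * x); rewrite ?BTZ ?rmorphM //; exact: IZ.
have [k nk] : exists k, ~ U (0 - e) (cf (j t) k / sg k p).
  apply: contrapT => nex; apply: nt.
  have [|b Wb jt] := @W_divp 0 e p (j t) p0 Up; last by exists b => //; rewrite -[- e]add0r.
  by move=> k; apply: contrapT => nk; apply: nex; exists k.
have [x Ix /jI ->] // : J (j s).
apply: (W_simple pp hJ _ _ _ nk) => //.
- move=> b Wb; have /jW[x xE] : W 0 (b * io p) by apply: (W_ior Wb Up); zmod.
  by exists x; rewrite ?xE //; apply: pI; exists b; rewrite // -[- e]add0r.
- by exists t.
- exact: jW0.
- exact: jW0.
Qed.

Lemma max_ideal_iso e p : gp_prime U e p -> exists f : {linear WM (- e) -> T^o},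
  injective f /\ forall t, max_ideal e p t <-> exists x, f x = t.
Proof.
move=> pp; have [Up p0 _ _] := pp.
have /choice[f fP] : forall x : WM (- e), exists t, j t = (sval_lin x : B) * io p.
  by move=> x; apply/jW; apply: (W_ior (sval_linP x) Up); zmod.
have fl : linear (f : WM (- e) -> T^o).
  move=> t x y; apply: jI; rewrite rmorphD rmorphM !fP.
  have -> : sval_lin (t *: x + y) = t *: sval_lin x + sval_lin y by exact: linearP.
  by rewrite BTZ mulrDl mulrA.
exists (mklin fl); split=> [x y xy|t].
  apply: sval_lin_inj; apply: (skew_mulI sl (c := io p)); first by rewrite io_neq0.
  by rewrite -!fP; congr (j _); exact: xy.
split=> [[b Wb jt]|[x <-]].
  by exists (msub (W_submodule (- e)) Wb); apply: jI; rewrite mklinE fP jt.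
by exists (sval_lin x); [exact: sval_linP|rewrite mklinE fP].
Qed.

Lemma T_noncommutative : exists s t : T, s * t <> t * s.
Proof.
have [u [Uu u0 nu]] := gp_nonunit gp.
have /jW[s sE] : W 0 (io u) by exact: W_io.
have /jW[t tE] := W_xz 1; exists t, s => /(congr1 j); rewrite !rmorphM sE tE (sl_comm sl).
move=> /(congr1 (fun b => cf b 1)); rewrite !(cf_iol sl) (cf_xz sl) eqxx !mulr1 => us.
by apply: nu; rewrite -[X in U X _]oppr0; apply: (gp_sg_orbit gp (k := 1)) => //;
  rewrite us divff //; exact: (gp_1 gp).
Qed.

Lemma udim_one (M : lmodType T) : embeds (T^o) M -> embeds M (T^o) -> has_udim M 1.
Proof.
move=> TM MT; have iso : lmod_iso (free_mod T 1) (T^o).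
  apply: lmod_iso_trans (free_modS T 0) _; exact: lmod_iso_prod0.
have [f fI] := embeds_trans (embeds_iso iso) TM.
have [g gI] := embeds_trans MT (embeds_iso (lmod_iso_sym iso)).
split; first exact: has_direct_sum_inj fI (@free_mod_direct_sum T 1).
by move=> /(has_direct_sum_inj gI); apply: free_mod_no_direct_sum; [exact: T_dom|exact: T_ore].
Qed.

Lemma regular_udim : has_udim (T^o) 1.
Proof. by apply: udim_one; exact/embeds_iso/lmod_iso_refl. Qed.

Lemma WM_udim a : has_udim (WM a) 1.
Proof.
have emb b c : embeds (WM b) (WM c).
  have [u Uu u0] := gp_neq0 gp (c - b).
  have ul : linear (fun x : WM b => rmul (io u) (sval_lin x)).
    by move=> t x y; rewrite !linearP.
  have [f fE] : exists f : {linear WM b -> WM c}, forall x, sval_lin (f x) = mklin ul x.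
    apply: submod_lift => x; rewrite mklinE rmulE.
    by apply: (W_ior (sval_linP x) Uu); zmod.
  exists f => x y xy; apply: sval_lin_inj; apply: (skew_mulI sl (c := io u)).
    by rewrite io_neq0.
  by rewrite -!rmulE -!(mklinE ul) -!fE xy.
by apply: udim_one; [apply: embeds_trans (emb 0 a)|apply: embeds_trans (emb a 0) _];
  apply: embeds_iso; [exact: WM0_iso|exact/lmod_iso_sym/WM0_iso].
Qed.

(** * The class of [W_a] is a stable invariant *)

Definition above (n : int) b := forall i, i < n -> cf b i = 0.

Lemma above_mul n m b c : above n b -> above m c -> above (n + m) (b * c).
Proof.
move=> bn cm; apply: (@skew_ind _ _ _ _ _ _ sl (fun x => above (n + m) (x * c)) b)
  => [i _|x y xb yb i ni|k i ni].
- by rewrite mul0r (cf0 sl).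
- by rewrite mulrDl (cfD sl) xb // yb // addr0.
have [kn|nk] := ltrP k n; first by rewrite bn // rmorph0 !mul0r (cf0 sl).
by rewrite (sl_cfl sl) cm ?rmorph0 ?mulr0 //; lia.
Qed.

Lemma above_sum (I : Type) (r : seq I) n (F : I -> B) :
  (forall i, above n (F i)) -> above n (\sum_(i <- r) F i).
Proof. by move=> Fn i ni; rewrite (cf_sum sl) big1 // => k _; exact: Fn. Qed.

Definition Wrow n (g : 'I_n -> D) (v : 'rV[B]_n) := forall k, W (g k) (v 0 k).

Lemma gclass_eq (E : lmodType L) (V V' : E -> Prop) c : (forall x, V x <-> V' x) ->
  gclass cl U V c -> gclass cl U V' c.
Proof. by move=> e; have <- : V = V' by apply/funext => x; apply/propext; exact: e. Qed.

Lemma gclass_coord n (g : 'I_n -> D) :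
  gclass cl U (fun u : 'rV[L]_n => forall k, U (g k) (u 0 k)) (cl (\sum_k g k)).
Proof.
have sumE (u : 'I_n -> L) k : (\sum_i u i *: delta_mx 0 i : 'rV_n) 0 k = u k.
  rewrite summxE (bigD1 k) //= !mxE !eqxx mulr1 big1 ?addr0 // => i ik.
  by rewrite !mxE eq_sym (negPf ik) andbF mulr0.
exists n, (fun k => delta_mx 0 k), g; split=> //; split=> [l l0 i|u].
  by have /rowP/(_ i) := l0; rewrite sumE mxE.
split=> [Uu|[l Ul ->] k]; last by rewrite sumE.
exists (fun k => u 0 k) => //; apply/rowP => k; by rewrite sumE.
Qed.

(** As sg preserves degrees, a semilinear injection carries a pseudo-basis to one with the same
    degrees. It serves for multiplication by x. *)
Lemma gclass_semilinear (E : lmodType L) (V : E -> Prop) (f : E -> E) k c :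
  {morph f : x y / x + y} -> injective f -> (forall l x, f (l *: x) = sg k l *: f x) ->
  gclass cl U V c -> gclass cl U (fun y => exists2 x, V x & y = f x) c.
Proof.
move=> fD fI fZ [n [v [g [[vfree vV] gc]]]].
have f0 : f 0 = 0 by apply: (addrI (f 0)); rewrite -fD !addr0.
have fs (l : 'I_n -> L) : f (\sum_i l i *: v i) = \sum_i sg k (l i) *: f (v i).
  elim/big_rec2: _ => [//|i _ y _ <-]; by rewrite fD fZ.
exists n, (fun i => f (v i)), g; split=> //; split=> [l l0 i|y].
  have : \sum_i sg (- k) (l i) *: v i = 0.
    apply: fI; rewrite fs f0 -[RHS]l0; apply: eq_bigr => i' _.
    by rewrite (gp_sgNK gp).
  by move/vfree => /(_ i) /eqP; rewrite fmorph_eq0 => /eqP.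
split=> [[x /vV[u Uu ->] ->]|[u Uu ->]].
  by exists (fun i => sg k (u i)) => [i|]; [exact: (gp_sgU gp)|rewrite fs].
exists (\sum_i sg (- k) (u i) *: v i).
  by apply/vV; exists (fun i => sg (- k) (u i)) => // i; exact: (gp_sgU gp).
by rewrite fs; apply: eq_bigr => i _; rewrite (gp_sgNK gp).
Qed.

(* Compare, in the class group of [U 0], the two ways of filtering
   [L2 / x L1] below: coefficients of top degree of [v], and constant
   coefficients of [v *m A]. *)
Lemma Wrow_class n (g h : 'I_n.+1 -> D) (A A' : 'M[B]_n.+1) :
  (forall v, Wrow g v -> Wrow h (v *m A)) -> (forall v, Wrow h v -> Wrow g (v *m A')) ->
  A *m A' = 1%:M -> A' *m A = 1%:M -> cl (\sum_k g k) = cl (\sum_k h k).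
Proof.
move=> gA hA' AA' A'A.
have /choice[N NP] : forall kl : 'I_n.+1 * 'I_n.+1, exists N : nat, forall i,
    (cf (A kl.1 kl.2) i != 0 -> `|i|%R <= N%:Z) /\ (cf (A' kl.1 kl.2) i != 0 -> `|i|%R <= N%:Z).
  move=> [k l]; have [N1 N1P] := sl_cf_fin sl (A k l); have [N2 N2P] := sl_cf_fin sl (A' k l).
  by exists (N1 + N2)%N => i; split=> [/N1P|/N2P]; lia.
(* A strict bound for the exponents in A and A': for a row u of scalars, [u x^e A] has no negative
   exponent and [u A'] has its exponents in [(- e, e)]. *)
pose e := (\sum_kl N kl).+1.
have eP k l i : (cf (A k l) i != 0 -> `|i|%R < e%:Z) /\ (cf (A' k l) i != 0 -> `|i|%R < e%:Z).
  have le : (N (k, l) <= \sum_kl N kl)%N by rewrite (bigD1 (k, l)) //= leq_addr.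
  by have [P1 P2] := NP (k, l) i; split=> [/P1|/P2] /=; rewrite /e; lia.
have Aab k l : above (- e%:Z) (A k l).
  by move=> i ie; apply/eqP; apply: contrapT => /negP; case: (eP k l i) => + _ => /[apply]; lia.
have A'ab k l : above (- e%:Z) (A' k l).
  by move=> i ie; apply/eqP; apply: contrapT => /negP; case: (eP k l i) => _ => /[apply]; lia.
pose E := resmod io 'rV[B]_n.+1.
(* Rows with exponents in [[- e, w)] whose image under A has no negative exponent. The lattices [L1]
   and [L2] are [Lw e] and [Lw (e + 1)]. *)
pose Lw (w : int) (v : E) := [/\ Wrow g (v : 'rV_n.+1),
  forall k, above 0 (((v : 'rV_n.+1) *m A) 0 k)
  & forall k i, cf ((v : 'rV_n.+1) 0 k) i != 0 -> (- e%:Z <= i) && (i < w)].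
have Lw0 w : Lw w 0.
  split=> [k i|k i _|k i]; rewrite ?mul0mx mxE (cf0 sl) ?eqxx //; exact: (gp_0 gp).
have LwD w (x y : E) : Lw w x -> Lw w y -> Lw w (x + y).
  move=> [Wx ax bx] [Wy ay by_]; split=> [k|k i i0|k i].
  - by rewrite mxE; exact: W_D.
  - by rewrite mulmxDl mxE (cfD sl) ax // ay // addr0.
  - rewrite mxE (cfD sl); have [->|/bx //] := eqVneq (cf ((x : 'rV_n.+1) 0 k) i) 0.
    by rewrite add0r => /by_.
have LwZ w r (x : E) : U 0 r -> Lw w x -> Lw w (r *: x).
  move=> Ur [Wx ax bx]; rewrite resmodZ; split=> [k|k i i0|k i].
  - by rewrite mxE; apply: (W_Me (W_io Ur) (Wx k)); rewrite add0r.
  - by rewrite -scalemxAl mxE (cf_iol sl) ax // mulr0.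
  - by rewrite mxE (cf_iol sl) mulf_eq0 negb_or => /andP[_ /bx].
have low (v : 'rV[B]_n.+1) m : (forall k, above m ((v *m A) 0 k)) ->
    forall k, above (m - e%:Z) (v 0 k).
  move=> va k; have -> : v = v *m A *m A' by rewrite -mulmxA AA' mulmx1.
  by rewrite mxE; apply: above_sum => l; apply: above_mul => //; exact: va.
have coef_lin k i : linear (fun v : E => cf ((v : 'rV_n.+1) 0 k) i : L^o).
  by move=> r x y; rewrite resmodZ !mxE (cfD sl) (cf_iol sl).
have [c1 Hc1] : exists c, gclass cl U (Lw e) c.
  (* Coefficients serve as linear forms: form m reads the coordinate m / 2e at the exponent (m mod
     2e) - e. *)
  apply: (gclass_sub gp (n := (n.+1 * e.*2)%N)
    (f := fun m => mklin (coef_lin (inord (m %/ e.*2)) ((m %% e.*2)%:Z - e%:Z)))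
    (g := fun m => g (inord (m %/ e.*2)))) => //.
  - by move=> x y; exact: LwD.
  - by move=> r x; exact: LwZ.
  - by move=> i v _ [Wv _ _]; rewrite mklinE; exact: Wv.
  - move=> v [_ _ bv] v0; apply/rowP => k; rewrite mxE; apply: (sl_cf_inj sl) => i.
    rewrite (cf0 sl); apply/eqP; apply: contrapT => /negP vi.
    have /andP[i1 i2] := bv k i vi.
    pose r := absz (i + e%:Z)%R.
    have rlt : (r < e.*2)%N by rewrite /r; lia.
    have := v0 (k * e.*2 + r)%N; rewrite mklinE.
    rewrite divnMDl ?double_gt0 // divn_small // addn0 modnMDl modn_small // inord_val.
    have -> : r%:Z - e%:Z = i by rewrite /r; lia.
    move=> vE; move/eqP: vi; apply; apply: vE.
    have kn := ltn_ord k.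
    have -> : (n.+1 * e.*2 = n * e.*2 + e.*2)%N by rewrite mulSn addnC.
    by rewrite -addnS leq_add // leq_mul2r -ltnS kn orbT.
have topl : linear (fun v : E => \row_k cf ((v : 'rV_n.+1) 0 k) e%:Z).
  by move=> r x y; apply/rowP => k; rewrite resmodZ !mxE (cfD sl) (cf_iol sl).
have cstl : linear (fun v : E => \row_k cf (((v : 'rV_n.+1) *m A) 0 k) 0).
  move=> r x y; apply/rowP => k; rewrite resmodZ mulmxDl -scalemxAl !mxE (cfD sl).
  by rewrite (cf_iol sl).
(* Top coefficients: the kernel is [Lw e], and [u x^e] lifts the row u. *)
have H1 : gclass cl U (Lw (e%:Z + 1)) (c1 + cl (\sum_k g k)).
  apply: (gclass_ext gp (f := mklin topl)).
  - by move=> x y; exact: LwD.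
  - by move=> r x; exact: LwZ.
  - apply: gclass_eq Hc1 => v; split=> [[Wv av bv]|[[Wv av bv] /rowP v0]].
      split; first by split=> // k i /bv; lia.
      apply/rowP => k; rewrite !mxE; apply/eqP; apply: contrapT => /negP /bv; lia.
    split=> // k i vi; have := bv k i vi; have [ie|] := eqVneq i e%:Z; last by lia.
    by have := v0 k; rewrite !mxE -ie => vi0; rewrite vi0 eqxx in vi.
  - apply: gclass_eq (gclass_coord g) => u; split=> [Uu|[v [Wv _ _] <-] k]; last first.
      by rewrite mxE; exact: Wv.
    pose v : 'rV[B]_n.+1 := \row_k (io (u 0 k) * xz e%:Z).
    have vW : Wrow g v.
      by move=> k; rewrite mxE; apply: (W_Me (W_io (Uu k)) (W_xz _)); rewrite addr0.
    exists v; last by apply/rowP => k; rewrite !mxE (sl_cf_mon sl) eqxx.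
    split=> // [k|k i].
      rewrite mxE; apply: above_sum => l; rewrite -(subrr e%:Z).
      apply: above_mul => // i ie; rewrite mxE (sl_cf_mon sl).
      by case: eqP => // ie'; move: ie; rewrite ie' ltxx.
    by rewrite mxE (sl_cf_mon sl); case: (i =P e%:Z) => [->|]; rewrite ?eqxx //; lia.
(* Constant coefficients of [v A]: the kernel is [x Lw e], of the same class as [Lw e], and [u A']
   lifts the row u. *)
have H2 : gclass cl U (Lw (e%:Z + 1)) (c1 + cl (\sum_k h k)).
  apply: (gclass_ext gp (f := mklin cstl)).
  - by move=> x y; exact: LwD.
  - by move=> r x; exact: LwZ.
  - have : gclass cl U (fun y : E => exists2 v : E, Lw e%:Z v & y = (xz 1 *: (v : 'rV[B]_n.+1) : E)) c1.
      apply: (gclass_semilinear (f := fun v : E => (xz 1 *: (v : 'rV[B]_n.+1)) : E) (k := 1)) Hc1.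
      + by move=> x y; exact: (scalerDr (xz 1) (x : 'rV[B]_n.+1)).
      + move=> x y xy; have := congr1 (fun z : E => xz (-1) *: (z : 'rV[B]_n.+1)) xy.
        by rewrite !scalerA (xzNK sl) !scale1r.
      + by move=> l x; rewrite !resmodZ !scalerA (sl_comm sl).
    apply: gclass_eq => y; split=> [[v [Wv av bv] ->]|[[Wy ay by_] /rowP y0]].
      split; last first.
        by apply/rowP => k; rewrite [LHS]mxE -scalemxAl [RHS]mxE [X in cf X _]mxE (cf_xl sl) av // rmorph0.
      split=> [k|k i i0|k i].
      - by rewrite mxE; apply: (W_Me (W_xz 1) (Wv k)); rewrite add0r.
      - by rewrite -scalemxAl mxE (cf_xl sl) av ?rmorph0 //; lia.
      - by rewrite mxE (cf_xl sl) fmorph_eq0 => /bv; lia.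
    have ay1 k : above 1 (((y : 'rV_n.+1) *m A) 0 k).
      move=> i i1; have [->|i0] := eqVneq i 0; first by have := y0 k; rewrite !mxE.
      by apply: ay; lia.
    exists (xz (-1) *: (y : 'rV_n.+1)); last by rewrite scalerA (xzK sl) scale1r.
    split=> [k|k i i0|k i].
    + by rewrite mxE; apply: (W_Me (W_xz (-1)) (Wy k)); rewrite add0r.
    + by rewrite -scalemxAl mxE (cf_xl sl) ay1 ?rmorph0 //; lia.
    + rewrite mxE (cf_xl sl) fmorph_eq0 => yi; have := by_ _ _ yi.
      have yl := low _ _ ay1 k (i - -1); have [lt|] := ltrP (i - -1) (1 - e%:Z); last by lia.
      by rewrite yl // eqxx in yi.
  - apply: gclass_eq (gclass_coord h) => u; split=> [Uu|[v [Wv _ _] <-] k]; last first.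
      by rewrite mxE; exact: gA.
    pose w : 'rV[B]_n.+1 := \row_k io (u 0 k).
    have Ww : Wrow h w by move=> k; rewrite mxE; exact: W_io.
    have wA : w *m A' *m A = w by rewrite -mulmxA A'A mulmx1.
    exists (w *m A'); last by apply/rowP => k; rewrite mklinE mxE wA mxE (cf_io sl) eqxx.
    split=> [|k i i0|k i].
    + exact: hA'.
    + by rewrite wA mxE (cf_io sl); case: eqP i0 => // ->.
    rewrite mxE (cf_sum sl) => vi.
    have [l vl] : exists l, cf (A' l k) i != 0.
      apply: contrapT => nl; move/eqP: vi; apply; rewrite big1 // => l _.
      rewrite mxE (cf_iol sl); have [->|A'i] := eqVneq (cf (A' l k) i) 0; first by rewrite mulr0.
      by exfalso; apply: nl; exists l.
    by case: (eP l k i) => _ /(_ vl); lia.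
exact: addrI (gclass_uniq gp H1 H2).
Qed.

Definition BTrow n : lmodType T := resmod j 'rV[B]_n.

Lemma Wrow_submodule n (g : 'I_n -> D) : submodule (Wrow g : set (BTrow n)).
Proof.
split=> [k|x y Wx Wy k|t x Wx k]; first by rewrite mxE; exact: W_0.
  by rewrite mxE; exact: W_D.
by rewrite resmodZ mxE; apply: (W_Me (jW0 t) (Wx k)); rewrite add0r.
Qed.

Definition Wrow_mod n (g : 'I_n -> D) := submod (Wrow_submodule g).

(** The coefficient i of [a b] must be divisible by [sg i c], so a is the product of the
    [sg i (c * c')] over a range containing all exponents of b; the factor [c'] of degree [- d]
    keeps a in degree 0. *)
Lemma W_left_denominator d b c : W d b -> U d c -> c != 0 ->
  exists a t, [/\ U 0 a, a != 0, W 0 t & io a * b = t * io c].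
Proof.
move=> Wb Uc c0; have [c' Uc' c'0] := gp_neq0 gp (- d).
have [N Nb] := sl_cf_fin sl b.
pose F (k : 'I_N.*2.+1) := sg (k%:Z - N%:Z) (c * c').
have Ucc : U 0 (c * c') by apply: (gp_Me gp Uc Uc'); rewrite subrr.
have UF (P : pred 'I_N.*2.+1) : U 0 (\prod_(k | P k) F k).
  have -> : 0 = \sum_(k : 'I_N.*2.+1 | P k) (0 : D) by rewrite big1.
  by apply: (gp_prod gp) => k _; exact: (gp_sgU gp).
pose a := \prod_k F k.
exists a, (io a * b * io c^-1); split.
- exact: UF.
- by apply/prodf_neq0 => k _; rewrite fmorph_eq0 mulf_neq0.
- move=> i; rewrite (cf_ior sl) (cf_iol sl).
  have [->|/Nb iN] := eqVneq (cf b i) 0; first by rewrite mulr0 mul0r; exact: (gp_0 gp).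
  have klt : (absz (N%:Z + i)%R < N.*2.+1)%N by lia.
  have [i0 i0E] : exists i0 : 'I_N.*2.+1, i0%:Z - N%:Z = i.
    by exists (Ordinal klt) => /=; lia.
  rewrite /a (bigD1 i0) //= {1}/F i0E rmorphM fmorphV.
  set q := \prod_(_ | _) _.
  have -> : sg i c * sg i c' * q * cf b i / sg i c = q * (sg i c' * cf b i).
    by field; rewrite fmorph_eq0.
  by apply: (gp_Me gp (UF _) (gp_M gp (gp_sgU gp i Uc') (Wb i))); zmod.
by rewrite -mulrA -rmorphM mulVf // rmorph1 mulr1.
Qed.

(** Up to left denominators, the summand [W_(g k)] is generated by a single nonzero scalar [c k]: as
    [a b = t c_k] with a nonzero, the image of [c k] determines f on the whole summand. *)
Lemma Wrow_hom n m (g : 'I_n -> D) (f : {linear Wrow_mod g -> BTrow m}) :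
  exists A : 'M[B]_(n, m), forall v, f v = (sval_lin v : 'rV[B]_n) *m A.
Proof.
have /choice[c cP] : forall k, exists c, U (g k) c /\ c != 0.
  by move=> k; have [c] := gp_neq0 gp (g k); exists c.
pose e k b : 'rV[B]_n := b *: delta_mx 0 k.
have We k b : W (g k) b -> Wrow g (e k b).
  move=> Wb l; rewrite !mxE eqxx /=; case: eqP => [->|_]; rewrite ?mulr1 ?mulr0 //.
  exact: W_0.
pose ec k := msub (Wrow_submodule g) (We k _ (W_io (cP k).1)).
pose A := \matrix_(k, l) (io (c k)^-1 * (f (ec k) : 'rV[B]_m) 0 l).
have AE k (b : B) (Wb : W (g k) b) :
    (f (msub (Wrow_submodule g) (We k b Wb)) : 'rV[B]_m) = b *: row k A.
  have [a [t [Ua a0 Wt ab]]] := W_left_denominator Wb (cP k).1 (cP k).2.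
  have /jW[a' a'E] := W_io Ua; have /jW[t' t'E] := Wt.
  have e1 : a' *: msub (Wrow_submodule g) (We k b Wb) = t' *: ec k.
    apply: sval_lin_inj; rewrite !linearZZ !msubK !resmodZ a'E t'E.
    by rewrite /e !scalerA ab.
  have := congr1 f e1; rewrite !linearZZ !resmodZ a'E t'E => e2.
  have -> : (f (msub (Wrow_submodule g) (We k b Wb)) : 'rV[B]_m) =
      io a^-1 *: (t *: (f (ec k) : 'rV[B]_m)).
    by rewrite -e2 scalerA -rmorphM mulVf // rmorph1 scale1r.
  have -> : row k A = io (c k)^-1 *: (f (ec k) : 'rV[B]_m).
    by apply/rowP => l; rewrite !mxE.
  rewrite !scalerA; congr (_ *: _).
  have -> : t = io a * b * io (c k)^-1.
    by rewrite ab -mulrA -rmorphM divff ?rmorph1 ?mulr1 //; case: (cP k).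
  by rewrite !mulrA -rmorphM mulVf // rmorph1 mul1r.
exists A => v; pose vk k := (sval_lin v : 'rV[B]_n) 0 k.
have Wv k : W (g k) (vk k) by exact: (sval_linP v).
have vE : v = \sum_k msub (Wrow_submodule g) (We k _ (Wv k)).
  apply: sval_lin_inj; rewrite linear_sum.
  exact: (row_sum_delta (sval_lin v : 'rV[B]_n)).
rewrite {1}vE linear_sum mulmx_sum_row.
by apply: eq_bigr => k _; rewrite AE.
Qed.

Lemma Wrow_mod_iso n (g h : 'I_n.+1 -> D) : lmod_iso (Wrow_mod g) (Wrow_mod h) ->
  cl (\sum_k g k) = cl (\sum_k h k).
Proof.
move=> /lmod_isoP[f [f' [fK f'K]]].
have [A AE] := Wrow_hom ((sval_lin : {linear Wrow_mod h -> BTrow n.+1}) \o f).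
have [A' A'E] := Wrow_hom ((sval_lin : {linear Wrow_mod g -> BTrow n.+1}) \o f').
have gA v : Wrow g v -> Wrow h (v *m A).
  move=> gv; rewrite -(msubK (Wrow_submodule g) gv) -AE; exact: sval_linP.
have hA' v : Wrow h v -> Wrow g (v *m A').
  move=> hv; rewrite -(msubK (Wrow_submodule h) hv) -A'E; exact: sval_linP.
have one (u : 'I_n.+1 -> D) (X : 'M[B]_n.+1) :
    (forall v, Wrow u v -> v *m X = v) -> X = 1%:M.
  move=> uX; apply/row_matrixP => k.
  have [c Uc c0] := gp_neq0 gp (u k).
  have : (io c *: delta_mx 0 k : 'rV[B]_n.+1) *m X = io c *: delta_mx 0 k.
    apply: uX => l; rewrite !mxE eqxx /=; case: eqP => [->|_]; rewrite ?mulr1 ?mulr0.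
      exact: W_io.
    exact: W_0.
  rewrite -scalemxAl -rowE => /(congr1 (fun v => io c^-1 *: v)).
  by rewrite !scalerA -rmorphM mulVf // rmorph1 !scale1r row1.
apply: (Wrow_class gA hA').
  apply: (one g) => v gv; pose y := msub (Wrow_submodule g) gv.
  have e1 : (sval_lin (f y) : 'rV[B]_n.+1) = v *m A := AE y.
  have e2 : (sval_lin (f' (f y)) : 'rV[B]_n.+1) = sval_lin (f y) *m A' := A'E (f y).
  by rewrite mulmxA -e1 -e2 fK.
apply: (one h) => v hv; pose y := msub (Wrow_submodule h) hv.
have e1 : (sval_lin (f' y) : 'rV[B]_n.+1) = v *m A' := A'E y.
have e2 : (sval_lin (f (f' y)) : 'rV[B]_n.+1) = sval_lin (f' y) *m A := AE (f' y).
by rewrite mulmxA -e1 -e2 f'K.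
Qed.

Lemma Wrow_mod_split a n : lmod_iso (WM a * free_mod T n)%type
  (Wrow_mod (fun k : 'I_n.+1 => if k == ord0 then a else 0)).
Proof.
pose g (k : 'I_n.+1) := if k == ord0 then a else 0.
pose F (x : WM a * free_mod T n) : BTrow n.+1 :=
  \row_k (if unlift ord0 k is Some i then j ((x.2 : 'rV[T]_n) 0 i) else (sval_lin x.1 : B)).
have Fl : linear F.
  move=> t x y; apply/rowP => k; rewrite resmodZ !mxE; case: unliftP => [i|] _.
    by rewrite !mxE rmorphD rmorphM.
  have -> : sval_lin (t *: x + y).1 = t *: sval_lin x.1 + sval_lin y.1 by exact: linearP.
  by rewrite BTZ.
have FW x : Wrow g (mklin Fl x).
  move=> k; rewrite mklinE mxE /g; case: unliftP => [i ->|->].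
    by rewrite eq_sym (negPf (neq_lift _ _)); exact: jW0.
  by rewrite eqxx; exact: sval_linP.
have [f fE] := submod_lift (Wrow_submodule g) FW.
apply: (@lmod_iso_bij _ _ _ f) => [x y xy|v].
  have /rowP e : F x = F y by rewrite -!(mklinE Fl) -!fE xy.
  have e1 : x.1 = y.1.
    by apply: sval_lin_inj; have := e ord0; rewrite !mxE unlift_none.
  have e2 : x.2 = y.2.
    by apply/rowP => i; apply: jI; have := e (lift ord0 i); rewrite !mxE liftK.
  by case: x y e1 e2 {xy e} => ? ? [? ?] /= -> ->.
have gv : Wrow g (sval_lin v) := sval_linP v.
have W0 : W a ((sval_lin v : 'rV[B]_n.+1) 0 ord0) by have := gv ord0; rewrite /g eqxx.
have /choice[x xP] : forall i, exists t, j t = (sval_lin v : 'rV[B]_n.+1) 0 (lift ord0 i).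
  by move=> i; apply/jW; have := gv (lift ord0 i); rewrite /g eq_sym (negPf (neq_lift _ _)).
exists (msub (W_submodule a) W0, \row_i x i : 'rV[T]_n).
apply: sval_lin_inj; rewrite fE mklinE; apply/rowP => k; rewrite mxE.
by case: unliftP => [i ->|->] //; rewrite mxE xP.
Qed.

(** A complement of Q makes the common summand free, and both sides become modules of rows. *)
Lemma WM_stably_cl a b : stably_iso (WM a) (WM b) -> cl a = cl b.
Proof.
move=> [Q [fQ pQ iso]]; have [n [N isoN]] := fgproj_embed fQ pQ.
have iso1 : lmod_iso (WM a * free_mod T n)%type (WM b * free_mod T n)%type.
  apply: lmod_iso_trans (lmod_iso_prodr _ isoN) _.
  apply: (@lmod_iso_trans _ _ ((WM a * Q) * N)%type); first by mod_ac.
  apply: lmod_iso_trans (lmod_iso_prodl _ iso) _.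
  apply: lmod_iso_trans (lmod_iso_prodr _ (lmod_iso_sym isoN)); by mod_ac.
have := Wrow_mod_iso (lmod_iso_trans (lmod_iso_sym (Wrow_mod_split a n))
  (lmod_iso_trans iso1 (Wrow_mod_split b n))).
by rewrite !big_ord_recl /= !big1 ?addr0.
Qed.

End IntegralSkewRing.

(** * Construction of skew Laurent rings *)

(** The coefficient set is a parameter: all of L gives the big ring B, and [U_0] gives T. The
    constants are fixed by sg, which makes K central. *)
Record skew_data (K : fieldType) (L : fieldType) := SkewData {
  sd_const : {rmorphism K -> L};
  sd_sg : int -> {rmorphism L -> L};
  sd_coef : L -> Prop;
  sd_sg0 : forall u, sd_sg 0 u = u;
  sd_sgD : forall i j u, sd_sg (i + j) u = sd_sg i (sd_sg j u);
  sd_sg_const : forall i c, sd_sg i (sd_const c) = sd_const c;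
  sd_coef_const : forall c, sd_coef (sd_const c);
  sd_coefB : forall a b, sd_coef a -> sd_coef b -> sd_coef (a - b);
  sd_coefM : forall a b, sd_coef a -> sd_coef b -> sd_coef (a * b);
  sd_coef_sg : forall i a, sd_coef a -> sd_coef (sd_sg i a) }.

Section SkewRing.
Variables (K L : fieldType) (d : skew_data K L).
Local Notation sg := (sd_sg d).
Local Notation A := (sd_coef d).

(* The skew Laurent polynomial [sum_k a_k x^k] is represented by the operator
   [v |-> (n |-> sum_k sg n (a_k) * v (n + k))] on the sequences [int -> L], so
   that the product is the composition. *)
Inductive skew_operator : ((int -> L) -> int -> L) -> Prop :=
| Skew0 : skew_operator (fun v n => 0)
| SkewD f g : skew_operator f -> skew_operator g -> skew_operator (fun v n => f v n + g v n)
| SkewM a k : A a -> skew_operator (fun v n => sg n a * v (n + k)).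

Record skew_poly := SkewPoly { skew_fun : (int -> L) -> int -> L; _ : skew_operator skew_fun }.

HB.instance Definition _ := gen_eqMixin skew_poly.
HB.instance Definition _ := gen_choiceMixin skew_poly.

Lemma skew_funP (f : skew_poly) : skew_operator (skew_fun f). Proof. by case: f. Qed.

Lemma skew_ext (f g : skew_poly) : (forall v n, skew_fun f v n = skew_fun g v n) -> f = g.
Proof.
case: f g => f fP [g gP] /= fg; have e : f = g by apply/funext => v; apply/funext => n.
by subst g; congr SkewPoly; exact: Prop_irrelevance.
Qed.

Lemma is_skew_eq f g : (forall v n, f v n = g v n) -> skew_operator f -> skew_operator g.
Proof. by move=> fg; have -> : g = f by apply/funext => v; apply/funext => n. Qed.

Lemma sd_coef1 : A 1. Proof. by rewrite -(rmorph1 (sd_const d)); exact: sd_coef_const. Qed.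

Lemma sd_coefN a : A a -> A (- a).
Proof.
move=> Aa; rewrite -sub0r; apply: sd_coefB => //.
by rewrite -(rmorph0 (sd_const d)); exact: sd_coef_const.
Qed.

Lemma is_skew_scale f c : skew_operator f -> skew_operator (fun v n => sd_const d c * f v n).
Proof.
elim=> [|g h _ IHg _ IHh|a k Aa].
- by apply: is_skew_eq Skew0 => v n; rewrite mulr0.
- by apply: is_skew_eq (SkewD IHg IHh) => v n; rewrite mulrDr.
apply: (@is_skew_eq (fun v n => sg n (sd_const d c * a) * v (n + k))) => [v n|].
  by rewrite rmorphM sd_sg_const mulrA.
by apply/SkewM/sd_coefM => //; exact: sd_coef_const.
Qed.

Lemma is_skew_opp f : skew_operator f -> skew_operator (fun v n => - f v n).
Proof. by move=> /(is_skew_scale (-1)); apply: is_skew_eq => v n; rewrite rmorphN1 mulN1r. Qed.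

Lemma is_skew_comp f g : skew_operator f -> skew_operator g -> skew_operator (fun v => f (g v)).
Proof.
move=> fP gP; elim: fP => [|f1 f2 _ IH1 _ IH2|a k Aa]; first exact: Skew0.
  exact: SkewD IH1 IH2.
elim: gP => [|g1 g2 _ IH1 _ IH2|b l Ab].
- by apply: is_skew_eq Skew0 => v n; rewrite mulr0.
- by apply: is_skew_eq (SkewD IH1 IH2) => v n; rewrite mulrDr.
apply: (@is_skew_eq (fun v n => sg n (a * sg k b) * v (n + (k + l)))) => [v n|].
  by rewrite rmorphM -sd_sgD -mulrA addrA.
by apply/SkewM/sd_coefM => //; exact: sd_coef_sg.
Qed.

Definition skew_zero := SkewPoly Skew0.
Definition skew_add f g := SkewPoly (SkewD (skew_funP f) (skew_funP g)).
Definition skew_opp f := SkewPoly (is_skew_opp (skew_funP f)).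
Definition skew_mon a k (Aa : A a) := SkewPoly (SkewM k Aa).
Definition skew_one := skew_mon 0 sd_coef1.
Definition skew_comp f g := SkewPoly (is_skew_comp (skew_funP f) (skew_funP g)).
Definition skew_scale c f := SkewPoly (is_skew_scale c (skew_funP f)).

Fact skew_addA : associative skew_add.
Proof. by move=> f g h; apply: skew_ext => v n /=; rewrite addrA. Qed.
Fact skew_addC : commutative skew_add.
Proof. by move=> f g; apply: skew_ext => v n /=; rewrite addrC. Qed.
Fact skew_add0 : left_id skew_zero skew_add.
Proof. by move=> f; apply: skew_ext => v n /=; rewrite add0r. Qed.
Fact skew_addN : left_inverse skew_zero skew_opp skew_add.
Proof. by move=> f; apply: skew_ext => v n /=; rewrite addNr. Qed.

HB.instance Definition _ := GRing.isZmodule.Build skew_poly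
  skew_addA skew_addC skew_add0 skew_addN.

Lemma is_skewD f (v w : int -> L) n : skew_operator f ->
  f (fun n => v n + w n) n = f v n + f w n.
Proof.
move=> fP; elim: fP n => [n|f1 f2 _ IH1 _ IH2 n|a k _ n]; first by rewrite addr0.
  by rewrite IH1 IH2 addrACA.
by rewrite mulrDr.
Qed.

Lemma is_skewZ f c (v : int -> L) n : skew_operator f -> f (fun n => c * v n) n = c * f v n.
Proof.
move=> fP; elim: fP n => [n|f1 f2 _ IH1 _ IH2 n|a k _ n]; first by rewrite mulr0.
  by rewrite IH1 IH2 mulrDr.
by rewrite mulrCA.
Qed.

Fact skew_compA : associative skew_comp.
Proof. by move=> f g h; apply: skew_ext. Qed.
Fact skew_comp1 : left_id skew_one skew_comp.
Proof. by move=> f; apply: skew_ext => v n /=; rewrite rmorph1 mul1r addr0. Qed.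
Fact skew_1comp : right_id skew_one skew_comp.
Proof.
move=> f; apply: skew_ext => v n /=; congr (skew_fun f _ n).
by apply/funext => m; rewrite rmorph1 mul1r addr0.
Qed.
Fact skew_compDl : left_distributive skew_comp +%R.
Proof. by move=> f g h; apply: skew_ext. Qed.
Fact skew_compDr : right_distributive skew_comp +%R.
Proof. by move=> f g h; apply: skew_ext => v n /=; exact: is_skewD (skew_funP f). Qed.
Fact skew_one_neq0 : skew_one != 0.
Proof.
apply/eqP => /(congr1 (fun f => skew_fun f (fun=> 1) 0)) /= /eqP.
by rewrite rmorph1 mulr1 oner_eq0.
Qed.

HB.instance Definition _ := GRing.Zmodule_isNzRing.Build skew_poly
  skew_compA skew_comp1 skew_1comp skew_compDl skew_compDr skew_one_neq0.

Fact skew_scaleA a b f : skew_scale a (skew_scale b f) = skew_scale (a * b) f.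
Proof. by apply: skew_ext => v n /=; rewrite rmorphM mulrA. Qed.
Fact skew_scale1 : left_id 1 skew_scale.
Proof. by move=> f; apply: skew_ext => v n /=; rewrite rmorph1 mul1r. Qed.
Fact skew_scaleDr : right_distributive skew_scale +%R.
Proof. by move=> a f g; apply: skew_ext => v n /=; rewrite mulrDr. Qed.
Fact skew_scaleDl f : {morph skew_scale^~ f : a b / a + b}.
Proof. by move=> a b; apply: skew_ext => v n /=; rewrite rmorphD mulrDl. Qed.

HB.instance Definition _ := GRing.Zmodule_isLmodule.Build K skew_poly
  skew_scaleA skew_scale1 skew_scaleDr skew_scaleDl.

Fact skew_scaleAl a (f g : skew_poly) : a *: (f * g) = a *: f * g.
Proof. by apply: skew_ext. Qed.

HB.instance Definition _ := GRing.Lmodule_isLalgebra.Build K skew_poly skew_scaleAl.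

Fact skew_scaleAr a (f g : skew_poly) : a *: (f * g) = f * (a *: g).
Proof. by apply: skew_ext => v n /=; rewrite (is_skewZ _ _ _ (skew_funP f)). Qed.

HB.instance Definition _ := GRing.Lalgebra_isAlgebra.Build K skew_poly skew_scaleAr.

Definition skew_alg : algType K := skew_poly.

Definition skew_delta (i n : int) : L := (n == i)%:R.

(** Applied to the indicator of i and evaluated at 0, where the twist is trivial, the operator
    returns [a_i]. *)
Definition skew_coef (f : skew_poly) i : L := skew_fun f (skew_delta i) 0.

Lemma skew_coef_mon a k (Aa : A a) i : skew_coef (skew_mon k Aa) i = if i == k then a else 0.
Proof.
rewrite /skew_coef /= sd_sg0 /skew_delta add0r eq_sym.
by case: eqP => _; rewrite ?mulr1 ?mulr0.
Qed.

Lemma skew_coefA f i : A (skew_coef f i).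
Proof.
rewrite /skew_coef; elim: (skew_funP f) => [|f1 f2 _ A1 _ A2|a k Aa].
- by rewrite -(subrr 1); apply: sd_coefB; exact: sd_coef1.
- by rewrite -[X in _ + X]opprK; apply: sd_coefB => //; exact: sd_coefN.
rewrite sd_sg0 /skew_delta; case: eqP => _; first by rewrite mulr1.
by rewrite mulr0 -(subrr 1); apply: sd_coefB; exact: sd_coef1.
Qed.

Lemma is_skew_delta f i n : skew_operator f -> f (skew_delta i) n = sg n (f (skew_delta (i - n)) 0).
Proof.
elim=> [|f1 f2 _ IH1 _ IH2|a k _]; first by rewrite rmorph0.
  by rewrite IH1 IH2 rmorphD.
rewrite sd_sg0 rmorphM /skew_delta rmorph_nat; congr (_ * _%:R).
by congr (nat_of_bool _); lia.
Qed.

(** Stated for every bound M from N on, so that two operators can be compared over a common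
    range. *)
Lemma is_skew_expand f : skew_operator f -> exists N : nat, forall M : nat, (N <= M)%N ->
  (forall i, f (skew_delta i) 0 != 0 -> `|i|%R <= M%:Z) /\
  forall v n, f v n = \sum_(k < M.*2.+1) sg n (f (skew_delta (k%:Z - M%:Z)) 0) * v (n + (k%:Z - M%:Z)).
Proof.
elim=> [|f1 f2 _ [N1 H1] _ [N2 H2]|a k _].
- exists 0%N => M _; split=> [i|v n]; first by rewrite eqxx.
  by rewrite big1 // => k _; rewrite rmorph0 mul0r.
- exists (maxn N1 N2) => M; rewrite geq_max => /andP[/H1[b1 e1] /H2[b2 e2]]; split=> [i|v n].
    by have [->|/b1 //] := eqVneq (f1 (skew_delta i) 0) 0; rewrite add0r => /b2.
  by rewrite e1 e2 -big_split; apply: eq_bigr => k _; rewrite /= rmorphD mulrDl.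
exists (absz k) => M kM; split=> [i|v n].
  by rewrite /skew_delta; have [|_] := eqVneq (0 + k) i; rewrite ?mulr0 ?eqxx //; lia.
have klt : (absz (k + M%:Z)%R < M.*2.+1)%N by lia.
have [i0 i0E] : exists i0 : 'I_M.*2.+1, i0%:Z - M%:Z = k.
  by exists (Ordinal klt) => /=; lia.
rewrite (bigD1 i0) //= big1 ?addr0 => [|l li].
  by rewrite i0E sd_sg0 /skew_delta add0r eqxx mulr1.
have kl : (0 + k == l%:Z - M%:Z) = false.
  by apply/negbTE; apply: contra li => /eqP e; rewrite -val_eqE /=; lia.
by rewrite /skew_delta kl mulr0 rmorph0 mul0r.
Qed.

Lemma skew_coef_inj f g : (forall i, skew_coef f i = skew_coef g i) -> f = g.
Proof.
move=> fg; have [N1 H1] := is_skew_expand (skew_funP f).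
have [N2 H2] := is_skew_expand (skew_funP g); apply: skew_ext => v n.
have [_ ->] := H1 (maxn N1 N2) (leq_maxl _ _); have [_ ->] := H2 (maxn N1 N2) (leq_maxr _ _).
by apply: eq_bigr => k _; congr (sg n _ * _); exact: fg.
Qed.

Lemma skew_coef_mull a k (Aa : A a) f i :
  skew_coef (skew_mon k Aa * f) i = a * sg k (skew_coef f (i - k)).
Proof. by rewrite /skew_coef /= sd_sg0 add0r (is_skew_delta _ _ (skew_funP f)). Qed.

Lemma skew_coef_mulr a k (Aa : A a) f i :
  skew_coef (f * skew_mon k Aa) i = skew_coef f (i - k) * sg (i - k) a.
Proof.
rewrite /skew_coef /= mulrC -(is_skewZ _ _ _ (skew_funP f)).
congr (skew_fun f _ 0); apply/funext => n; rewrite /skew_delta.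
have -> : (n + k == i) = (n == i - k) by lia.
by case: eqP => [->|_]; rewrite ?mulr0.
Qed.

Lemma skew_poly_of_coef (c : int -> L) (N : nat) : (forall i, A (c i)) ->
  (forall i, c i != 0 -> `|i|%R <= N%:Z) -> exists f, forall i, skew_coef f i = c i.
Proof.
move=> Ac cN.
exists (\sum_(k < N.*2.+1) skew_mon (k%:Z - N%:Z) (Ac (k%:Z - N%:Z))) => i.
have coefD f g : skew_coef (f + g) i = skew_coef f i + skew_coef g i by [].
have -> : forall (F : 'I_N.*2.+1 -> skew_poly), skew_coef (\sum_k F k) i = \sum_k skew_coef (F k) i.
  by move=> F; elim/big_rec2: _ => // k _ y _ <-.
under eq_bigr => k _ do rewrite skew_coef_mon.
have [ci0|/cN iN] := eqVneq (c i) 0.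
  by rewrite ci0 big1 // => k _; case: eqP => // <-.
have klt : (absz (i + N%:Z)%R < N.*2.+1)%N by lia.
have [i0 i0E] : exists i0 : 'I_N.*2.+1, i0%:Z - N%:Z = i.
  by exists (Ordinal klt) => /=; lia.
rewrite (bigD1 i0) //= i0E eqxx big1 ?addr0 // => k ki.
by case: eqP => // e; case/negP: ki; rewrite -val_eqE /=; lia.
Qed.

End SkewRing.

(** * The class group *)

Section ClassGroup.
Variables (L : fieldType) (D G : zmodType) (cl : D -> G) (U : D -> L -> Prop).
Variables (len : L -> nat) (sg : int -> {rmorphism L -> L}).
Hypothesis gp : graded_pid cl U len sg.
Variables (B : nzRingType) (io : {rmorphism L -> B}) (xz : int -> B) (cf : B -> int -> L).
Hypothesis sl : skew_laurent sg io xz cf.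
Variables (S : nzRingType) (j : {rmorphism S^c -> B}).
Hypothesis jI : injective j.
Hypothesis jW : forall b, W U cf 0 b <-> exists t, j t = b.

Local Notation WM := (WM gp sl jW).

(** Right modules over S are left modules over [S^c], so the preceding results are used with [S^c]
    in the place of T. *)
Definition WP a : fgproj S := FGProj (WM_fg gp sl jI jW a) (@WM_proj _ _ _ _ _ _ _ gp _ _ _ _ sl _ _ jI jW a).
Local Notation RP := (fgproj_regular S).

Lemma K0_diff_WP_eq a b : K0_diff (WP a) RP = K0_diff (WP b) RP <-> cl a = cl b.
Proof.
rewrite K0_diff_eq; split=> [[Q /= iso]|ab].
  apply: (WM_stably_cl (gp := gp) (sl := sl) (jW := jW) jI); exists ((S^c)^o * Q)%type; split.
  - by apply: finitely_generated_prod; [exact: finitely_generated_regular|exact: fgproj_fg].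
  - by apply: projective_prod; [exact: projective_regular|exact: fgproj_proj].
  apply: (@lmod_iso_trans _ _ ((WM a * (S^c)^o) * Q)%type); first by mod_ac.
  apply: (@lmod_iso_trans _ _ ((WM b * (S^c)^o) * Q)%type); first exact: iso.
  by mod_ac.
exists RP; apply: lmod_iso_prodl; apply: lmod_iso_prodl; exact: WM_cl.
Qed.

(** Stably, [P + W_0 = W_aP + F] and [Q + W_0 = W_aQ + F] with the same free module F, as P and Q
    have the same rank. Hence the difference of P and Q is that of [W_a] and S for [a = aP - aQ]. *)
Lemma class_groupP x : class_group x <-> exists a, K0_diff (WP a) RP = x.
Proof.
split=> [[P [Q [m [n [-> Pm Qn mn]]]]]|[a <-]]; last first.
  exists (WP a), RP, 1%N, 1%N; split=> //; first exact: (WM_udim gp sl jI jW).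
  exact: (regular_udim gp sl jI jW).
have {}mn : m = n by apply/eqP; rewrite -eqz_nat -subr_eq0 -mn.
subst n.
have [mP [aP gP]] := fgproj_good gp sl jI jW (fgproj_fg P) (@fgproj_proj _ P).
have [mQ [aQ gQ]] := fgproj_good gp sl jI jW (fgproj_fg Q) (@fgproj_proj _ Q).
have mE : m = mP by apply/(good_module_udim jI m gP).
have mE' : m = mQ by apply/(good_module_udim jI m gQ).
rewrite -{}mE in gP; rewrite -{}mE' in gQ.
case: gP => _ _ stP _ _; case: gQ => _ _ stQ _ _.
exists (aP - aQ); apply/K0_diff_eq.
set a := aP - aQ; pose F := free_mod S^c m.
have st : stably_iso ((WM a * Q) * WM 0)%type ((P * (S^c)^o) * WM 0)%type.
  apply: (@stably_trans _ _ (WM a * (WM aQ * F))%type).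
    apply: (@stably_trans _ _ (WM a * (Q * WM 0))%type); first by apply: iso_stably; mod_ac.
    by apply: stably_prod stQ; exact/iso_stably/lmod_iso_refl.
  apply: (@stably_trans _ _ ((S^c)^o * (WM aP * F))%type).
    apply: iso_stably; apply: (@lmod_iso_trans _ _ ((WM a * WM aQ) * F)%type); first by mod_ac.
    apply: lmod_iso_trans (lmod_iso_prodl _ (WM_det gp sl jW _ _)) _.
    have -> : a + aQ = aP by rewrite subrK.
    apply: (@lmod_iso_trans _ _ ((WM aP * (S^c)^o) * F)%type); last by mod_ac.
    exact/lmod_iso_prodl/lmod_iso_prodr/lmod_iso_sym/(WM0_iso gp sl jI jW).
  apply: (@stably_trans _ _ ((S^c)^o * (P * WM 0))%type); last by apply: iso_stably; mod_ac.
  by apply: stably_prod (stably_sym stP); exact/iso_stably/lmod_iso_refl.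
have [X [fX pX iso]] := st.
exists (fgproj_sum (WP 0) (FGProj fX pX)).
apply: (@lmod_iso_trans _ ((WM a * Q) * (WM 0 * X))%type ((P * (S^c)^o) * (WM 0 * X))%type).
  apply: (@lmod_iso_trans _ _ (((WM a * Q) * WM 0) * X)%type); first by mod_ac.
  by apply: lmod_iso_trans iso _; mod_ac.
exact: lmod_iso_refl.
Qed.

Lemma K0_add_WP a b :
  K0_add (K0_diff (WP a) RP) (K0_diff (WP b) RP) = K0_diff (WP (a + b)) RP.
Proof.
have iso : lmod_iso ((WM a * WM b) * (S^c)^o)%type (WM (a + b) * ((S^c)^o * (S^c)^o))%type.
  apply: lmod_iso_trans (lmod_iso_prodl _ (WM_det gp sl jW _ _)) _.
  apply: (@lmod_iso_trans _ _ ((WM (a + b) * (S^c)^o) * (S^c)^o)%type); last by mod_ac.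
  exact/lmod_iso_prodl/lmod_iso_prodr/lmod_iso_sym/(WM0_iso gp sl jI jW).
by rewrite K0_add_diff; apply/K0_diff_eq; exists RP; exact: lmod_iso_prodl iso.
Qed.

Lemma class_group_isomP : class_group_isom S G.
Proof.
have /choice[s sK] := gp_cl_surj gp.
exists (fun g => K0_diff (WP (s g)) RP); split=> [g h|g h /K0_diff_WP_eq|x].
- by rewrite K0_add_WP; apply/K0_diff_WP_eq; rewrite (gp_clD gp) !sK.
- by rewrite !sK.
- split=> [/class_groupP[a <-]|[g <-]].
    by exists (cl a); apply/K0_diff_WP_eq; rewrite sK.
  by apply/class_groupP; exists (s g).
Qed.

Lemma max_ideal_class e p : gp_prime U e p ->
  maximal_right_ideal (max_ideal U io cf j e p : set S) /\
  class_contains (K0_diff (WP (- e)) RP) (max_ideal U io cf j e p : set S).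
Proof.
move=> pp; have hM := max_ideal_submodule gp sl jW e p.
have [Up p0 _ _] := pp.
have rM : right_ideal (max_ideal U io cf j e p : set S).
  by case: hM => M0 MD MZ; split=> // x r Mx; exact: (MZ r x Mx).
split; split=> //.
- by move=> eT; apply: (max_ideal_proper gp sl pp (j := j)); rewrite eT.
- move=> b [b0 bD bM] Mb; have [bME|nbM] := pselect (forall x, b x -> max_ideal U io cf j e p x).
    by left; apply/funext => x; apply/propext; split=> [/bME|/Mb].
  right; apply/funext => x; apply/propext; split=> // _.
  have [t bt nt] : exists2 t, b t & ~ max_ideal U io cf j e p t.
    apply: contrapT => nex; apply: nbM => t bt; apply: contrapT => nt.
    by apply: nex; exists t.
  apply: (max_ideal_maximal gp sl jI jW pp (I := b) (t := t)) => //.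
  by split=> // r y by_; exact: (bM y r by_).
(* Essentiality: by the Ore condition, a nonzero element z of the ideal and y have a nonzero common
   multiple. *)
- split=> // b [b0 bD bM] [y by_ y0].
  have [c Uc c0] := gp_neq0 gp (- e).
  have /jW[z zE] : W U cf 0 (io (c * p)).
    by apply: (W_io gp sl); apply: (gp_Me gp Uc Up); rewrite addNr.
  have Mz : max_ideal U io cf j e p z by exists (io c); [exact: (W_io gp sl)|rewrite zE rmorphM].
  have z0 : z != 0.
    apply/eqP => z0; move/eqP: zE; rewrite z0 rmorph0 eq_sym fmorph_eq0 mulf_eq0.
    by rewrite (negPf c0) (negPf p0).
  have [s [t [s0 st]]] := T_ore gp sl jI jW z y0.
  exists (s * z : S^c); split; [by case: hM => _ _; apply|by rewrite st; exact: (bM y t by_)|].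
  apply/eqP => /(T_dom sl jI)[e0|e0]; [by rewrite e0 eqxx in s0|by rewrite e0 eqxx in z0].
- have [f [fI fE]] := max_ideal_iso gp sl jI jW pp.
  by exists (WP (- e)), f.
Qed.

(** Tested on [c * p] with c of degree [- e], the inclusion shows that p / p' multiplies [U_(-e)]
    into [U_(-e')]. This separates the ideals of non-associate primes. *)
Lemma max_ideal_inj e p e' p' : gp_prime U e p -> gp_prime U e' p' ->
  (forall t, max_ideal U io cf j e p t -> max_ideal U io cf j e' p' t) ->
  U (e - e') (p / p').
Proof.
move=> [Up p0 _ _] [Up' p'0 _ _] MM.
have -> : e - e' = - e' - (- e) by zmod.
apply: (gp_quot gp) => c Uc.
have /jW[z zE] : W U cf 0 (io (c * p)).
  by apply: (W_io gp sl); apply: (gp_Me gp Uc Up); rewrite addNr.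
have [|b Wb bE] := MM z; first by exists (io c); [exact: (W_io gp sl)|rewrite zE rmorphM].
have := congr1 (fun b => cf b 0) (etrans (esym zE) bE).
rewrite (cf_io sl) eqxx (cf_ior sl) (gp_sg0 gp) => e1.
by rewrite mulrA e1 mulfK.
Qed.

End ClassGroup.

(** * The opposite skew Laurent ring *)

Section Reverse.
Variables (L : fieldType) (D G : zmodType) (cl : D -> G) (U : D -> L -> Prop).
Variables (len : L -> nat) (sg : int -> {rmorphism L -> L}).
Hypothesis gp : graded_pid cl U len sg.
Variables (B : nzRingType) (io : {rmorphism L -> B}) (xz : int -> B) (cf : B -> int -> L).
Hypothesis sl : skew_laurent sg io xz cf.

Definition rev_sg (k : int) : {rmorphism L -> L} := sg (- k).

Lemma graded_pid_rev : graded_pid cl U len rev_sg.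
Proof.
split; rewrite /rev_sg; try by case: gp.
- by move=> k l u; rewrite opprD (gp_sgD gp).
- by move=> a u k; exact: (gp_sgU gp).
- by move=> a u k Uu u0 k0; apply: (gp_sg_orbit gp) => //; rewrite oppr_eq0.
Qed.

Definition rev_io (a : L) : B^c := io a.

Fact rev_io_zmod : zmod_morphism rev_io. Proof. by move=> x y; exact: (rmorphB io x y). Qed.
Fact rev_io_monoid : monoid_morphism rev_io.
Proof.
split=> [|a b]; first exact: (rmorph1 io).
by rewrite /rev_io mulrC; exact: (rmorphM io b a).
Qed.

HB.instance Definition _ := GRing.isZmodMorphism.Build L B^c rev_io rev_io_zmod.
HB.instance Definition _ := GRing.isMonoidMorphism.Build L B^c rev_io rev_io_monoid.

(** Left coefficients in the opposite ring are right coefficients in B, and [a x^i] equals [x^i a']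
    with [a' = sg (- i) a]. *)
Definition rev_cf (b : B^c) i := sg (- i) (cf b i).

Lemma skew_laurent_rev : skew_laurent rev_sg (rev_io : {rmorphism L -> B^c}) (xz : int -> B^c) rev_cf.
Proof.
have mE (x y : B^c) : x * y = (y : B) * (x : B) by [].
have sK k : cancel (sg k) (sg (- k)) := gp_sgK gp k.
have xio a k : ((io a : B^c) * xz k : B^c) = io (sg k a) * xz k by rewrite mE (sl_comm sl).
split; rewrite /rev_sg /rev_cf /rev_io /=.
- exact: (sl_x0 sl).
- by move=> k l; rewrite mE addrC (sl_xD sl).
- by move=> k a; rewrite xio mE (gp_sgNK gp).
- by move=> b c i; rewrite (sl_cfB sl) rmorphB.
- move=> b c bc; apply: (sl_cf_inj sl) => i.
  by rewrite -[LHS](gp_sgNK gp i) bc (gp_sgNK gp).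
- by move=> b; have [N Nb] := sl_cf_fin sl b; exists N => i; rewrite fmorph_eq0 => /Nb.
- by move=> a k i; rewrite xio (sl_cf_mon sl); case: eqP => [->|_]; rewrite ?sK ?rmorph0.
- move=> a k b i; rewrite mE xio (sl_cfr sl) rmorphM -!(gp_sgD gp) mulrC.
  rewrite [X in sg X a](_ : _ = 0) ?(gp_sg0 gp); last by lia.
  by congr (_ * sg _ _); lia.
- move=> b a k i; rewrite mE xio (sl_cfl sl) rmorphM -!(gp_sgD gp) mulrC.
  by congr (sg _ _ * sg _ _); lia.
Qed.

End Reverse.

(** * Polynomial rings and factoriality *)

Section FreeAbelianGroup.
Variable G : zmodType.

Definition fabgroup : zmodType := {malg int[G]}.
Definition fgen (g : G) : fabgroup := mkmalgU g 1.
Definition fsum (x : fabgroup) : G := \sum_(k <- msupp x) k *~ mcoeff k x.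

Lemma fsumEw (d : {fset G}) (x : fabgroup) : (msupp x `<=` d)%fset ->
  fsum x = \sum_(k <- d) k *~ mcoeff k x.
Proof.
move=> le; rewrite /fsum (big_fset_incl _ le) //= => k kd /mcoeff_outdom ->.
by rewrite mulr0z.
Qed.

Lemma fsumB : {morph fsum : x y / x - y}.
Proof.
move=> x y; set d := (msupp x `|` msupp y)%fset.
rewrite !(@fsumEw d) ?fsubsetUl ?fsubsetUr ?msuppB_le // -sumrB.
by apply: eq_bigr => k _; rewrite mcoeffB mulrzBr.
Qed.

Lemma fsum0 : fsum (0 : fabgroup) = 0. Proof. by rewrite -(subrr 0) fsumB subrr. Qed.

Lemma fsumN (x : fabgroup) : fsum (- x) = - fsum x.
Proof. by rewrite -[- x]sub0r fsumB fsum0 sub0r. Qed.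

Lemma fsumD (x y : fabgroup) : fsum (x + y) = fsum x + fsum y.
Proof. by rewrite -[y]opprK fsumB [fsum (- - y)]fsumN. Qed.

Lemma fsum_gen g : fsum (fgen g) = g.
Proof. by rewrite (fsumEw msuppU_le) big_seq_fset1 mcoeffUU mulr1z. Qed.

Lemma fabgroup_ext (x y : fabgroup) : (forall g, mcoeff g x = mcoeff g y) -> x = y.
Proof. by move=> xy; apply/malgP. Qed.

Lemma mcoeff_gen g h : mcoeff h (fgen g) = (g == h)%:R :> int.
Proof. by rewrite mcoeffU. Qed.

End FreeAbelianGroup.

(** * Polynomial rings in arbitrarily many variables *)

Definition polyring (K : fieldType) (I : choiceType) : Type := {malg K[{cmonom I}]}.

HB.instance Definition _ (K : fieldType) (I : choiceType) :=
  GRing.ComNzRing.on (polyring K I).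

Section PolynomialRing.
Variables (K : fieldType) (I : choiceType).
Local Notation polyring := (polyring K I).

Definition pconst : {rmorphism K -> polyring} := malgC.
Definition pvar (i : I) : polyring := mkmalgU (ucm i) 1.

Lemma cmonom_ind (P : cmonom I -> Prop) : P mone ->
  (forall i m, P m -> P (mmul (ucm i) m)) -> forall m, P m.
Proof.
move=> P1 PM m; have [n] := ubnP (mdeg m); elim: n m => // n IHn m /ltnSE mn.
have [/mdeg_eq0I -> //|m0] := eqVneq (mdeg m) 0%N.
have [i im] : exists i, m i != 0%N.
  apply: contrapT => nex; case/negP: m0; rewrite mdeg_eq0; apply/cmP => i.
  by rewrite cm1; apply/eqP; apply: contrapT => /negP mi; apply: nex; exists i.
have mE : m = mmul (ucm i) (divcm m (ucm i)).
  apply/eqP/cmP => k; rewrite cmM cmU divcmE cmU.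
  by have [<-|_] := eqVneq i k; rewrite ?subn0 // add1n subn1 prednK ?lt0n.
rewrite mE; apply/PM/IHn; move: mn; rewrite {1}mE mdegM mdegU add1n.
exact: leq_trans.
Qed.

Lemma mpolyring_ind (P : polyring -> Prop) :
  (forall c, P (pconst c)) -> (forall i, P (pvar i)) ->
  (forall x y, P x -> P y -> P (x + y)) -> (forall x y, P x -> P y -> P (x * y)) ->
  forall x, P x.
Proof.
move=> Pc Pv PD PM x; rewrite (monalgE x).
have P0 : P 0 by rewrite -(rmorph0 pconst); exact: Pc.
have pmonM (m n : cmonom I) c : mkmalgU (mmul m n) c = mkmalgU m 1 * mkmalgU n c :> polyring.
  by rewrite [RHS]fgmulUU mul1r.
have Pm (m : cmonom I) c : P (mkmalgU m c).
  elim/cmonom_ind: m => [|i m Pm]; first exact: (Pc c).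
  rewrite pmonM; exact: (PM (pvar i) (mkmalgU m c) (Pv i) Pm).
by elim/big_ind: _.
Qed.

Section Universal.
Variables (S : comNzRingType) (f : {rmorphism K -> S}) (v : I -> S).

Definition mon_eval (m : cmonom I) : S := \prod_(i <- finsupp m) v i ^+ m i.

Lemma mon_evalEw (d : {fset I}) (m : cmonom I) : (finsupp m `<=` d)%fset ->
  mon_eval m = \prod_(i <- d) v i ^+ m i.
Proof.
move=> le; rewrite /mon_eval (big_fset_incl _ le) //= => i _.
by rewrite -cmE_neq0 negbK => /eqP ->; rewrite expr0.
Qed.

Fact mon_eval_mmorphism : mmorphism mon_eval.
Proof.
split=> [m n|]; last by rewrite /mon_eval mdom1 big_seq_fset0.
set d := (finsupp m `|` finsupp n)%fset.
rewrite !(@mon_evalEw d) ?fsubsetUl ?fsubsetUr ?mdomD // -big_split.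
by apply: eq_bigr => i _; rewrite cmM exprD.
Qed.

HB.instance Definition _ := isMultiplicative.Build (cmonom I) S mon_eval mon_eval_mmorphism.

Lemma mpolyring_eval : exists h : {rmorphism polyring -> S},
  (forall c, h (pconst c) = f c) /\ forall i, h (pvar i) = v i.
Proof.
exists (mmap f mon_eval); split=> [c|i]; first exact: mmapC.
rewrite -[LHS]/(mmap f mon_eval (mkmalgU (ucm i) 1)) mmapU.
rewrite -[X in X * _]/(f 1) -[X in _ * X]/(mon_eval _) rmorph1 mul1r.
by rewrite /mon_eval mdomU big_seq_fset1 cmUU expr1.
Qed.
End Universal.

End PolynomialRing.

(** * Divisibility and factorization *)

Section Divisibility.
Variable R : comNzRingType.
Definition rdiv (a b : R) := exists c, b = a * c.
Definition runit (a : R) := rdiv a 1.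
Definition rprime (p : R) := [/\ p != 0, ~ runit p
  & forall a b, rdiv p (a * b) -> rdiv p a \/ rdiv p b].
Definition rirr (p : R) := [/\ p != 0, ~ runit p
  & forall a b, p = a * b -> runit a \/ runit b].
(** Factors are required to be prime, not just irreducible, which includes uniqueness. *)
Definition ufd := forall a : R, a != 0 -> exists u (s : seq R),
  [/\ runit u, (forall p, p \in s -> rprime p) & a = u * \prod_(p <- s) p].

Lemma rdiv_refl a : rdiv a a. Proof. by exists 1; rewrite mulr1. Qed.

Lemma rdiv_trans b a c : rdiv a b -> rdiv b c -> rdiv a c.
Proof. by move=> [x ->] [y ->]; exists (x * y); rewrite mulrA. Qed.

Lemma rdiv_mulr a b c : rdiv a b -> rdiv a (b * c).
Proof. by move=> [x ->]; exists (x * c); rewrite mulrA. Qed.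

Lemma rdiv_mull a b c : rdiv a c -> rdiv a (b * c).
Proof. by rewrite mulrC; exact: rdiv_mulr. Qed.

Lemma rdivD a b c : rdiv a b -> rdiv a c -> rdiv a (b + c).
Proof. by move=> [x ->] [y ->]; exists (x + y); rewrite mulrDr. Qed.

Lemma rdivN a b : rdiv a b -> rdiv a (- b).
Proof. by move=> [x ->]; exists (- x); rewrite mulrN. Qed.

Lemma rdiv0 a : rdiv a 0. Proof. by exists 0; rewrite mulr0. Qed.

Lemma rdiv_sum a (I : Type) (r : seq I) (P : pred I) (F : I -> R) :
  (forall i, P i -> rdiv a (F i)) -> rdiv a (\sum_(i <- r | P i) F i).
Proof. by move=> aF; elim/big_ind: _ => //; [exact: rdiv0|move=> x y; exact: rdivD]. Qed.

Lemma runit1 : runit 1. Proof. by exists 1; rewrite mulr1. Qed.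

Lemma runitM a b : runit a -> runit b -> runit (a * b).
Proof. by move=> [x e1] [y e2]; exists (x * y); rewrite mulrACA -e1 -e2 mulr1. Qed.

Lemma runitMl a b : runit (a * b) -> runit a.
Proof. by move=> [x e]; exists (b * x); rewrite mulrA. Qed.

Lemma rdiv_unit a b : rdiv a b -> runit b -> runit a.
Proof. by move=> [c ->]; exact: runitMl. Qed.

Lemma rprime_prod p (s : seq R) : rprime p -> rdiv p (\prod_(q <- s) q) ->
  exists2 q, q \in s & rdiv p q.
Proof.
move=> [_ np pp]; elim: s => [|q s IHs]; first by rewrite big_nil => /np.
rewrite big_cons => /pp[pq|/IHs[r rs pr]]; first by exists q; rewrite ?inE ?eqxx.
by exists r; rewrite ?inE ?rs ?orbT.
Qed.
End Divisibility.

Section DivisibilityDomain.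
Variable R : idomainType.
Implicit Types a b p q : R.

Lemma rprime_irr p : rprime p -> rirr p.
Proof.
move=> [p0 np pp]; split=> // a b pab.
have [|[c ac]|[c bc]] := pp a b; first by rewrite -pab; exact: rdiv_refl.
  right; exists c; apply: (mulfI p0).
  by rewrite mulr1 {1}pab {1}ac -!mulrA; congr (_ * _); rewrite mulrC.
left; exists c; apply: (mulfI p0).
by rewrite mulr1 {1}pab {1}bc mulrC -!mulrA; congr (_ * _); rewrite mulrC.
Qed.

Lemma rprime_dvd_prime p q : rprime p -> rprime q -> rdiv p q -> exists2 t, runit t & q = p * t.
Proof.
move=> [p0 np _] /rprime_irr[_ _ qi] [t qt]; exists t => //.
by have [/np|] := qi _ _ qt.
Qed.

Lemma ufd_irr_prime p : ufd R -> rirr p -> rprime p.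
Proof.
move=> Ru [p0 np pi]; have [u [s [uu sp pE]]] := Ru p p0.
have [v uv] := uu.
case: s sp pE => [|q [|r s]] sp pE.
- by exfalso; apply: np; rewrite pE big_nil mulr1.
- have [q0 nq qp] : rprime q by apply: sp; rewrite inE.
  rewrite big_seq1 in pE; split=> // a b pab.
  have [|[c ac]|[c bc]] := qp a b; first by apply: rdiv_trans pab; exists u; rewrite mulrC.
    left; exists (c * v); have -> : p * (c * v) = (u * v) * (q * c) by rewrite pE; ring.
    by rewrite -uv mul1r.
  right; exists (c * v); have -> : p * (c * v) = (u * v) * (q * c) by rewrite pE; ring.
  by rewrite -uv mul1r.
exfalso; have [_ nq _] : rprime q by apply: sp; rewrite inE eqxx.
have [_ nr _] : rprime r by apply: sp; rewrite !inE eqxx orbT.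
rewrite !big_cons in pE.
have pE' : p = (u * q) * (r * \prod_(j <- s) j) by rewrite pE !mulrA.
by have [] := pi _ _ pE'; [rewrite mulrC => /runitMl|move/runitMl].
Qed.

Lemma prime_factor_cancel u (s : seq R) p l : runit u -> (forall q, q \in s -> rprime q) ->
  rprime p -> u * \prod_(q <- s) q = p * l -> exists u' s',
  [/\ runit u', (forall q, q \in s' -> rprime q), l = u' * \prod_(q <- s') q & (size s' < size s)%N].
Proof.
move=> uu sp pp e; have [p0 np pP] := pp.
have [|q qs pq] := @rprime_prod _ p s pp.
  have [|//] : rdiv p u \/ rdiv p (\prod_(q <- s) q) by apply: pP; exists l.
  by move=> pu; exfalso; apply: np; exact: rdiv_unit pu uu.
have [t ut qE] := rprime_dvd_prime pp (sp q qs) pq.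
exists (u * t), (rem q s); split.
- exact: runitM.
- by move=> r /mem_rem; exact: sp.
- apply: (mulfI p0); rewrite -e (perm_big _ (perm_to_rem qs)) big_cons qE.
  by rewrite !mulrA; congr (_ * _); rewrite [p * u]mulrC.
- by rewrite size_rem // prednK //; case: (s) qs.
Qed.
End DivisibilityDomain.

(** * Gauss's lemma and factoriality of polynomial rings *)

Section Gauss.
Variable D : idomainType.
Hypothesis Dufd : ufd D.
Implicit Types (f g h : {poly D}) (p c : D).

Lemma rdivC p f : rdiv p%:P f <-> forall i, rdiv p f`_i.
Proof.
split=> [[g ->] i|pf]; first by exists g`_i; rewrite coefCM.
have /choice[c cP] := pf; exists (\poly_(i < size f) c i).
apply/polyP => i; rewrite coefCM coef_poly; case: ltnP => [_|fi]; first exact: cP.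
by rewrite nth_default // mulr0.
Qed.

(** At the least indices i and k where p fails to divide the coefficients of f and g, the
    coefficient i + k of [f * g] is congruent to the product of these two modulo p. *)
Lemma rprimeC p : rprime p -> rprime p%:P.
Proof.
move=> [p0 np pP]; split; first by rewrite polyC_eq0.
  move=> /rdivC/(_ 0%N); rewrite coef1 => pu; exact: np.
move=> f g pfg; apply: contrapT => /not_orP[nf ng].
have first h : ~ rdiv p%:P h -> exists i, ~ rdiv p h`_i /\ forall k, (k < i)%N -> rdiv p h`_k.
  move=> nh; have exi : exists i, `[< ~ rdiv p h`_i >].
    apply: contrapT => nex; apply: nh; apply/rdivC => i; apply: contrapT => ni.
    by apply: nex; exists i; apply/asboolP.
  case: (ex_minnP exi) => i /asboolP ni imin; exists i; split=> // k ki.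
  apply: contrapT => nk; move: ki; rewrite ltnNge => /negP; apply; apply: imin.
  exact/asboolP.
have [i [ni imin]] := first f nf; have [k [nk kmin]] := first g ng.
have := (rdivC p _).1 pfg (i + k)%N; rewrite coefM.
have ilt : (i < (i + k).+1)%N by rewrite ltnS leq_addr.
rewrite (bigD1 (Ordinal ilt)) //= addKn => pS.
have [] : rdiv p f`_i \/ rdiv p g`_k; [|exact: ni|exact: nk].
apply: pP; set S := \sum_(_ < _ | _) _ in pS.
rewrite -[_ * _](addrK S); apply: rdivD => //; apply: rdivN; apply: rdiv_sum => l li.
have [lti|ltk] : (l < i)%N \/ (i + k - l < k)%N.
  have := ltn_ord l; move: li; rewrite -val_eqE /=; lia.
- by apply: rdiv_mulr; exact: imin.
- by apply: rdiv_mull; exact: kmin.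
Qed.

Lemma runitC c : runit c -> runit c%:P.
Proof. by move=> [d e]; exists d%:P; rewrite -polyCM -e. Qed.

(** Each prime factor of c divides [f * r] but not f, so it cancels against r. *)
Lemma const_clear (c : D) f h r : c != 0 -> (forall p, rprime p -> ~ rdiv p%:P f) ->
  c%:P * h = f * r -> rdiv f h.
Proof.
move=> c0 nf; have [u [s [[v uv] sp ->]]] := Dufd c0; elim: s sp r => [|p s IHs] sp r.
  rewrite big_nil mulr1 => e; exists (r * v%:P).
  by rewrite mulrA -e mulrAC -polyCM -uv mul1r.
rewrite big_cons mulrCA polyCM -mulrA => e.
have pp : rprime p by apply: sp; rewrite inE eqxx.
have [p0 _ pP] := rprimeC pp.
have [|/(nf _ pp) //|[r' rE]] := pP f r; first by rewrite -e; exists ((u * \prod_(j <- s) j)%:P * h).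
apply: (IHs _ r') => [q qs|]; first by apply: sp; rewrite inE qs orbT.
by apply: (mulfI p0); rewrite e rE mulrCA.
Qed.

(** Each prime factor of c stays prime as a constant polynomial, so it can be removed from g or from
    h. *)
Lemma const_split (c : D) f g h : c != 0 -> c%:P * f = g * h ->
  exists g' h' a b, [/\ f = g' * h', g = a%:P * g' & h = b%:P * h'].
Proof.
move=> c0; have [u [s [[v uv] sp ->]]] := Dufd c0.
elim: s sp g h => [|p s IHs] sp g h.
  rewrite big_nil mulr1 => e; exists (v%:P * g), h, u, 1; split.
  - by rewrite -mulrA -e mulrA -polyCM mulrC mulrC [v * u]mulrC -uv mul1r.
  - by rewrite mulrA -polyCM -uv mul1r.
  - by rewrite mul1r.
rewrite big_cons mulrCA polyCM -mulrA => e.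
have pp : rprime p by apply: sp; rewrite inE eqxx.
have [p0 _ pP] := rprimeC pp.
have sp' q : q \in s -> rprime q by move=> qs; apply: sp; rewrite inE qs orbT.
have [|[g1 gE]|[h1 hE]] := pP g h; first by rewrite -e; exists ((u * \prod_(j <- s) j)%:P * f).
  have [|g' [h' [a [b [fE g1E hE]]]]] := IHs sp' g1 h.
    by apply: (mulfI p0); rewrite e gE mulrA.
  by exists g', h', (p * a), b; split=> //; rewrite gE g1E polyCM mulrA.
have [|g' [h' [a [b [fE gE h1E]]]]] := IHs sp' g h1.
  by apply: (mulfI p0); rewrite e hE mulrCA.
by exists g', h', a, (p * b); split=> //; rewrite hE h1E polyCM mulrA.
Qed.

Import Pdiv.Idomain.

(* Over the fraction field [f] is irreducible, so either [f] divides [g] up to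
   a constant or it is coprime to [g]; constants are then cleared. *)
Lemma poly_prime f : (1 < size f)%N -> (forall p, rprime p -> ~ rdiv p%:P f) ->
  (forall g h, f = g * h -> (size g <= 1)%N \/ (size h <= 1)%N) -> rprime f.
Proof.
move=> f1 nf fi; have f0 : f != 0 by rewrite -size_poly_gt0; apply: leq_trans f1.
have rdiv_of_dvdp g : f %| g -> rdiv f g.
  move=> /dvdpP[[c q] /= c0 e]; apply: (@const_clear c f g q) => //.
  by rewrite mul_polyC e mulrC.
split=> //.
  move=> [g e]; have := size_mul f0 (_ : g != 0); rewrite -e size_poly1.
  have g0 : g != 0 by apply/eqP => g0; move/eqP: e; rewrite g0 mulr0 oner_eq0.
  move/(_ g0); move: g0; rewrite -size_poly_gt0; move: (size f) (size g) f1 => k l; lia.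
move=> g h [r fgh].
have fdvd : f %| g * h by apply/dvdpP; exists (1, r); rewrite ?oner_neq0 //= scale1r fgh mulrC.
have [cop|ncop] := boolP (coprimep f g).
  by right; apply: rdiv_of_dvdp; rewrite -(Gauss_dvdpr _ cop).
left; apply: rdiv_of_dvdp.
have /dvdpP[[c q] /= c0 e] := dvdp_gcdl f g.
have [|d' [q' [a [b [fE dE qE]]]]] := @const_split c f (gcdp f g) q c0.
  by rewrite mul_polyC e mulrC.
have d0 : gcdp f g != 0 by rewrite gcdp_eq0 negb_and f0.
have a0 : a != 0 by apply: contra_neq d0 => a0; rewrite dE a0 polyC0 mul0r.
have d'1 : (1 < size d')%N.
  have : size (gcdp f g) = size d' by rewrite dE mul_polyC size_scale.
  have : size (gcdp f g) != 1%N by exact: ncop.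
  have : (0 < size (gcdp f g))%N by rewrite size_poly_gt0.
  lia.
have [|q'1] := fi _ _ fE; first by rewrite leqNgt d'1.
have q'0 : q' != 0 by apply: contra_neq f0 => q'0; rewrite fE q'0 mulr0.
have [k q'E] : exists k, q' = k%:P by exists q'`_0; apply: size1_polyC.
have k0 : k != 0 by rewrite q'E polyC_eq0 in q'0.
apply: (@dvdp_trans _ (gcdp f g)); last exact: dvdp_gcdr.
apply/dvdpP; exists (k, a%:P) => //=.
by rewrite dE fE q'E -mul_polyC; ring.
Qed.

(** Splittings into factors of positive degree are handled by induction on the size. Otherwise prime
    constants are extracted, at most as many as the leading coefficient has prime factors; what
    remains is prime by [poly_prime], or a unit. *)
Lemma poly_ufd : ufd {poly D}.
Proof.
move=> f; have [n] := ubnP (size f); elim: n f => // n IHn f /ltnSE fn f0.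
have [[g [h [fE g1 h1]]]|fi] := pselect (exists g h : {poly D}, [/\ f = g * h, (1 < size g)%N & (1 < size h)%N]).
  have g0 : g != 0 by apply: contra_neq f0 => g0; rewrite fE g0 mul0r.
  have h0 : h != 0 by apply: contra_neq f0 => h0; rewrite fE h0 mulr0.
  have sE : size f = (size g + size h).-1 by rewrite fE size_mul.
  have [gn hn] : (size g < n)%N /\ (size h < n)%N.
    by move: sE fn g1 h1; move: (size f) (size g) (size h) => k l m; lia.
  have [u [s [uu sp gE]]] := IHn g gn g0; have [v [t [uv tp hE]]] := IHn h hn h0.
  exists (u * v), (s ++ t); split.
  - exact: runitM.
  - by move=> p; rewrite mem_cat => /orP[/sp|/tp].
  - by rewrite big_cat /= fE gE hE mulrACA.
have lf0 : lead_coef f != 0 by rewrite lead_coef_eq0.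
have [u [s [uu sp lE]]] := Dufd lf0.
have [m] := ubnP (size s); elim: m => // m IHm in f fn f0 fi lf0 u s uu sp lE * => /ltnSE sm.
have [[p [pp [g fE]]]|nf] := pselect (exists p, rprime p /\ rdiv p%:P f).
  have [p0 _ _] := pp.
  have g0 : g != 0 by apply: contra_neq f0 => g0; rewrite fE g0 mulr0.
  have lfE : lead_coef f = p * lead_coef g by rewrite fE lead_coefM lead_coefC.
  have gs : size g = size f by rewrite fE mul_polyC size_scale.
  have [u' [s' [uu' sp' lgE ss]]] := prime_factor_cancel uu sp pp (etrans (esym lE) lfE).
  have [||||v [t [uv tp gE]]] := IHm g _ g0 _ _ u' s' uu' sp' lgE.
  - by rewrite gs.
  - move=> [x [y [gxy x1 y1]]]; apply: fi; exists (p%:P * x), y.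
    by rewrite fE gxy mulrA; split=> //; rewrite mul_polyC size_scale.
  - by rewrite lead_coef_eq0.
  - exact: leq_trans ss sm.
  exists v, (p%:P :: t); split=> //.
    by move=> q; rewrite inE => /predU1P[->|/tp //]; exact: rprimeC.
  by rewrite big_cons fE gE mulrCA.
have nf' p : rprime p -> ~ rdiv p%:P f by move=> pp pf; apply: nf; exists p.
have [f1|f1] := ltnP 1 (size f).
  exists 1, [:: f]; split; first exact: runit1.
    move=> p; rewrite inE => /eqP ->; apply: poly_prime => // g h fE.
    have [//|g1] := leqP (size g) 1; first by left.
    have [//|h1] := leqP (size h) 1; first by right.
    by exfalso; apply: fi; exists g, h.
  by rewrite big_seq1 mul1r.
have [c fc] : exists c, f = c%:P by exists f`_0; exact: size1_polyC.
rewrite fc lead_coefC in lE; case: s sp lE {sm} => [|p s] sp lE.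
  by exists f, [::]; rewrite big_nil mulr1; split=> //; rewrite fc lE big_nil mulr1; exact: runitC.
exfalso; apply: (nf' p); first by apply: sp; rewrite inE eqxx.
by exists (u * \prod_(q <- s) q)%:P; rewrite fc -polyCM lE big_cons mulrCA.
Qed.
End Gauss.

(** * Finitely many variables: towers of polynomial rings *)

Section Tower.
Variable K : fieldType.

Fixpoint tower n : idomainType := if n is n'.+1 then {poly tower n'} else K.

Lemma tower_ufd n : ufd (tower n).
Proof.
elim: n => [|n IHn]; last exact: poly_ufd.
move=> a a0; exists a, [::]; split=> //; last by rewrite big_nil mulr1.
by exists a^-1; rewrite divff.
Qed.

End Tower.

Record is_polyring (K : fieldType) (I : Type) (R : comNzRingType)
    (C : {rmorphism K -> R}) (X : I -> R) : Prop := IsPolyring {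
  polyring_ind : forall P : R -> Prop, (forall c, P (C c)) -> (forall i, P (X i)) ->
    (forall x y, P x -> P y -> P (x + y)) -> (forall x y, P x -> P y -> P (x * y)) ->
    forall x, P x;
  polyring_eval : forall (S : comNzRingType) (f : {rmorphism K -> S}) (v : I -> S),
    exists h : {rmorphism R -> S}, (forall c, h (C c) = f c) /\ forall i, h (X i) = v i }.

Section PolynomialRingDomain.
Variables (K : fieldType) (I : eqType) (R : comNzRingType).
Variables (C : {rmorphism K -> R}) (X : I -> R).
Hypothesis pR : is_polyring C X.

(** The polynomials in the variables of e, defined impredicatively so that membership is an
    induction principle. *)
Definition subalg (e : seq I) (x : R) := forall P : R -> Prop,
  (forall c, P (C c)) -> (forall i, i \in e -> P (X i)) ->
  (forall x y, P x -> P y -> P (x + y)) -> (forall x y, P x -> P y -> P (x * y)) -> P x.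

Lemma subalg_mono (e e' : seq I) x : {subset e <= e'} -> subalg e x -> subalg e' x.
Proof. by move=> ee ex P Pc PX PD PM; apply: ex => // i /ee; exact: PX. Qed.

Lemma subalgD e x y : subalg e x -> subalg e y -> subalg e (x + y).
Proof. by move=> ex ey P Pc PX PD PM; apply: (PD); [exact: ex|exact: ey]. Qed.

Lemma subalgM e x y : subalg e x -> subalg e y -> subalg e (x * y).
Proof. by move=> ex ey P Pc PX PD PM; apply: (PM); [exact: ex|exact: ey]. Qed.

Lemma subalgC e c : subalg e (C c). Proof. by []. Qed.

Lemma subalgX e i : i \in e -> subalg e (X i). Proof. by move=> ie P Pc PX _ _; exact: PX. Qed.

Lemma subalg_ex x : exists2 e, uniq e & subalg e x.
Proof.
elim/(polyring_ind pR): x => [c|i|x y [e ue ex] [f uf fy]|x y [e ue ex] [f uf fy]].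
- by exists [::].
- by exists [:: i] => //; apply: subalgX; rewrite inE.
- exists (undup (e ++ f)); first exact: undup_uniq.
  by apply: subalgD; [apply: subalg_mono ex|apply: subalg_mono fy] => i ie;
    rewrite mem_undup mem_cat ie ?orbT.
exists (undup (e ++ f)); first exact: undup_uniq.
by apply: subalgM; [apply: subalg_mono ex|apply: subalg_mono fy] => i ie;
  rewrite mem_undup mem_cat ie ?orbT.
Qed.

Lemma subalg_all (s : seq R) : exists2 e, uniq e & forall x, x \in s -> subalg e x.
Proof.
elim: s => [|x s [e ue es]]; first by exists [::].
have [f uf fx] := subalg_ex x; exists (undup (e ++ f)); first exact: undup_uniq.
move=> y; rewrite inE => /predU1P[->|/es ey]; [apply: subalg_mono fx|apply: subalg_mono ey];
  by move=> i ie; rewrite mem_undup mem_cat ie ?orbT.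
Qed.

Lemma pconst_inj : injective C. Proof. exact: fmorph_inj. Qed.

Lemma tower_embed (e : seq I) : uniq e -> exists h : {rmorphism tower K (size e) -> R},
  injective h /\ forall x, subalg e x <-> exists y, h y = x.
Proof.
elim: e => [|s e IHe] /=.
  exists C; split; first exact: pconst_inj.
  move=> x; split=> [ex|[y <-]]; last exact: subalgC.
  apply: (ex (fun x => exists y, C y = x)) => [c|//|_ _ [y <-] [z <-]|_ _ [y <-] [z <-]].
  - by exists c.
  - by exists (y + z); rewrite rmorphD.
  - by exists (y * z); rewrite rmorphM.
move=> /andP[se /IHe[h [hI hE]]].
have hX : commr_rmorph h (X s) by move=> x; exact: mulrC.
have [H [HC HX]] : exists H : {rmorphism {poly tower K (size e)} -> R},
    (forall c, H c%:P = h c) /\ H 'X = X s.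
  by exists (horner_morph hX); split=> [c|]; [exact: horner_morphC|exact: horner_morphX].
(* The substitution d separates the variable s from the others: [d \o H] is h applied to the
   coefficients, so H is injective. *)
have [d [dC dX]] := @polyring_eval _ _ _ _ _ pR {poly R} (polyC \o C)
  (fun i => if i == s then 'X else (X i)%:P).
have de x : subalg e x -> d x = x%:P.
  move=> ex; apply: (ex (fun x => d x = x%:P)) => [c|i ie|y z|y z].
  - exact: dC.
  - by rewrite dX; have [ie'|//] := eqVneq i s; case/negP: se; rewrite -ie'.
  - by rewrite rmorphD => -> ->; rewrite polyCD.
  - by rewrite rmorphM => -> ->; rewrite polyCM.
have dH : d \o H =1 map_poly h.
  move=> p; rewrite /=; elim/poly_ind: p => [|p c IHp]; first by rewrite !rmorph0.
  rewrite !(rmorphD, rmorphM) /= IHp HC HX dX eqxx map_polyX map_polyC /=.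
  by rewrite de //; apply/hE; exists c.
exists H; split=> [p q /(congr1 d)|x].
  by rewrite -![d (H _)]/((d \o H) _) !dH; exact: map_inj_poly hI (rmorph0 h) p q.
split=> [ex|[p <-]]; last first.
  elim/poly_ind: p => [|p c IHp]; first by rewrite rmorph0 -(rmorph0 C); exact: subalgC.
  rewrite rmorphD rmorphM /= HC HX; apply: subalgD.
    by apply: subalgM => //; apply: subalgX; rewrite inE eqxx.
  have : subalg e (h c) by apply/hE; exists c.
  by apply: subalg_mono => i ie; rewrite inE ie orbT.
apply: (ex (fun x => exists y, H y = x)) => [c|i|_ _ [y <-] [z <-]|_ _ [y <-] [z <-]].
- have /hE[y yE] : subalg e (C c) by exact: subalgC.
  by exists y%:P; rewrite HC.
- rewrite inE => /predU1P[->|ie]; first by exists 'X.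
  have /hE[y yE] := subalgX ie.
  by exists y%:P; rewrite HC.
- by exists (y + z); rewrite rmorphD.
- by exists (y * z); rewrite rmorphM.
Qed.

Lemma polyring_mul_eq0 (x y : R) : x * y = 0 -> x = 0 \/ y = 0.
Proof.
move=> xy; have [e ue es] := subalg_all [:: x; y].
have [h [hI hE]] := tower_embed ue.
have /hE[a ax] : subalg e x by apply: es; rewrite inE eqxx.
have /hE[b bx] : subalg e y by apply: es; rewrite !inE eqxx orbT.
have /eqP : a * b = 0 by apply: hI; rewrite rmorphM ax bx rmorph0.
by rewrite mulf_eq0 => /orP[/eqP a0|/eqP b0]; [left|right]; rewrite -?ax -?bx ?a0 ?b0 rmorph0.
Qed.

End PolynomialRingDomain.

Section PolynomialRingInstance.
Variables (K : fieldType) (I : choiceType).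
Local Notation R := (polyring K I).

Lemma polyringP : is_polyring (pconst K I) (@pvar K I).
Proof. by split; [exact: mpolyring_ind|exact: mpolyring_eval]. Qed.

Lemma polyring_inv_ex (x : R) : exists y, if `[<runit x>] then x * y = 1 else y = x.
Proof. by case: asboolP => [[y ->]|_]; [exists y|exists x]. Qed.

Definition polyring_unit : pred R := fun x => `[<runit x>].
Definition polyring_inv (x : R) : R := projT1 (cid (polyring_inv_ex x)).

Fact polyring_invP x : if `[<runit x>] then x * polyring_inv x = 1 else polyring_inv x = x.
Proof. exact: projT2 (cid (polyring_inv_ex x)). Qed.

Fact polyring_mulVr : {in polyring_unit, left_inverse 1 polyring_inv *%R}.
Proof.
move=> x xu; have := polyring_invP x; rewrite (xu : `[<runit x>] = true).
by move=> <-; exact: mulrC.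
Qed.

Fact polyring_unitP (x y : R) : y * x = 1 -> polyring_unit x.
Proof. by move=> yx; apply/asboolP; exists y; rewrite -yx; exact: mulrC. Qed.

Fact polyring_inv_out : {in [predC polyring_unit], polyring_inv =1 id}.
Proof.
move=> x xu; have := polyring_invP x.
by rewrite (negbTE (xu : ~~ `[<runit x>])).
Qed.

HB.instance Definition _ := GRing.ComNzRing_hasMulInverse.Build R
  polyring_mulVr polyring_unitP polyring_inv_out.

Fact polyring_integral (x y : R) : x * y = 0 -> (x == 0) || (y == 0).
Proof. by move=> /(polyring_mul_eq0 polyringP)[->|->]; rewrite eqxx ?orbT. Qed.

HB.instance Definition _ := GRing.ComUnitRing_isIntegral.Build R polyring_integral.

End PolynomialRingInstance.

Lemma polyring_exists (K : fieldType) (I : choiceType) : exists (R : idomainType)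
  (C : {rmorphism K -> R}) (X : I -> R), is_polyring C X.
Proof. by exists (polyring K I), (pconst K I), (@pvar K I); exact: polyringP. Qed.

(** * Weighted degrees and factoriality *)

Section PolynomialRingUfd.
Variables (K : fieldType) (I : eqType) (R : idomainType).
Variables (C : {rmorphism K -> R}) (X : I -> R).
Hypothesis pR : is_polyring C X.
Local Notation subalg := (subalg C X).

(* [wt w f] is [f] with ['X_i] replaced by ['X_i 'X^(w i)]: it records the
   [w]-weighted homogeneous components of [f]. *)
Fact wt_ex (w : I -> nat) : exists h : {rmorphism R -> {poly R}},
  (forall c, h (C c) = (C c)%:P) /\ forall i, h (X i) = X i *: 'X^(w i).
Proof. exact: (@polyring_eval _ _ _ _ _ pR {poly R} (polyC \o C) (fun i => X i *: 'X^(w i))). Qed.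

Definition wt w : {rmorphism R -> {poly R}} := projT1 (cid (wt_ex w)).

Lemma wtC w c : wt w (C c) = (C c)%:P.
Proof. by rewrite /wt; case: cid => h []. Qed.

Lemma wtX w i : wt w (X i) = X i *: 'X^(w i).
Proof. by rewrite /wt; case: cid => h []. Qed.

Lemma wt1 w x : (wt w x).[1] = x.
Proof.
elim/(polyring_ind pR): x => [c|i|x y xE yE|x y xE yE].
- by rewrite wtC hornerC.
- by rewrite wtX hornerZ hornerXn expr1n mulr1.
- by rewrite rmorphD hornerD xE yE.
- by rewrite rmorphM hornerM xE yE.
Qed.

Lemma wt_inj w : injective (wt w).
Proof. by move=> x y xy; rewrite -(wt1 w x) xy wt1. Qed.

Lemma wt_size_gt0 w x : x != 0 -> (0 < size (wt w x))%N.
Proof. by move=> x0; rewrite size_poly_gt0 -(rmorph0 (wt w)) (inj_eq (@wt_inj w)). Qed.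

Definition wdeg w (x : R) := (size (wt w x)).-1.

Lemma wdegM w x y : x != 0 -> y != 0 -> wdeg w (x * y) = (wdeg w x + wdeg w y)%N.
Proof.
move=> x0 y0; rewrite /wdeg rmorphM size_mul -?size_poly_gt0 ?wt_size_gt0 //.
have := wt_size_gt0 w x0; have := wt_size_gt0 w y0.
by move: (size _) (size _) => k l; lia.
Qed.

Lemma wdeg0 w x : wdeg w x = 0%N -> wt w x = x%:P.
Proof.
move=> x0; have /size1_polyC xc : (size (wt w x) <= 1)%N.
  by move: x0; rewrite /wdeg; case: size => [|[]].
by rewrite -[in RHS](wt1 w x) xc hornerC.
Qed.

Lemma wdegC w c : wdeg w (C c) = 0%N.
Proof. by rewrite /wdeg wtC size_polyC; case: eqP. Qed.

Lemma wdegX w i : wdeg w (X i) = w i.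
Proof.
rewrite /wdeg wtX size_scale ?size_polyXn //; apply/eqP => Xi0.
have [h [_ /(_ i)]] := @polyring_eval _ _ _ _ _ pR K idfun (fun=> 1).
by rewrite Xi0 rmorph0 => /eqP; rewrite eq_sym oner_eq0.
Qed.

(** For positive weights, setting the extra variable of [wt w x] to 0 leaves the constant term. *)
Lemma wdeg_const w x : (forall i, 0 < w i)%N -> wdeg w x = 0%N -> exists c, x = C c.
Proof.
move=> w0 /wdeg0 xE.
suff: exists c, (wt w x).[0] = C c by rewrite xE hornerC.
elim/(polyring_ind pR): x {xE} => [c|i|x y [c cE] [d dE]|x y [c cE] [d dE]].
- by exists c; rewrite wtC hornerC.
- by exists 0; rewrite wtX hornerZ hornerXn expr0n eqn0Ngt w0 mulr0 rmorph0.
- by exists (c + d); rewrite !rmorphD hornerD cE dE.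
- by exists (c * d); rewrite !rmorphM hornerM cE dE.
Qed.

Lemma runit_neq0 (x : R) : runit x -> x != 0.
Proof. by move=> [y e]; apply/eqP => x0; move: e; rewrite x0 mul0r => /eqP; rewrite oner_eq0. Qed.

Lemma runit_wdeg w x : runit x -> wdeg w x = 0%N.
Proof.
move=> ux; have x0 := runit_neq0 ux; have [y xy] := ux.
have y0 : y != 0 by apply: runit_neq0; exists x; rewrite mulrC.
have := wdegM w x0 y0; rewrite -xy -(rmorph1 C) wdegC.
by move=> /esym/eqP; rewrite addn_eq0 => /andP[/eqP].
Qed.

Definition tdeg := wdeg (fun=> 1%N).

Lemma runitP x : x != 0 -> runit x <-> tdeg x = 0%N.
Proof.
move=> x0; split=> [ux|/(@wdeg_const (fun=> 1%N))[//|c xE]]; first exact: runit_wdeg.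
have c0 : c != 0 by apply: contra_neq x0 => c0; rewrite xE c0 rmorph0.
by exists (C c^-1); rewrite xE -rmorphM divff // rmorph1.
Qed.

(** The subalgebra of e is a tower, hence factorial. An irreducible p of R stays irreducible there,
    as the units of R are constants and so lie in the subalgebra. *)
Lemma subalg_irr_prime e (p : R) : uniq e -> subalg e p -> rirr p ->
  forall a b c, subalg e a -> subalg e b -> subalg e c ->
  a * b = p * c -> rdiv p a \/ rdiv p b.
Proof.
move=> ue ep [p0 np pi] a b c ea eb ec.
have [h [hI hE]] := tower_embed pR ue.
have hu x : runit x <-> runit (h x).
  split=> [[y xy]|]; first by exists (h y); rewrite -rmorphM -xy rmorph1.
  move=> ux; have x0 := runit_neq0 ux; have [d hd] := ux.
  have d0 : d != 0 by apply: runit_neq0; exists (h x); rewrite mulrC.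
  have ud : runit d by exists (h x); rewrite mulrC.
  have [//|k dk] := @wdeg_const (fun=> 1%N) d _ (runit_wdeg _ ud).
  have /hE[z zd] : subalg e d by rewrite dk; exact: subalgC.
  by exists z; apply: hI; rewrite rmorph1 rmorphM zd.
have /hE[p' pE] := ep; have /hE[a' <-] := ea; have /hE[b' <-] := eb; have /hE[c' <-] := ec.
rewrite -pE -!rmorphM => /hI pc.
have hdiv x : rdiv p' x -> rdiv (h p') (h x) by move=> [y ->]; exists (h y); rewrite rmorphM.
have [|_ _ pP] := @ufd_irr_prime _ p' (@tower_ufd K _).
  split.
  - by apply/eqP => p'0; case/eqP: p0; rewrite -pE p'0 rmorph0.
  - by move=> /hu; rewrite pE.
  - move=> x y pxy; have := pi (h x) (h y); rewrite -pE pxy rmorphM => /(_ erefl).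
    by case=> /hu; [left|right].
by have [||] := pP a' b'; [exists c'|move=> /hdiv; left|move=> /hdiv; right].
Qed.

Lemma polyring_irr_prime (p : R) : rirr p -> rprime p.
Proof.
move=> pirr; have [p0 np _] := pirr; split=> // a b [c pc].
have [e ue es] := subalg_all pR [:: p; a; b; c].
by apply: subalg_irr_prime ue _ pirr _ _ _ _ _ _ pc; apply: es; rewrite !inE eqxx ?orbT.
Qed.

Lemma polyring_ufd : ufd R.
Proof.
move=> a; have [n] := ubnP (tdeg a); elim: n a => // n IHn a an a0.
have [ua|nua] := pselect (runit a).
  by exists a, [::]; split=> //; rewrite big_nil mulr1.
have [ia|nia] := pselect (rirr a).
  exists 1, [:: a]; split; [exact: runit1| |by rewrite big_seq1 mul1r].
  by move=> p; rewrite inE => /eqP ->; exact: polyring_irr_prime.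
have [x [y [aE nx ny]]] : exists x y, [/\ a = x * y, ~ runit x & ~ runit y].
  apply: contrapT => nex; apply: nia; split=> // x y aE.
  by apply: contrapT => nu; apply: nex; exists x, y; split=> // u; apply: nu; [left|right].
have [x0 y0] : x != 0 /\ y != 0 by move: a0; rewrite aE mulf_eq0 negb_or => /andP.
have := wdegM (fun=> 1%N) x0 y0; rewrite -aE -![wdeg _ _]/(tdeg _) => dE.
have tx : tdeg x != 0%N by apply/eqP => /(runitP x0).
have ty : tdeg y != 0%N by apply/eqP => /(runitP y0).
have [|u [s [uu sp xE]]] := IHn x _ x0; first by lia.
have [|v [t [uv tp yE]]] := IHn y _ y0; first by lia.
exists (u * v), (s ++ t); split; first exact: runitM.
  by move=> p; rewrite mem_cat => /orP[]; [exact: sp|exact: tp].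
by rewrite aE xE yE big_cat mulrACA.
Qed.
End PolynomialRingUfd.

(** * Prime elements: variables, and combinations with new variables *)

Section PolynomialRingPrimes.
Variables (K : fieldType) (I : eqType) (R : idomainType).
Variables (C : {rmorphism K -> R}) (X : I -> R).
Hypothesis pR : is_polyring C X.
Local Notation subalg := (subalg C X).
Local Notation wt := (wt pR).
Local Notation wdeg := (wdeg pR).
Local Notation tdeg := (tdeg pR).

Lemma rdiv_neq0 (a b : R) : rdiv a b -> b != 0 -> a != 0.
Proof. by move=> [c ->]; apply: contra_neq => ->; rewrite mul0r. Qed.

Lemma X_neq0 i : X i != 0.
Proof.
rewrite -(inj_eq (@wt_inj _ _ _ _ _ pR (fun=> 1%N))) rmorph0 -size_poly_gt0.
by have := wdegX pR (fun=> 1%N) i; rewrite /wdeg; case: size.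
Qed.

Lemma tdegX i : tdeg (X i) = 1%N. Proof. exact: wdegX. Qed.

Lemma X_prime i : rprime (X i).
Proof.
apply: (polyring_irr_prime pR); split; first exact: X_neq0.
  by move=> /(runitP pR (X_neq0 i)); rewrite tdegX.
move=> a b e; have [a0 b0] : a != 0 /\ b != 0.
  by have := X_neq0 i; rewrite e mulf_eq0 negb_or => /andP.
have := tdegX i; rewrite e [tdeg _](wdegM pR) // -![wdeg _ _]/(tdeg _) => t1.
have /orP[/eqP ta|/eqP tb] : (tdeg a == 0%N) || (tdeg b == 0%N) by move: t1; lia.
  by left; apply/(runitP pR).
by right; apply/(runitP pR).
Qed.

Lemma tdeg_nonunit (p : R) : p != 0 -> ~ runit p -> (0 < tdeg p)%N.
Proof. by move=> p0 np; rewrite lt0n; apply/eqP => /(runitP pR p0). Qed.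

Lemma tdegM (a b : R) : a != 0 -> b != 0 -> tdeg (a * b) = (tdeg a + tdeg b)%N.
Proof. exact: wdegM. Qed.

Lemma tdeg_ltn (p f : R) : rprime p -> f != 0 -> (tdeg f < tdeg (p * f))%N.
Proof. by move=> [p0 np _] f0; rewrite tdegM // -addn1 addnC leq_add2r tdeg_nonunit. Qed.

Lemma prime_divisor (f : R) : f != 0 -> ~ runit f -> exists2 p, rprime p & rdiv p f.
Proof.
move=> f0 nf; have [u [s [uu sp fE]]] := polyring_ufd pR f0.
case: s sp fE => [|p s] sp fE; first by case: nf; rewrite fE big_nil mulr1.
exists p; first by apply: sp; rewrite inE eqxx.
by rewrite fE big_cons; apply/rdiv_mull/rdiv_mulr/rdiv_refl.
Qed.

Lemma rdiv_wdeg w (f g : R) : rdiv f g -> g != 0 -> (wdeg w f <= wdeg w g)%N.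
Proof.
move=> [h ->]; rewrite mulf_eq0 negb_or => /andP[f0 h0].
by rewrite (wdegM pR) // leq_addr.
Qed.

Lemma gcd_split (f g : R) : f != 0 -> g != 0 -> exists h f1 g1,
  [/\ f = h * f1, g = h * g1 & forall p, rprime p -> rdiv p f1 -> ~ rdiv p g1].
Proof.
have [n] := ubnP (tdeg f); elim: n f g => // n IHn f g fn f0 g0.
have [[p [pp [f' fE] [g' gE]]]|nex] := pselect (exists p, [/\ rprime p, rdiv p f & rdiv p g]); last first.
  by exists 1, f, g; rewrite !mul1r; split=> // p pp pf pg; apply: nex; exists p.
have [f'0 g'0] : f' != 0 /\ g' != 0.
  by split; [move: f0; rewrite fE|move: g0; rewrite gE]; rewrite mulf_eq0 negb_or => /andP[].
have [|h [f1 [g1 [f'E g'E cop]]]] := IHn f' g' _ f'0 g'0.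
  by move: fn (tdeg_ltn pp f'0); rewrite -fE; lia.
by exists (p * h), f1, g1; rewrite fE gE f'E g'E !mulrA.
Qed.

Definition var_wt (i j : I) : nat := (i == j).
Local Notation vdeg i := (wdeg (var_wt i)).

Lemma vdegX i j : vdeg i (X j) = (i == j). Proof. exact: wdegX. Qed.

Lemma wt_subalg e i f : subalg e f -> i \notin e -> wt (var_wt i) f = f%:P.
Proof.
move=> ef ie; apply: (ef (fun f => wt (var_wt i) f = f%:P)) => [c|j je|x y|x y].
- exact: wtC.
- rewrite wtX /var_wt; have [ij|_] := eqVneq i j; first by rewrite ij je in ie.
  by rewrite -mul_polyC mulr1.
- by rewrite rmorphD => -> ->; rewrite polyCD.
- by rewrite rmorphM => -> ->; rewrite polyCM.
Qed.

Lemma vdeg_subalg e i f : subalg e f -> i \notin e -> vdeg i f = 0%N.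
Proof. by move=> ef ie; rewrite /wdeg (wt_subalg ef ie) size_polyC; case: eqP. Qed.

(** A polynomial of degree 0 in [X s] is unchanged when [X s] is set to 0, so its variables can be
    removed one at a time. *)
Lemma vdeg0_const f : (forall i, vdeg i f = 0%N) -> exists c, f = C c.
Proof.
move=> f0; have [e _ ef] := subalg_ex pR f.
have sub_nil : subalg [::] f.
  elim: e ef => // s e IHe ef; apply: IHe.
  rewrite -[f](_ : (wt (var_wt s) f).[0] = f); last by rewrite (wdeg0 (f0 s)) hornerC.
  apply: (ef (fun f => subalg e (wt (var_wt s) f).[0])) => [c|i|x y xe ye|x y xe ye].
  - by rewrite wtC hornerC; exact: subalgC.
  - rewrite wtX hornerZ hornerXn /var_wt inE eq_sym; have [_ _|_ /= ie] := eqVneq s i.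
      by rewrite expr0n mulr0 -(rmorph0 C); exact: subalgC.
    by rewrite expr0 mulr1; exact: subalgX.
  - by rewrite rmorphD hornerD; exact: subalgD.
  - by rewrite rmorphM hornerM; exact: subalgM.
apply: (sub_nil (fun f => exists c, f = C c)) => [c|//|_ _ [c ->] [d ->]|_ _ [c ->] [d ->]].
- by exists c.
- by exists (c + d); rewrite rmorphD.
- by exists (c * d); rewrite rmorphM.
Qed.

Section LinearPrime.
Variables (f g : R) (y z : I).
Hypotheses (f0 : f != 0) (g0 : g != 0).
Hypothesis cop : forall p, rprime p -> rdiv p f -> ~ rdiv p g.
Hypotheses (fy : vdeg y f = 0%N) (gy : vdeg y g = 0%N) 
  (fz : vdeg z f = 0%N).
Hypothesis yz : y != z.

Lemma wt_linear : wt (var_wt y) (f * X y + g * X z) = (f * X y)%:P * 'X + (g * X z)%:P.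
Proof.
rewrite rmorphD !rmorphM /= !wtX /var_wt eqxx (negbTE yz) (wdeg0 fy) (wdeg0 gy).
by rewrite expr0 expr1 -!mul_polyC mulrA mulr1.
Qed.

Lemma vdeg_linear : vdeg y (f * X y + g * X z) = 1%N.
Proof.
rewrite /wdeg wt_linear size_MXaddC.
have fX : f * X y != 0 by rewrite mulf_neq0 ?X_neq0.
by rewrite polyC_eq0 (negbTE fX) /= size_polyC fX.
Qed.

Lemma linear_neq0 : f * X y + g * X z != 0.
Proof. by apply/eqP => e; have := vdeg_linear; rewrite e /wdeg rmorph0 size_poly0. Qed.

(** A divisor of degree 0 in y divides both [f * X y] and [g * X z]. A prime factor of it is not
    [X y], so it divides f, hence not g, hence is [X z] up to a unit, which does not divide f. *)
Lemma linear_unit a : rdiv a (f * X y + g * X z) -> vdeg y a = 0%N -> runit a.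
Proof.
move=> aq ay; have a0 := rdiv_neq0 aq linear_neq0.
have [b qE] := aq.
have /rdivC ad : rdiv a%:P (wt (var_wt y) (f * X y + g * X z)).
  by exists (wt (var_wt y) b); rewrite qE rmorphM (wdeg0 ay).
apply: contrapT => nu; have [p pp pa] := prime_divisor a0 nu.
have py : ~ rdiv p (X y).
  move=> /(rprime_dvd_prime pp (X_prime y))[t ut XE].
  have : (vdeg y (X y) <= vdeg y a)%N.
    apply: rdiv_wdeg a0; have [u tu] := ut; apply: rdiv_trans pa.
    by exists u; rewrite XE -mulrA -tu mulr1.
  by rewrite ay vdegX eqxx.
have [_ _ pP] := pp.
have pf : rdiv p f.
  have [|//|/py //] := pP f (X y); have := rdiv_trans pa (ad 1%N).
  by rewrite wt_linear coefD coefMX !coefC /= addr0.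
have [||/(rprime_dvd_prime pp (X_prime z))[t ut XE]] := pP g (X z).
- by have := rdiv_trans pa (ad 0%N); rewrite wt_linear coefD coefMX !coefC /= add0r.
- exact: cop pf.
have : (vdeg z (X z) <= vdeg z f)%N.
  apply: rdiv_wdeg f0; have [u tu] := ut; apply: rdiv_trans pf.
  by exists u; rewrite XE -mulrA -tu mulr1.
by rewrite fz vdegX eqxx.
Qed.

Lemma linear_prime : rprime (f * X y + g * X z).
Proof.
have q0 := linear_neq0; apply: (polyring_irr_prime pR); split=> //.
  by move=> /(runit_wdeg pR (var_wt y)); rewrite vdeg_linear.
move=> a b qE; have [a0 b0] : a != 0 /\ b != 0.
  by move: q0; rewrite qE mulf_eq0 negb_or => /andP.
have := vdeg_linear; rewrite {1}qE (wdegM pR) // => d1.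
have /orP[/eqP ay|/eqP bz] : (vdeg y a == 0%N) || (vdeg y b == 0%N) by move: d1; lia.
  by left; apply: linear_unit ay; exists b.
by right; apply: linear_unit bz; exists a; rewrite [RHS]mulrC.
Qed.
End LinearPrime.

(** The combination has degree 1 in both y and z, whereas a variable has positive degree in one
    variable only. *)
Lemma linear_not_var f g y z i : f != 0 -> g != 0 -> vdeg y f = 0%N -> vdeg y g = 0%N ->
  vdeg z f = 0%N -> vdeg z g = 0%N -> y != z ->
  (forall p, rprime p -> rdiv p f -> ~ rdiv p g) ->
  ~ rdiv (f * X y + g * X z) (X i).
Proof.
move=> f0 g0 fy gy fz gz yz cop /rdiv_wdeg qi.
have := qi (var_wt y) (X_neq0 i); rewrite vdeg_linear // vdegX; case: eqP => // yi _.
have zy : z != y by rewrite eq_sym.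
have cop' p : rprime p -> rdiv p g -> ~ rdiv p f by move=> pp pg pf; exact: cop pg.
have := qi (var_wt z) (X_neq0 i); rewrite vdegX addrC vdeg_linear //.
by rewrite -yi (negbTE zy).
Qed.
End PolynomialRingPrimes.

(** * The graded localization of the polynomial ring *)

Section GradedPolynomials.
Variables (G : zmodType) (A : eqType) (a0 : A).
(* The variable [(l, k, n)] has degree [list_deg l]; [k] makes room for many
   primes of a given degree and [n] for the shift. *)
Local Notation var := ((seq G * A) * int)%type.
Variables (K : fieldType) (R : idomainType) (C : {rmorphism K -> R}) (X : var -> R).
Hypothesis pR : is_polyring C X.
Local Notation D := (fabgroup G).
Local Notation wt := (wt pR).
Local Notation wdeg := (wdeg pR).
Local Notation tdeg := (tdeg pR).
Local Notation vdeg i := (wdeg (var_wt i)).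

Definition list_deg (l : seq G) : D := \sum_(g <- l) fgen g.
Definition var_deg (s : var) : D := list_deg s.1.1.

Lemma mcoeff_list_deg g l : mcoeff g (list_deg l) = (count_mem g l)%:Z.
Proof.
rewrite /list_deg; elim: l => [|h l IHl]; first by rewrite big_nil mcoeff0.
by rewrite big_cons mcoeffD mcoeff_gen IHl /= PoszD; case: (h == g).
Qed.

Lemma list_with_counts (a : D) (k : G -> nat) :
  (forall g, k g <= absz (mcoeff g a)%R)%N -> exists l, forall g, count_mem g l = k g.
Proof.
move=> ka; exists (flatten [seq nseq (k h) h | h <- msupp a]) => g.
rewrite count_flatten -map_comp sumnE big_map.
rewrite (eq_bigr (fun h => (h == g) * k h)%N) => [|h _]; last by rewrite /= count_nseq.
have [ga|ga] := boolP (g \in msupp a).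
  rewrite (bigD1_seq g) ?fset_uniq //= eqxx mul1n big1 ?addn0 // => h /negbTE ->.
  by rewrite mul0n.
have := ka g; rewrite (mcoeff_outdom ga) leqn0 => /eqP kg; rewrite big1 // => h _.
by have [->|_] := eqVneq h g; rewrite ?kg ?mul0n ?muln0.
Qed.

(** The coefficient of a at g is the degree for the weight counting g in the list of a variable.
    Zero is homogeneous of every degree. *)
Definition homog (a : D) (f : R) := f != 0 -> forall g,
  0 <= mcoeff g a /\ wt (fun s => count_mem g s.1.1) f = f *: 'X^(absz (mcoeff g a)%R).

Lemma homog0 a : homog a 0. Proof. by rewrite /homog eqxx. Qed.

Lemma homogB a f g : homog a f -> homog a g -> homog a (f - g).
Proof.
move=> hf hg; have [->|f0] := eqVneq f 0.
  rewrite sub0r => g0 x; have [|g1 g2] := hg _ x; first by rewrite -oppr_eq0.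
  by rewrite rmorphN g2 scaleNr.
have [->|g0] := eqVneq g 0; first by rewrite subr0.
move=> _ x; have [f1 f2] := hf f0 x; have [_ g2] := hg g0 x.
by rewrite rmorphB f2 g2 scalerBl.
Qed.

Lemma homogM a b f g : homog a f -> homog b g -> homog (a + b) (f * g).
Proof.
move=> hf hg; rewrite /homog mulf_eq0 negb_or => /andP[f0 g0] x.
have [f1 f2] := hf f0 x; have [g1 g2] := hg g0 x; split; first by rewrite mcoeffD addr_ge0.
rewrite rmorphM /= f2 g2 mcoeffD; have -> : absz (mcoeff x a + mcoeff x b)%R =
  (absz (mcoeff x a)%R + absz (mcoeff x b)%R)%N by move: f1 g1; lia.
by rewrite exprD -!mul_polyC polyCM mulrACA.
Qed.

Lemma homogC c : homog 0 (C c).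
Proof. by move=> _ g; rewrite mcoeff0 wtC expr0 -mul_polyC mulr1. Qed.

Lemma homogX s : homog (var_deg s) (X s).
Proof. by move=> _ g; rewrite mcoeff_list_deg wtX. Qed.

Lemma homogD a f g : homog a f -> homog a g -> homog a (f + g).
Proof.
move=> hf hg; rewrite -[g]opprK; apply: homogB => //.
by rewrite -sub0r; apply: homogB => //; exact: homog0.
Qed.

Lemma homog_uniq a b f : f != 0 -> homog a f -> homog b f -> a = b.
Proof.
move=> f0 ha hb; apply: fabgroup_ext => g; have [a1 a2] := ha f0 g; have [b1 b2] := hb f0 g.
have /(congr1 (fun p : {poly R} => size p)) : f *: 'X^(absz (mcoeff g a)%R) = f *: 'X^(absz (mcoeff g b)%R).
  by rewrite -a2.
by rewrite !size_scale // !size_polyXn => -[]; move: a1 b1; lia.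
Qed.

Lemma poly_X_split (p : {poly R}) : p != 0 -> exists n q, p = q * 'X^n /\ q.[0] != 0.
Proof.
have [m] := ubnP (size p); elim: m p => // m IHm p pm p0.
have [pr|pr] := boolP (root p 0); last by exists 0%N, p; rewrite expr0 mulr1.
have [q pE] := factor_theorem p 0 pr; rewrite subr0 in pE.
have q0 : q != 0 by apply: contra_neq p0 => q0; rewrite pE q0 mul0r.
have [|n [r [qE r0]]] := IHm q _ q0; first by move: pm; rewrite pE size_mulX // ltnS.
by exists n.+1, r; rewrite pE qE exprSr mulrA.
Qed.

Lemma monomial_div (p q : {poly R}) c n : c != 0 -> p * q = c *: 'X^n ->
  exists2 k, (k <= n)%N & p = p.[1] *: 'X^k.
Proof.
move=> c0 pq; have : p * q != 0 by rewrite pq -mul_polyC mulf_neq0 ?polyC_eq0 ?monic_neq0 ?monicXn.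
rewrite mulf_eq0 negb_or => /andP[/poly_X_split[i [p' [pE p'0]]] /poly_X_split[j [q' [qE q'0]]]].
have e : (p' * q') * 'X^(i + j) = c *: 'X^n by rewrite -pq pE qE exprD mulrACA.
have ijn : (i + j = n)%N.
  have := congr1 (fun r : {poly R} => r`_(i + j)) e.
  rewrite coefMXn ltnn subnn coefZ coefXn -horner_coef0 hornerM.
  case: eqP => // _ /eqP; rewrite mulr0 mulf_eq0 (negbTE p'0) (negbTE q'0) //.
have {}e : p' * q' = c%:P.
  by apply: (mulIf (monic_neq0 (monicXn R n))); rewrite mul_polyC -e ijn.
have [p'n q'n] : p' != 0 /\ q' != 0.
  by split; apply/eqP => z; [move: p'0|move: q'0]; rewrite z horner0 eqxx.
have /size1_polyC p'C : (size p' <= 1)%N.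
  have := congr1 (fun r : {poly R} => size r) e; rewrite size_mul // size_polyC c0.
  move: (p'n) (q'n); rewrite -!size_poly_gt0; move: (size p') (size q') => k l; lia.
exists i; first by rewrite -ijn leq_addr.
by rewrite pE p'C hornerM hornerC hornerXn expr1n mulr1 mul_polyC.
Qed.

(** By [monomial_div], g is homogeneous for each of the weights. The degrees found are bounded by
    those of f, so only finitely many are nonzero and they come from a list. *)
Lemma homog_divl a f g h : f != 0 -> homog a f -> f = g * h -> exists b, homog b g.
Proof.
move=> f0 hf fE; have hfg x := hf f0 x.
have /choice[k kP] : forall x, exists k, (k <= absz (mcoeff x a)%R)%N /\
    wt (fun s => count_mem x s.1.1) g = g *: 'X^k.
  move=> x; have [_] := hfg x; rewrite [X in wt _ X]fE rmorphM => /(monomial_div f0)[k kn].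
  by rewrite wt1 => gE; exists k.
have [l lk] := list_with_counts (fun x => (kP x).1).
exists (list_deg l) => _ x; rewrite mcoeff_list_deg lk; split=> //=.
by have [_ ->] := kP x.
Qed.

Lemma homog_div a f g h : f != 0 -> homog a f -> f = g * h -> exists b c,
  [/\ homog b g, homog c h & a = b + c].
Proof.
move=> f0 hf fE; have [b hb] := homog_divl f0 hf fE.
have [c hc] : exists c, homog c h by apply: homog_divl f0 hf _; rewrite mulrC; exact: fE.
exists b, c; split=> //; apply: homog_uniq f0 hf _; rewrite fE; exact: homogM.
Qed.

Lemma homog_list a f : f != 0 -> homog a f -> exists l, a = list_deg l.
Proof.
move=> f0 hf; have [l lE] := @list_with_counts a (fun g => absz (mcoeff g a)%R) (fun=> leqnn _).
exists l; apply: fabgroup_ext => g; rewrite mcoeff_list_deg lE.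
by have [] := hf f0 g; lia.
Qed.

Lemma homog_unit a u : runit u -> homog a u -> a = 0.
Proof.
move=> uu hu; have u0 := runit_neq0 uu.
have [c uE] := @wdeg_const _ _ _ _ _ pR (fun=> 1%N) u (fun=> erefl) (runit_wdeg pR _ uu).
by apply: homog_uniq u0 hu _; rewrite uE; exact: homogC.
Qed.

(** The integer component supplies infinitely many variables for each list. *)
Lemma fresh_var (l : seq G) (e : seq var) : exists2 y, y.1.1 = l & y \notin e.
Proof.
have [n nP] : exists n : nat, forall y, y \in e -> y.2 < n%:Z.
  elim: e => [|s e [n nP]]; first by exists 0%N.
  exists (n + (absz s.2).+1)%N => y; rewrite inE => /predU1P[->|/nP]; [move: s.2|move: y.2] => k; lia.
by exists (l, a0, n%:Z) => //; apply/negP => /nP; rewrite ltxx.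
Qed.

Definition inv_prime (p : R) :=
  [/\ rprime p, exists2 a, homog a p & fsum a = 0 & forall i, ~ rdiv p (X i)].
(** The saturated multiplicative set generated by the inverted primes. *)
Definition denom (s : R) := s != 0 /\ forall p, rprime p -> rdiv p s -> inv_prime p.

Lemma denom_unit s : runit s -> denom s.
Proof.
move=> us; split; first exact: runit_neq0.
by move=> p [_ np _] /rdiv_unit/(_ us)/np.
Qed.

Lemma denomM s t : denom s -> denom t -> denom (s * t).
Proof.
move=> [s0 sp] [t0 tp]; split; first by rewrite mulf_neq0.
by move=> p pp; have [_ _ pP] := pp; move=> /pP[/(sp _ pp)|/(tp _ pp)].
Qed.

Lemma denom_div s t : denom t -> rdiv s t -> denom s.
Proof.
move=> [t0 tp] st; split; first exact: rdiv_neq0 st t0.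
by move=> p pp /rdiv_trans/(_ st)/(tp _ pp).
Qed.

Lemma denom_cl s a : denom s -> homog a s -> fsum a = 0.
Proof.
have [n] := ubnP (tdeg s); elim: n s a => // n IHn s a sn ds hs.
have [us|nus] := pselect (runit s); first by rewrite (homog_unit us hs) fsum0.
have [s0 sp] := ds; have [p pp ps] := prime_divisor pR s0 nus.
have [_ [b hb fb] _] := sp p pp ps; have [t sE] := ps.
have [b' [c [hb' hc ->]]] := homog_div s0 hs sE.
rewrite fsumD (homog_uniq (rdiv_neq0 ps s0) hb' hb) fb add0r.
have t0 : t != 0 by apply: contra_neq s0 => t0; rewrite sE t0 mulr0.
apply: (IHn t) => //; first by move: sn (tdeg_ltn pR pp t0); rewrite -sE; lia.
by apply: denom_div ds _; exists p; rewrite mulrC.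
Qed.

Lemma inv_prime_denom q : inv_prime q -> denom q.
Proof.
move=> [qq [a ha fa] qX]; have [q0 _ _] := qq; split=> // p pp pq.
have [t [v tv] qE] := rprime_dvd_prime pp qq pq; split=> //; last first.
  by move=> i pi; apply: (qX i); apply: rdiv_trans pi; exists v; rewrite qE -mulrA -tv mulr1.
have [b [c [hb hc aE]]] := homog_div q0 ha qE.
by exists b => //; rewrite -fa aE (@homog_unit c t) ?addr0 //; exists v.
Qed.

(* A combination of two coprime polynomials with new variables as coefficients
   is prime; it is inverted when its degree is in the kernel of [fsum], which
   makes the localization a graded principal ideal domain. *)
Lemma denom_linear f g a b l m : f != 0 -> g != 0 -> homog a f -> homog b g ->
  (forall p, rprime p -> rdiv p f -> ~ rdiv p g) ->
  a + list_deg l = b + list_deg m -> fsum (a + list_deg l) = 0 ->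
  exists y z : var, [/\ y.1.1 = l, z.1.1 = m, denom (f * X y + g * X z)
    & homog (a + list_deg l) (f * X y + g * X z)].
Proof.
move=> f0 g0 hf hg cop ab s0; have [e _ es] := subalg_all pR [:: f; g].
have ef : subalg C X e f by apply: es; rewrite inE eqxx.
have eg : subalg C X e g by apply: es; rewrite !inE eqxx orbT.
have [y yl ye] := fresh_var l e; have [z zm] := fresh_var m (y :: e).
rewrite inE negb_or => /andP[zy ze].
have [fy gy] := (vdeg_subalg pR ef ye, vdeg_subalg pR eg ye).
have [fz gz] := (vdeg_subalg pR ef ze, vdeg_subalg pR eg ze).
have yz : y != z by rewrite eq_sym.
have hq : homog (a + list_deg l) (f * X y + g * X z).
  apply: homogD; first by rewrite -yl; apply: homogM => //; exact: homogX.
  by rewrite ab -zm; apply: homogM => //; exact: homogX.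
exists y, z; split=> //; apply: inv_prime_denom; split.
- exact: (@linear_prime _ _ _ _ _ pR f g y z f0 g0 cop fy gy fz yz).
- by exists (a + list_deg l).
- by move=> i; apply: (@linear_not_var _ _ _ _ _ pR f g y z i).
Qed.
End GradedPolynomials.

(** * Fraction fields *)

Lemma fraction_field_exists (R : idomainType) : exists (L : fieldType) (io : {rmorphism R -> L}),
  injective io /\ forall u, exists a b, b != 0 /\ u = io a / io b.
Proof.
pose io : {rmorphism R -> {fraction R}} := @tofrac R.
have ioI : injective io by move=> x y /eqP; rewrite /io tofrac_eq => /eqP.
exists {fraction R}, io; split=> // u.
elim/quotW: u => x; exists \n_x, \d_x; split; first exact: denom_ratioP.
apply: (canRL (mulfK _)); first by rewrite /io tofrac_eq0 denom_ratioP.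
rewrite /io /= /GRing.mul /= !piE; apply/eqmodP; rewrite /= FracField.equivfE /FracField.mulf.
rewrite !numden_Ratio ?oner_neq0 ?mulf_neq0 ?denom_ratioP ?oner_neq0 //; apply/eqP; ring.
Qed.

Section FractionLift.
Variables (R : idomainType) (L : fieldType) (io : {rmorphism R -> L}).
Hypotheses (ioI : injective io) (ioF : forall u, exists a b, b != 0 /\ u = io a / io b).

Lemma frac_neq0 x : x != 0 -> io x != 0.
Proof. by move=> x0; rewrite -(rmorph0 io) (inj_eq ioI). Qed.

Lemma frac_eq a b c d : b != 0 -> d != 0 -> io a / io b = io c / io d -> a * d = c * b.
Proof.
move=> b0 d0 /eqP; rewrite eqr_div ?frac_neq0 // -!rmorphM => /eqP /ioI //.
Qed.

Lemma frac_lift (h : {rmorphism R -> L}) : injective h ->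
  exists H : {rmorphism L -> L}, forall x, H (io x) = h x.
Proof.
move=> hI; have h0 x : x != 0 -> h x != 0 by move=> x0; rewrite -(rmorph0 h) (inj_eq hI).
have /choice[n /choice[d nd]] := ioF.
have d0 u : d u != 0 by have [] := nd u.
pose H u := h (n u) / h (d u).
have HE a b : b != 0 -> H (io a / io b) = h a / h b.
  move=> b0; have [_ /esym /(frac_eq (d0 _) b0) e] := nd (io a / io b).
  by apply/eqP; rewrite eqr_div ?h0 // -!rmorphM e.
have Hio a : H (io a) = h a.
  by have := HE a 1 (oner_neq0 _); rewrite !rmorph1 !divr1.
have HB : zmod_morphism H.
  move=> u v; have [a [b [b0 ->]]] := ioF u; have [c [e [e0 ->]]] := ioF v.
  have -> : io a / io b - io c / io e = io (a * e - c * b) / io (b * e).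
    by rewrite -(mulNr (io c)) addf_div ?frac_neq0 // mulNr -!rmorphM -rmorphB.
  by rewrite !HE ?mulf_neq0 // -(mulNr (h c)) addf_div ?h0 // mulNr -!rmorphM -rmorphB.
have HM : monoid_morphism H.
  split; first by rewrite -(rmorph1 io) Hio !rmorph1.
  move=> u v; have [a [b [b0 ->]]] := ioF u; have [c [e [e0 ->]]] := ioF v.
  by rewrite mulf_div -!rmorphM !HE ?mulf_neq0 // !rmorphM mulf_div.
pose HBm := GRing.isZmodMorphism.Build L L H HB.
pose HMm := GRing.isMonoidMorphism.Build L L H HM.
pose HH : {rmorphism L -> L} := HB.pack H HBm HMm.
by exists HH.
Qed.

End FractionLift.

(** * The localized ring: length, Bezout relations, units *)

Section LocalizedPolynomials.
Variables (G : zmodType) (A : eqType) (a0 : A).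
Local Notation var := ((seq G * A) * int)%type.
Variables (K : fieldType) (R : idomainType) (C : {rmorphism K -> R}) (X : var -> R).
Hypothesis pR : is_polyring C X.
Variables (L : fieldType) (io : {rmorphism R -> L}).
Hypothesis ioI : injective io.
Local Notation D := (fabgroup G).
Local Notation wt := (wt pR).
Local Notation wdeg := (wdeg pR).
Local Notation tdeg := (tdeg pR).
Local Notation vdeg i := (wdeg (var_wt i)).
Local Notation homog := (homog pR).
Local Notation inv_prime := (inv_prime pR).
Local Notation denom := (denom pR).

Definition loc (a : D) (u : L) := exists f s b,
  [/\ u = io f / io s, homog (a + b) f, homog b s & denom s].

Lemma list_deg_cons g l : list_deg (g :: l) = fgen g + list_deg l :> D.
Proof. by rewrite /list_deg big_cons. Qed.

Lemma list_deg_nil : list_deg [::] = 0 :> D.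
Proof. by rewrite /list_deg big_nil. Qed.

Lemma denom1 : denom 1. Proof. exact/denom_unit/runit1. Qed.

Lemma homog1 : homog 0 1. Proof. by rewrite -(rmorph1 C); exact: homogC. Qed.

Lemma loc_io a f : homog a f -> loc a (io f).
Proof.
move=> hf; exists f, 1, 0; rewrite rmorph1 divr1 addr0.
by split=> //; [exact: homog1|exact: denom1].
Qed.

Lemma loc0 a : loc a 0.
Proof. by rewrite -(rmorph0 io); apply/loc_io/homog0. Qed.

Lemma loc1 : loc 0 1.
Proof. by rewrite -(rmorph1 io); apply/loc_io/homog1. Qed.

Lemma locB a u v : loc a u -> loc a v -> loc a (u - v).
Proof.
move=> [f [s [b [-> hf hs ds]]]] [g [t [c [-> hg ht dt]]]].
have [s0 _] := ds; have [t0 _] := dt.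
exists (f * t - g * s), (s * t), (b + c); split.
- by rewrite -(mulNr (io g)) addf_div ?(frac_neq0 ioI) // mulNr -!rmorphM -rmorphB.
- apply: homogB; first by rewrite addrA; exact: homogM.
  by rewrite [b + c]addrC addrA; exact: homogM.
- exact: homogM.
- exact: denomM.
Qed.

Lemma locM a b u v : loc a u -> loc b v -> loc (a + b) (u * v).
Proof.
move=> [f [s [c [-> hf hs ds]]]] [g [t [d [-> hg ht dt]]]].
exists (f * g), (s * t), (c + d); split.
- by rewrite mulf_div -!rmorphM.
- by rewrite addrACA; exact: homogM.
- exact: homogM.
- exact: denomM.
Qed.

Lemma loc_deg a b u : loc a u -> loc b u -> u != 0 -> a = b.
Proof.
move=> [f [s [c [-> hf hs ds]]]] [g [t [d [e hg ht dt]]]] u0.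
have [s0 _] := ds; have [t0 _] := dt.
have f0 : f != 0 by apply: contra_neq u0 => ->; rewrite rmorph0 mul0r.
have {}e := frac_eq ioI s0 t0 e.
have : a + c + d = b + d + c.
  apply: (@homog_uniq _ _ _ _ _ _ pR _ _ (f * t)); first by rewrite mulf_neq0.
    exact: homogM.
  by rewrite e; exact: homogM.
by rewrite addrAC => /addIr/addIr.
Qed.

Lemma loc_denom_inv a b s : homog (a + b) s -> denom s ->
  forall t, homog b t -> denom t -> loc (- a) (io s / io t)^-1.
Proof.
move=> hs ds t ht dt; exists t, s, (a + b); split=> //; last by rewrite addKr.
by rewrite invf_div.
Qed.

Lemma loc_inv_denom a f s : f != 0 -> denom s -> loc a (io f / io s)^-1 -> denom f.
Proof.
move=> f0 ds [g [t [b [e _ _ dt]]]]; have [s0 _] := ds; have [t0 _] := dt.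
have {}e : s * t = g * f by apply: (frac_eq ioI f0 t0); rewrite -e invf_div.
by apply: (denom_div (denomM ds dt)); rewrite e; exists g; rewrite mulrC.
Qed.

Lemma loc_unit_cl a u : u != 0 -> loc a u -> loc (- a) u^-1 -> fsum a = 0.
Proof.
move=> u0 [f [s [b [uE hf hs ds]]]]; rewrite uE => /loc_inv_denom df.
have f0 : f != 0 by apply: contra_neq u0 => f0; rewrite uE f0 rmorph0 mul0r.
rewrite -[a](addrK b) fsumB (denom_cl (df f0 ds) hf) (denom_cl ds hs).
by rewrite subrr.
Qed.

Definition clean (b : R) := b != 0 /\ forall p, inv_prime p -> ~ rdiv p b.

Lemma cleanM b c : clean b -> clean c -> clean (b * c).
Proof.
move=> [b0 bp] [c0 cp]; split; first by rewrite mulf_neq0.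
by move=> p ip; have [[_ _ pP] _ _] := ip; move=> /pP[/(bp p ip)|/(cp p ip)].
Qed.

Lemma clean_split f : f != 0 -> exists b t, [/\ f = b * t, clean b & denom t].
Proof.
have [n] := ubnP (tdeg f); elim: n f => // n IHn f fn f0.
have [[p [ip [g fE]]]|nex] := pselect (exists p, inv_prime p /\ rdiv p f); last first.
  exists f, 1; rewrite mulr1; split=> //; last exact: denom1.
  by split=> // p ip pf; apply: nex; exists p.
have g0 : g != 0 by apply: contra_neq f0 => g0; rewrite fE g0 mulr0.
have [pp _ _] := ip.
have [|b [t [gE cb dt]]] := IHn g _ g0; first by move: fn (tdeg_ltn pR pp g0); rewrite -fE; lia.
exists b, (p * t); split=> //; first by rewrite fE gE mulrCA.
by apply: denomM => //; exact: inv_prime_denom.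
Qed.

(** The prime factors of t are inverted, so they do not divide [b'] and cancel against [t'] one at a
    time. *)
Lemma clean_rdiv b b' t t' : clean b' -> denom t -> b * t = b' * t' -> rdiv b' b.
Proof.
move=> cb'; have [n] := ubnP (tdeg t); elim: n t t' => // n IHn t t' tn dt e.
have [[v tv]|nut] := pselect (runit t).
  by exists (t' * v); rewrite mulrA -e -mulrA -tv mulr1.
have [t0 tp] := dt; have [p pp pt] := prime_divisor pR t0 nut.
have ip := tp p pp pt; have [p0 _ pP] := pp; have [s tE] := pt.
have [|/(cb'.2 p ip) //|[s' t'E]] := pP b' t'; first by rewrite -e; exact: rdiv_mull.
have s0 : s != 0 by apply: contra_neq t0 => s0; rewrite tE s0 mulr0.
apply: (IHn s s').
- by move: tn (tdeg_ltn pR pp s0); rewrite -tE; lia.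
- by apply: denom_div dt _; exists p; rewrite mulrC.
by apply: (mulfI p0); rewrite mulrCA -tE e t'E mulrCA.
Qed.

(** The total degree of the part of the numerator prime to all inverted primes. Ignoring inverted
    factors makes it well defined on fractions, additive, and zero only on units. *)
Definition len_spec (u : L) n := exists b t s,
  [/\ u = io (b * t) / io s, clean b, denom t, denom s & n = tdeg b].
(** The value 0 is a default where no such expression exists, for instance at 0. *)
Definition len (u : L) : nat :=
  if pselect (exists n, len_spec u n) is left h then projT1 (cid h) else 0%N.

Lemma len_spec_uniq u m n : len_spec u m -> len_spec u n -> m = n.
Proof.
move=> [b [t [s [-> cb dt ds ->]]]] [c [r [q [/frac_eq e cc dr dq ->]]]].
have [s0 _] := ds; have [q0 _] := dq; have {}e := e ioI s0 q0; rewrite -!mulrA in e.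
have [b0 _] := cb; have [c0 _] := cc.
apply/eqP; rewrite eqn_leq; apply/andP; split; apply: rdiv_wdeg => //.
  exact: (clean_rdiv cb (denomM dr ds) (esym e)).
exact: (clean_rdiv cc (denomM dt dq) e).
Qed.

Lemma lenE u n : len_spec u n -> len u = n.
Proof.
move=> un; rewrite /len; case: pselect => [h|[]]; last by exists n.
by case: cid => m /= um; exact: len_spec_uniq um un.
Qed.

Lemma len_spec_ex a u : loc a u -> u != 0 -> exists n, len_spec u n.
Proof.
move=> [f [s [b [uE hf hs ds]]]] u0.
have f0 : f != 0 by apply: contra_neq u0 => f0; rewrite uE f0 rmorph0 mul0r.
by have [c [t [fE cc dt]]] := clean_split f0; exists (tdeg c), c, t, s; rewrite -fE.
Qed.

Lemma loc_lenM a b u v : loc a u -> loc b v -> u != 0 -> v != 0 ->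
  len (u * v) = (len u + len v)%N.
Proof.
move=> lu lv u0 v0; have [m um] := len_spec_ex lu u0; have [n vn] := len_spec_ex lv v0.
rewrite (lenE um) (lenE vn); apply: lenE.
have [b1 [t [s [-> cb dt ds ->]]]] := um; have [c [r [q [-> cc dr dq ->]]]] := vn.
exists (b1 * c), (t * r), (s * q); split; last 1 first.
- by rewrite tdegM ?(proj1 cb) ?(proj1 cc).
- by rewrite mulf_div -!rmorphM mulrACA.
- exact: cleanM.
- exact: denomM.
- exact: denomM.
Qed.

Lemma tdeg0_unit (b : R) : b != 0 -> tdeg b = 0%N -> runit b.
Proof. by move=> b0 /(runitP pR b0). Qed.

Lemma loc_len0 a u : loc a u -> u != 0 -> len u = 0%N -> loc (- a) u^-1.
Proof.
move=> [f [s [b [uE hf hs ds]]]] u0.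
have f0 : f != 0 by apply: contra_neq u0 => f0; rewrite uE f0 rmorph0 mul0r.
have [c [t [fE cc dt]]] := clean_split f0.
rewrite (@lenE u (tdeg c)); last by exists c, t, s; rewrite -fE.
move=> /(tdeg0_unit (proj1 cc)) uc; rewrite uE.
apply: loc_denom_inv hf _ _ hs ds.
by rewrite fE; apply: denomM dt; exact: denom_unit.
Qed.

(** Dividing by a gcd h leaves coprime f1 and g1. With new variables, [q = f1 X_y + g1 X_z] is
    inverted, and [h = (X_y / q) f + (X_z / q) g]. *)
Lemma loc_bezout a b u v : loc a u -> loc b v -> u != 0 -> v != 0 ->
  exists c d r s, [/\ loc c d, d != 0, loc (a - c) (u / d), loc (b - c) (v / d)
    & [/\ loc (c - a) r, loc (c - b) s & d = r * u + s * v]].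
Proof.
move=> [f [s [c [uE hf hs ds]]]] [g [t [d [vE hg ht dt]]]] u0 v0.
have f0 : f != 0 by apply: contra_neq u0 => f0; rewrite uE f0 rmorph0 mul0r.
have g0 : g != 0 by apply: contra_neq v0 => g0; rewrite vE g0 rmorph0 mul0r.
have [h [f1 [g1 [fE gE cop]]]] := gcd_split pR f0 g0.
have [e [e1 [hh hf1 aE]]] := homog_div f0 hf fE.
have [e' [e2 [hh' hg1 bE]]] := homog_div g0 hg gE.
have aE' : a = e + e1 - c by rewrite -aE; zmod.
have ee := homog_uniq (rdiv_neq0 (ex_intro _ _ fE) f0) hh' hh; subst e'.
have bE' : b = e + e2 - d by rewrite -bE; zmod.
have [h0 f10] : h != 0 /\ f1 != 0 by move: f0; rewrite fE mulf_eq0 negb_or => /andP.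
have g10 : g1 != 0 by apply: contra_neq g0 => g10; rewrite gE g10 mulr0.
have [l1 l1E] := homog_list f10 hf1; have [l2 l2E] := homog_list g10 hg1.
(* The extra generator w puts the common degree of [f1 X_y] and [g1 X_z] into the kernel of
   [fsum]. *)
pose w := - (fsum (list_deg l1) + fsum (list_deg l2)).
have [||y [z [yl zl dq hq]]] := denom_linear a0 f10 g10 hf1 hg1 cop (l := w :: l2) (m := w :: l1).
- by rewrite l1E l2E !list_deg_cons; zmod.
- by rewrite l1E list_deg_cons !fsumD fsum_gen /w; zmod.
move: dq hq; set q := f1 * X y + g1 * X z => dq hq; have [q0 _] := dq.
have [s0 _] := ds; have [t0 _] := dt; have io0 := frac_neq0 ioI.
exists e, (io h), (io (s * X y) / io q), (io (t * X z) / io q); split.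
- exact: loc_io.
- exact: io0.
- exists f1, s, c; split=> //; last by move: hf1; congr homog; rewrite aE'; zmod.
  by rewrite uE fE rmorphM mulrAC [io h * _]mulrC mulfK ?io0.
- exists g1, t, d; split=> //; last by move: hg1; congr homog; rewrite bE'; zmod.
  by rewrite vE gE rmorphM mulrAC [io h * _]mulrC mulfK ?io0.
split.
- exists (s * X y), q, (e1 + list_deg (w :: l2)); split=> //.
  have hy : homog (var_deg y) (X y) := @homogX _ _ _ _ _ _ pR y.
  by have := homogM hs hy; congr homog; rewrite /var_deg yl; rewrite aE'; zmod.
- exists (t * X z), q, (e1 + list_deg (w :: l2)); split=> //.
  have hz : homog (var_deg z) (X z) := @homogX _ _ _ _ _ _ pR z.
  have := homogM ht hz; congr homog; rewrite /var_deg zl.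
  by rewrite bE' l1E l2E !list_deg_cons; zmod.
apply: (mulIf (io0 _ q0)); rewrite mulrDl.
have tE (x y' : L) : x / io q * y' * io q = x * y' by rewrite mulrAC divfK ?io0.
rewrite !tE uE vE -!rmorphM.
have sE (x y' z' : R) : z' != 0 -> io (z' * x) * (io y' / io z') = io (x * y').
  by move=> z0; rewrite mulrA -rmorphM -mulrA rmorphM mulrAC divff ?io0 // mul1r.
by rewrite !sE // -rmorphD; congr (io _); rewrite fE gE /q; ring.
Qed.
Lemma list_deg_sub (a : D) : exists l m, a = list_deg l - list_deg m.
Proof.
have [|l lE] := @list_with_counts _ a
  (fun g => if 0 <= mcoeff g a then absz (mcoeff g a)%R else 0%N).
  by move=> g; case: ifP.
have [|m mE] := @list_with_counts _ a
  (fun g => if 0 <= mcoeff g a then 0%N else absz (mcoeff g a)%R).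
  by move=> g; case: ifP.
exists l, m; apply: fabgroup_ext => g; rewrite mcoeffB !mcoeff_list_deg lE mE.
by case: ifP; lia.
Qed.

(** A sum of two new variables, obtained from the coprime pair 1 and 1. *)
Lemma denom_list l : fsum (list_deg l) = 0 -> exists2 q, homog (list_deg l) q & denom q.
Proof.
move=> l0; have o0 := oner_neq0 R.
have cop p : rprime p -> rdiv p (1 : R) -> ~ rdiv p (1 : R) by move=> [_ np _] /np.
have [|y [z [_ _ dq]]] := denom_linear a0 o0 o0 homog1 homog1 cop (erefl (0 + list_deg l)).
  by rewrite add0r.
by rewrite add0r => hq; exists (1 * X y + 1 * X z).
Qed.

Lemma loc_unit_ex a : fsum a = 0 -> exists u, [/\ u != 0, loc a u & loc (- a) u^-1].
Proof.
move=> fa; have [l [m aE]] := list_deg_sub a.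
(* Appending w to both lists puts their degrees into the kernel, where [denom_list] supplies a
   numerator and a denominator. *)
pose w := - fsum (list_deg l).
have lm : fsum (list_deg l) = fsum (list_deg m).
  by apply/eqP; rewrite -subr_eq0 -fsumB -aE fa.
have [|q hq dq] := @denom_list (w :: l); first by rewrite list_deg_cons fsumD fsum_gen addNr.
have [|r hr dr] := @denom_list (w :: m).
  by rewrite list_deg_cons fsumD fsum_gen -lm addNr.
have aE' : a + list_deg (w :: m) = list_deg (w :: l) by rewrite aE !list_deg_cons; zmod.
have [[q0 _] [r0 _]] := (dq, dr).
exists (io q / io r); split; first by rewrite mulf_neq0 ?invr_eq0 ?(frac_neq0 ioI).
  by exists q, r, (list_deg (w :: m)); rewrite aE'.
by apply: loc_denom_inv dq _ hr dr; rewrite aE'.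
Qed.

Lemma rdiv_var i j : rdiv (X i) (X j) -> i = j.
Proof.
move=> /(rdiv_wdeg pR (var_wt i))/(_ (X_neq0 pR j)); rewrite !vdegX eqxx.
by case: eqP.
Qed.

(** Units reduce a and b to the generators of their classes. There [q = X_i X_y + X_j X_z] is
    inverted, and division by q gives the determinant 1. *)
Lemma loc_det a b : exists p q r s,
  [/\ loc b p, loc a q, loc (- a) r, loc (- b) s & p * s - q * r = 1].
Proof.
have unit_deg x : exists u, [/\ u != 0, loc (x - fgen (fsum x)) u & loc (- (x - fgen (fsum x))) u^-1].
  by apply: loc_unit_ex; rewrite fsumB fsum_gen subrr.
have [e [e0 le le']] := unit_deg b; have [h [h0 lh lh']] := unit_deg a.
have [i iE _] := fresh_var a0 [:: fsum b] [::].
have [j jE] := fresh_var a0 [:: fsum a] [:: i].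
rewrite inE => ji; pose w := - (fsum a + fsum b).
have ld1 g : list_deg [:: g] = fgen g :> D by rewrite list_deg_cons list_deg_nil addr0.
have hi : homog (fgen (fsum b)) (X i) by rewrite -ld1 -iE; exact: homogX.
have hj : homog (fgen (fsum a)) (X j) by rewrite -ld1 -jE; exact: homogX.
have cop p : rprime p -> rdiv p (X i) -> ~ rdiv p (X j).
  move=> pp /(rprime_dvd_prime pp (X_prime pR i))[t [v tv] iE'] pj.
  case/eqP: ji; apply/esym/rdiv_var; apply: rdiv_trans pj.
  by exists v; rewrite iE' -mulrA -tv mulr1.
have [||y [z [yE zE dq hq]]] := denom_linear a0 (X_neq0 pR i) (X_neq0 pR j) hi hj cop
    (l := [:: fsum a; w]) (m := [:: fsum b; w]).
- by rewrite !list_deg_cons; zmod.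
- by rewrite !list_deg_cons list_deg_nil !fsumD !fsum_gen fsum0 /w; zmod.
move: dq hq; set q := X i * X y + X j * X z => dq hq; have [q0 _] := dq.
have io0 := frac_neq0 ioI.
have hy : homog (var_deg y) (X y) := @homogX _ _ _ _ _ _ pR y.
have hz : homog (var_deg z) (X z) := @homogX _ _ _ _ _ _ pR z.
have ly : loc (- fgen (fsum b)) (io (X y) / io q).
  exists (X y), q, (fgen (fsum b) + list_deg [:: fsum a; w]); split=> //.
  by rewrite addKr -yE.
have lz : loc (- fgen (fsum a)) (io (X z) / io q).
  exists (X z), q, (fgen (fsum b) + list_deg [:: fsum a; w]); split=> //.
  by move: hz; congr homog; rewrite /var_deg zE !list_deg_cons; zmod.
exists (io (X i) * e), (- (io (X j) * h)), (io (X z) / io q * h^-1), (io (X y) / io q * e^-1); split.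
- by have := locM (loc_io hi) le; congr loc; zmod.
- by have := locB (loc0 a) (v := io (X j) * h) _; rewrite sub0r; apply;
    have := locM (loc_io hj) lh; congr loc; zmod.
- by have := locM lz lh'; congr loc; zmod.
- by have := locM ly le'; congr loc; zmod.
have qE : io q = io (X i) * io (X y) + io (X j) * io (X z) by rewrite -!rmorphM -rmorphD.
have : io q != 0 by exact: io0.
by rewrite qE => nz; field; rewrite nz e0 h0.
Qed.

Lemma denom_var s i : denom s -> ~ rdiv (X i) s.
Proof. by move=> [_ sp] /(sp _ (X_prime pR i))[_ _ /(_ i)]; apply; exact: rdiv_refl. Qed.

Lemma loc_var_quot i j : i != j -> ~ loc 0 (io (X i) / io (X j)).
Proof.
move=> ij [f [s [b [e _ _ ds]]]]; have [s0 _] := ds.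
have {}e := frac_eq ioI (X_neq0 pR j) s0 e.
have [_ _ jP] := X_prime pR j; have [|/rdiv_var ji|] := jP (X i) s.
- by rewrite e; exists f; rewrite mulrC.
- by case/eqP: ij.
- exact: denom_var.
Qed.

Lemma var_noninv i : ~ loc (- var_deg i) (io (X i))^-1.
Proof.
move=> l; apply: (@denom_var (X i) i); last exact: rdiv_refl.
apply: (@loc_inv_denom (- var_deg i) _ 1 (X_neq0 pR i) denom1).
by rewrite rmorph1 divr1.
Qed.

Lemma var_gp_prime i : gp_prime loc (var_deg i) (io (X i)).
Proof.
split; [exact/loc_io/homogX|exact: (frac_neq0 ioI (X_neq0 pR i))|exact: var_noninv|].
move=> a b u v [f [s [c [uE hf hs ds]]]] [g [t [d [vE hg ht dt]]]].
have [[s0 _] [t0 _]] := (ds, dt).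
rewrite uE vE mulf_div -!rmorphM -[LHS]divr1 -[X in _ / X](rmorph1 io).
move=> /(frac_eq ioI (oner_neq0 R)); rewrite mulf_neq0 // mulr1 => /(_ isT) e.
have [x0 _ xP] := X_prime pR i.
have [|[f' fE]|[g' gE]] := xP f g; first by rewrite -e; exists (s * t).
  right; apply: (loc_denom_inv hg _ ht dt).
  apply: denom_div (denomM ds dt) _; exists f'; apply: (mulfI x0).
  by rewrite e fE -mulrA [f' * g]mulrC.
left; apply: (loc_denom_inv hf _ hs ds).
apply: denom_div (denomM ds dt) _; exists g'; apply: (mulfI x0).
by rewrite e gE mulrCA.
Qed.

(** * The shift of the variables *)

Section Shift.
Variables (sR : int -> {rmorphism R -> R}) (sg : int -> {rmorphism L -> L}).
Hypotheses (sRC : forall k c, sR k (C c) = C c)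
  (sRX : forall k i, sR k (X i) = X (i.1, i.2 + k))
  (sgE : forall k x, sg k (io x) = io (sR k x)).

Lemma polyring_hom_eq (S : comNzRingType) (h1 h2 : {rmorphism R -> S}) :
  (forall c, h1 (C c) = h2 (C c)) -> (forall i, h1 (X i) = h2 (X i)) -> h1 =1 h2.
Proof.
move=> hc hv; apply: (polyring_ind pR) => // x y; rewrite ?rmorphD ?rmorphM; by move=> -> ->.
Qed.

Lemma sR0 x : sR 0 x = x.
Proof.
apply: (@polyring_hom_eq R (sR 0) idfun) => [c|[i n]]; first exact: sRC.
by rewrite sRX addr0.
Qed.

Lemma sRD i j x : sR (i + j) x = sR i (sR j x).
Proof.
apply: (@polyring_hom_eq R (sR (i + j)) (sR i \o sR j)) => [c|[y n]] /=; first by rewrite !sRC.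
by rewrite !sRX -addrA [j + i]addrC.
Qed.

Lemma sRK k x : sR (- k) (sR k x) = x. Proof. by rewrite -sRD addNr sR0. Qed.
Lemma sRVK k x : sR k (sR (- k) x) = x. Proof. by rewrite -sRD subrr sR0. Qed.

Lemma sR_inj k : injective (sR k). Proof. exact: can_inj (sRK k). Qed.

Lemma sR_neq0 k x : x != 0 -> sR k x != 0.
Proof. by move=> x0; rewrite -(rmorph0 (sR k)) (inj_eq (@sR_inj k)). Qed.

Lemma sR_homog k a f : homog a f -> homog a (sR k f).
Proof.
move=> hf sf0 g; have [|f1 f2] := hf _ g.
  by apply: contra_neq sf0 => ->; rewrite rmorph0.
split=> //; pose w (s : var) := count_mem g s.1.1.
have -> : wt w (sR k f) = map_poly (sR k) (wt w f).
  apply: (@polyring_hom_eq {poly R} (wt w \o sR k) (map_poly (sR k) \o wt w)) => [c|i] /=.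
    by rewrite sRC !wtC map_polyC /= sRC.
  by rewrite sRX !wtX map_polyZ /= map_polyXn sRX.
by rewrite f2 map_polyZ /= map_polyXn.
Qed.

Lemma sR_rdiv k a b : rdiv a b -> rdiv (sR k a) (sR k b).
Proof. by move=> [c ->]; exists (sR k c); rewrite rmorphM. Qed.

Lemma sR_rprime k p : rprime p -> rprime (sR k p).
Proof.
move=> [p0 np pP]; split; first exact: sR_neq0.
  by move=> /(sR_rdiv (- k)); rewrite sRK rmorph1.
move=> a b /(sR_rdiv (- k)); rewrite rmorphM sRK => /pP[] /(sR_rdiv k); rewrite sRVK; by [left|right].
Qed.

Lemma sR_inv_prime k p : inv_prime p -> inv_prime (sR k p).
Proof.
move=> [pp [a ha fa] pX]; split; first exact: sR_rprime.
  by exists a => //; exact: sR_homog.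
by move=> i /(sR_rdiv (- k)); rewrite sRK sRX; exact: pX.
Qed.

Lemma sR_denom k s : denom s -> denom (sR k s).
Proof.
move=> [s0 sp]; split; first exact: sR_neq0.
move=> p /(sR_rprime (- k)) pp /(sR_rdiv (- k)); rewrite sRK => /(sp _ pp)/(sR_inv_prime k).
by rewrite sRVK.
Qed.

Lemma sR_clean k b : clean b -> clean (sR k b).
Proof.
move=> [b0 bp]; split; first exact: sR_neq0.
by move=> p /(sR_inv_prime (- k)) ip /(sR_rdiv (- k)); rewrite sRK; exact: bp.
Qed.

Lemma sR_vdeg k i f : vdeg i f = vdeg (i.1, i.2 + k) (sR k f).
Proof.
rewrite /wdeg; have -> : wt (var_wt (i.1, i.2 + k)) (sR k f) = map_poly (sR k) (wt (var_wt i) f).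
  apply: (@polyring_hom_eq {poly R} (wt (var_wt (i.1, i.2 + k)) \o sR k)
    (map_poly (sR k) \o wt (var_wt i))) => [c|j] /=.
    by rewrite sRC !wtC map_polyC /= sRC.
  rewrite sRX !wtX map_polyZ /= map_polyXn sRX /var_wt; congr (_ *: 'X^(_ _)).
  case: i j => [i m] [j n] /=; rewrite !xpair_eqE; congr (_ && _).
  exact: (inj_eq (addIr k)).
by rewrite size_map_inj_poly ?rmorph0 //; exact: sR_inj.
Qed.

Lemma loc_sg a u k : loc a u -> loc a (sg k u).
Proof.
move=> [f [s [b [-> hf hs ds]]]]; exists (sR k f), (sR k s), b; split.
- by rewrite rmorphM fmorphV !sgE.
- exact: sR_homog.
- exact: sR_homog.
- exact: sR_denom.
Qed.

(** The clean part b of the numerator is associate to its shift, so it has equal degrees in all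
    variables of an orbit. Only finitely many variables occur in b and orbits are infinite, so b is
    constant. *)
Lemma loc_sg_orbit a u k : loc a u -> u != 0 -> k != 0 ->
  loc 0 (sg k u / u) -> loc 0 (u / sg k u) -> loc (- a) u^-1.
Proof.
move=> lu u0 k0 l1 l2; have [f [s [c [uE hf hs ds]]]] := lu.
have f0 : f != 0 by apply: contra_neq u0 => f0; rewrite uE f0 rmorph0 mul0r.
have [b [t [fE cb dt]]] := clean_split f0; have [b0 _] := cb.
suff ub : runit b.
  by rewrite uE; apply: loc_denom_inv hf _ _ hs ds; rewrite fE; apply: denomM dt; exact: denom_unit.
have [x [y [_ [xE _ _ dy]]]] := l1; have [x' [y' [_ [x'E _ _ dy']]]] := l2.
have [[s0 _] [y0 _] [y'0 _]] := And3 ds dy dy'.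
have su0 : sg k u != 0 by rewrite fmorph_eq0.
have io0 := frac_neq0 ioI.
have dx : denom x.
  apply: denom_div (denomM dy dy') _; exists x'; apply: ioI; rewrite !rmorphM.
  have -> : io x = sg k u / u * io y by rewrite xE divfK ?io0.
  have -> : io x' = u / sg k u * io y' by rewrite x'E divfK ?io0.
  by field; rewrite u0 su0.
have e : sR k b * (sR k t * s * y) = b * (t * sR k s * x).
  apply: ioI; rewrite !rmorphM; have -> : io x = sg k u / u * io y by rewrite xE divfK ?io0.
  rewrite uE rmorphM fmorphV !sgE fE !rmorphM.
  have s1 := io0 _ s0; have s2 : io (sR k s) != 0 by exact/io0/sR_neq0.
  have b1 := io0 _ b0; have t1 : io t != 0 by have [t0 _] := dt; exact: io0.
  by field; rewrite s1 s2 b1 t1.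
have dl := denomM (denomM (sR_denom k dt) ds) dy.
have dr := denomM (denomM dt (sR_denom k ds)) dx.
have bs := clean_rdiv cb dl e; have sb := clean_rdiv (sR_clean k cb) dr (esym e).
have vb i : vdeg i b = vdeg (i.1, i.2 + k) b.
  rewrite (sR_vdeg k); apply/eqP; rewrite eqn_leq !rdiv_wdeg //; exact: sR_neq0.
have [e1 _ eb] := subalg_ex pR b.
have vn i n : vdeg i b = vdeg (i.1, i.2 + k *+ n) b.
  elim: n => [|n ->]; first by rewrite mulr0n addr0; case: i.
  by rewrite vb /= -addrA mulrSr.
have v0 i : vdeg i b = 0%N.
  have [N NP] : exists N : nat, forall j, j \in e1 -> (absz (j.2)%R < N)%N.
    elim: e1 {eb} => [|j e1 [N NP]]; first by exists 0%N.
    exists (N + (absz j.2).+1)%N => j'; rewrite inE => /predU1P[->|/NP]; lia.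
  (* After this many shifts by k the index exceeds N in absolute value or equals it, so the variable
     does not occur in b. *)
  rewrite (vn i (N + absz i.2)%N); apply: vdeg_subalg eb _.
  apply/negP => /NP /=; rewrite -mulr_natr natz; move: k0; move: (i.2) => z; nia.
have [d bE] := vdeg0_const v0.
by apply: (tdeg0_unit b0); rewrite bE; exact: wdegC.
Qed.
End Shift.
End LocalizedPolynomials.

Lemma graded_pid_exists (K : fieldType) (G : zmodType) (kappa : Type) :
  exists (L : fieldType) (k0 : {rmorphism K -> L}) (U : fabgroup G -> L -> Prop)
    (len : L -> nat) (sg : int -> {rmorphism L -> L}),
  [/\ graded_pid (@fsum G) U len sg, forall c, U 0 (k0 c), forall i c, sg i (k0 c) = k0 c
    & forall g, exists p : kappa -> L, (forall k, gp_prime U (fgen g) (p k)) /\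
        forall k k', k <> k' -> ~ U 0 (p k / p k')].
Proof.
(* [None] leaves a variable of degree 0 when [kappa] is empty. *)
pose A : choiceType := option {classic kappa}.
pose a0 : A := None.
have [R [C [X pR]]] := polyring_exists K ((seq G * A) * int)%type.
have [L [io [ioI ioF]]] := fraction_field_exists R.
have /choice[sR sRP] : forall k : int, exists h : {rmorphism R -> R},
    (forall c, h (C c) = C c) /\ forall i, h (X i) = X (i.1, i.2 + k).
  by move=> k; exact: (polyring_eval pR).
have sRC k := (sRP k).1; have sRX k := (sRP k).2.
have /choice[sg sgE] : forall k, exists h : {rmorphism L -> L}, forall x, h (io x) = io (sR k x).
  move=> k; have [|h hE] := @frac_lift _ _ _ ioI ioF (io \o sR k).
    by apply: inj_comp ioI _; exact: (sR_inj pR sRC sRX).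
  by exists h.
exists L, (io \o C), (loc pR io), (len pR io), sg; split.
- split.
  + exact: fsumB.
  + by move=> g; exists (fgen g); exact: fsum_gen.
  + exact: loc0.
  + exact: loc_deg.
  + exact: locB.
  + exact: loc1.
  + exact: locM.
  + exact: loc_lenM.
  + exact: loc_len0.
  + exact: loc_bezout.
  + exact: loc_unit_cl.
  + exact: loc_unit_ex.
  + exact: loc_det.
  + exists (io (X ([::], a0, 0))).
    have X0 := @loc_io _ _ _ _ _ _ pR _ io _ _ (@homogX _ _ _ _ _ _ pR ([::], a0, 0)).
    have := @var_noninv _ _ _ _ _ _ pR _ _ ioI ([::], a0, 0).
    move: X0; rewrite /var_deg list_deg_nil oppr0 => X0 nX.
    by split=> //; exact: (frac_neq0 ioI (X_neq0 pR _)).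
  + move=> u; have [f [s [_ ->]]] := ioF u.
    by rewrite rmorphM fmorphV !sgE !(sR0 pR sRC sRX).
  + move=> i j u; have [f [s [_ ->]]] := ioF u.
    by rewrite !rmorphM /= !fmorphV /= !sgE !(sRD pR sRC sRX).
  + by move=> a u k; exact: loc_sg.
  + by move=> a u k; exact: loc_sg_orbit.
- by move=> c; apply: loc_io; exact: homogC.
- by move=> i c; rewrite /= sgE sRC.
move=> g; exists (fun k => io (X ([:: g], Some k, 0))); split=> [k|k k' kk'].
  have := @var_gp_prime _ _ _ _ _ _ pR _ _ ioI ([:: g], Some k, 0).
  by rewrite /var_deg list_deg_cons list_deg_nil addr0.
apply: loc_var_quot => //; apply/eqP => -[e]; exact: kk'.
Qed.

(** * The algebra T inside the full skew Laurent ring *)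

Section SkewLaurentAlgebra.
Variables (K L : fieldType) (k0 : {rmorphism K -> L}) (D G : zmodType) (cl : D -> G).
Variables (U : D -> L -> Prop) (len : L -> nat) (sg : int -> {rmorphism L -> L}).
Hypotheses (gp : graded_pid cl U len sg) (Uk : forall c, U 0 (k0 c)).
Hypothesis sgk : forall i c, sg i (k0 c) = k0 c.

Definition full_data : skew_data K L.
Proof. by apply: (@SkewData K L k0 sg (fun=> True)) => //; [exact: gp_sg0 gp|exact: gp_sgD gp]. Defined.

Definition int_data : skew_data K L.
Proof.
apply: (@SkewData K L k0 sg (U 0)) => //; [exact: gp_sg0 gp|exact: gp_sgD gp| | |].
- exact: gp_B gp 0.
- by move=> a b Ua Ub; rewrite -[0](addr0 (0 : D)); exact: (gp_M gp).
- by move=> i a; exact: (gp_sgU gp).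
Defined.

Local Notation B := (skew_poly full_data).
Local Notation T := (skew_poly int_data).

Definition full_mon (a : L) (k : int) : B := skew_mon (d := full_data) (a := a) k Logic.I.
Definition full_io (a : L) : B := full_mon a 0.

Fact full_io_zmod : zmod_morphism full_io.
Proof.
by move=> a b; apply: skew_ext => v n; rewrite -[RHS]/(sg n a * v (n + 0) - sg n b * v (n + 0))
  -[LHS]/(sg n (a - b) * v (n + 0)) rmorphB mulrBl.
Qed.

Fact full_monM a b i k : full_mon a i * full_mon b k = full_mon (a * sg i b) (i + k).
Proof.
apply: skew_ext => v n; rewrite -[LHS]/(sg n a * (sg (n + i) b * v (n + i + k))).
by rewrite -[RHS]/(sg n (a * sg i b) * v (n + (i + k))) rmorphM (gp_sgD gp) mulrA addrA.
Qed.

Fact full_io_monoid : monoid_morphism full_io.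
Proof.
split; first exact: skew_ext.
by move=> a b; rewrite /full_io full_monM (gp_sg0 gp) addr0.
Qed.

HB.instance Definition _ := GRing.isZmodMorphism.Build L B full_io full_io_zmod.
HB.instance Definition _ := GRing.isMonoidMorphism.Build L B full_io full_io_monoid.

Definition full_xz (k : int) : B := full_mon 1 k.

Lemma skew_coef_fin (f : B) : exists N : nat, forall i, skew_coef f i != 0 -> `|i|%R <= N%:Z.
Proof.
case: f => f fP; rewrite /skew_coef /=; elim: fP => [|g h _ [M gM] _ [N hN]|a k _].
- by exists 0%N => i; rewrite eqxx.
- exists (M + N)%N => i; have [g0|/gM iM _] := eqVneq (g (skew_delta L i) 0) 0; last by lia.
  by rewrite g0 add0r => /hN; lia.
exists (absz k) => i; rewrite /skew_delta add0r; have [<- _|_] := eqVneq k i; first by lia.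
by rewrite mulr0 eqxx.
Qed.

Lemma full_skew_laurent : skew_laurent sg (full_io : {rmorphism L -> B}) full_xz (@skew_coef _ _ full_data).
Proof.
have ioxz a k : full_io a * full_xz k = full_mon a k.
  by rewrite full_monM (gp_sg0 gp) mulr1 add0r.
split.
- exact: skew_ext.
- by move=> i k; rewrite full_monM rmorph1 mulr1.
- by move=> i a; rewrite !full_monM (gp_sg0 gp) mul1r mulr1 addr0 add0r.
- by [].
- exact: skew_coef_inj.
- exact: skew_coef_fin.
- by move=> a k i; rewrite [full_io a * _]ioxz; exact: skew_coef_mon.
- by move=> a k b i; rewrite [full_io a * _]ioxz; exact: skew_coef_mull.
- by move=> a k b i; rewrite [full_io a * _]ioxz; exact: skew_coef_mulr.
Qed.

Lemma is_skew_full f : skew_operator int_data f -> skew_operator full_data f.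
Proof. by elim=> [|g h _ IHg _ IHh|a k _]; [exact: Skew0|exact: SkewD|exact: SkewM]. Qed.

Definition int_incl (f : T) : B := SkewPoly (is_skew_full (skew_funP f)).

Fact int_incl_zmod : zmod_morphism int_incl. Proof. by move=> f g; exact: skew_ext. Qed.
Fact int_incl_monoid : monoid_morphism int_incl.
Proof. by split=> [|f g]; exact: skew_ext. Qed.
HB.instance Definition _ := GRing.isZmodMorphism.Build T B int_incl int_incl_zmod.
HB.instance Definition _ := GRing.isMonoidMorphism.Build T B int_incl int_incl_monoid.

Lemma int_incl_inj : injective int_incl.
Proof. by move=> f g fg; apply: skew_ext => v n; rewrite -[LHS]/(skew_fun (int_incl f) v n) fg. Qed.

Lemma int_inclP b : W U (@skew_coef _ _ full_data) 0 b <-> exists t, int_incl t = b.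
Proof.
split=> [Wb|[t <-] k]; last exact: (@skew_coefA _ _ int_data).
have [N bN] := skew_coef_fin b.
have [f fE] := @skew_poly_of_coef _ _ int_data (skew_coef b) N Wb bN.
by exists f; apply: skew_coef_inj => i; rewrite -fE.
Qed.

Definition int_incl_rev (f : T^c) : B^c := int_incl f.
Fact int_incl_rev_zmod : zmod_morphism int_incl_rev. Proof. exact: int_incl_zmod. Qed.
Fact int_incl_rev_monoid : monoid_morphism int_incl_rev.
Proof. by split=> [|f g]; exact: skew_ext. Qed.
HB.instance Definition _ := GRing.isZmodMorphism.Build T^c B^c int_incl_rev int_incl_rev_zmod.
HB.instance Definition _ := GRing.isMonoidMorphism.Build T^c B^c int_incl_rev int_incl_rev_monoid.

Lemma int_incl_revP (b : B^c) : W U (rev_cf sg (@skew_coef _ _ full_data)) 0 b <->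
  exists t, int_incl_rev t = b.
Proof.
rewrite -[X in _ <-> X]/(exists t, int_incl t = b) -int_inclP; split=> Wb k.
  by have := gp_sgU gp k (Wb k); rewrite /rev_cf -(gp_sgD gp) subrr (gp_sg0 gp).
exact: (gp_sgU gp).
Qed.
End SkewLaurentAlgebra.

Theorem theorem1p1 (G : zmodType) (K : fieldType) (kappa : Type) :
  exists T : algType K,
    [/\ noncommutative T, simple_ring T, dedekind_domain T,
        class_group_isom T G
      & forall g : K0 T, class_group g ->
          exists a : kappa -> set T,
            injective a /\
            forall k, maximal_right_ideal (a k) /\ class_contains g (a k)].
Proof.
have [L [k0 [U [len [sg [gp Uk sgk primes]]]]]] := graded_pid_exists K G kappa.
have sl := full_skew_laurent gp sgk; have gp' := graded_pid_rev gp.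
have sl' := skew_laurent_rev gp sl.
have jI := int_incl_inj (gp := gp) (Uk := Uk) (sgk := sgk).
have jW := int_inclP (gp := gp) Uk (sgk := sgk).
have jW' := int_incl_revP (gp := gp) Uk (sgk := sgk).
set j := (int_incl_rev (gp := gp) (Uk := Uk) (sgk := sgk) : {rmorphism (skew_poly (int_data gp Uk sgk))^c -> (skew_poly (full_data gp sgk))^c}).
have jI' : injective j := jI.
exists (skew_alg (int_data gp Uk sgk)); split.
- exact: (T_noncommutative gp sl jW).
- move=> a [[a0 aD aM] Ma].
  have [[x ax x0]|nx] := pselect (exists2 x, a x & x != 0).
    right; apply/seteqP; split=> // t _.
    exact: (T_simple gp sl jI jW aD Ma (fun t x => aM x t) (ex_intro2 _ _ x ax x0) t).
  left; apply/seteqP; split=> [x ax|x xE]; last by rewrite (xE : x = 0).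
  by apply: contrapT => /eqP x0; apply: nx; exists x.
- split; last exact: (T_dom sl jI).
  split; first exact: (T_submodules_of_progenerators gp sl jI jW).
  exact: (T_submodules_of_progenerators gp' sl' jI' jW').
- exact: (class_group_isomP gp' sl' jI' jW').
move=> g /(class_groupP gp' sl' jI' jW')[a <-].
(* The ideal [W_(-e) p] has the class of [W_(-e)]; hence the sign. *)
have [p [pP pk]] := primes (- fsum a).
pose e := fgen (- fsum a).
have gE : K0_diff (WP gp' sl' jI' jW' a) (fgproj_regular _) =
          K0_diff (WP gp' sl' jI' jW' (- e)) (fgproj_regular _).
  by apply/(K0_diff_WP_eq gp' sl' jI' jW'); rewrite (gp_clN gp) /e fsum_gen opprK.
have mP k := max_ideal_class gp' sl' jI' jW' (pP k).
have mI k k' := max_ideal_inj gp' sl' jW' (pP k) (pP k').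
exists (fun k => max_ideal U (rev_io (full_io gp sgk) : {rmorphism L -> _^c})
  (rev_cf sg (@skew_coef _ _ (full_data gp sgk))) j e (p k)).
split=> [k k' kk'|k]; last by rewrite gE; exact: mP.
apply: contrapT => /pk; apply; rewrite -(subrr e); apply: mI => t.
by move: (congr1 (fun I : _ -> Prop => I t) kk') => /= ->.
Qed.
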